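(* Let conditions (A), (B) and (C) of the context hold, and let $g(y)=f(e^y)$, $G(y)=\int_0^y g(z)\,dz$, $y\in\mathbb{R}$. Then there is a constant $C$ not depending on $n$ such that for all $n\ge1$ $$\left|\mathrm{E} g(X_T)-(2\pi)^{-\frac12}\int_{\mathbb{R}}G(x)\,\mathrm{E}\left(\frac{x-m_{Y,n}}{\sigma_{Y,n}^3}\exp\left\{-\frac{(x-m_{Y,n})^2}{2\sigma_{Y,n}^2}\right\}\right)dx\right|\le C\,n^{-rH},$$ where $r\in(0,1]$ is the Hölder exponent of $\sigma$ in condition (B)(iii) and $H$ is the Hurst index.
   Context: Model. Fix $T>0$, $H\in(\tfrac12,1)$, $b\in\mathbb{R}$, $\alpha>0$ and deterministic $S_0>0$, $Y_0\in\mathbb{R}$. $W$ is a standard Wiener process on $[0,T]$ and $B^H$ is a fractional Brownian motion on $[0,T]$ with Hurst index $H$ (centered Gaussian, covariance $\frac12(s^{2H}+t^{2H}-|t-s|^{2H})$, with continuous paths), independent of $W$. $Y_t=Y_0e^{-\alpha t}+\int_0^te^{-\alpha(t-s)}dB^H_s$ (the solution of $dY_t=-\alpha Y_tdt+dB^H_t$), and $S_t=S_0\exp\{bt+\int_0^t\sigma(Y_s)dW_s-\frac12\int_0^t\sigma^2(Y_s)ds\}$ (the solution of $dS_t=bS_tdt+\sigma(Y_t)S_tdW_t$). Put $X_t=\log S_t$, $X_0=\log S_0$. Condition (A), on $f:\mathbb{R}^+\to\mathbb{R}^+$: (i) $f$ is measurable and $f(x)\le C_f(1+x^p)$, $x\ge0$,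 for some constants $C_f>0$, $p>0$; (ii) $f$ is locally Riemann integrable, possibly having discontinuities of the first kind. Condition (B), on $\sigma:\mathbb{R}\to\mathbb{R}$: there is $C_\sigma>0$ such that (i) $\sigma(x)\ge\sigma_{\min}>0$ for all $x$; (ii) there is $q\in(0,1)$ with $\sigma(x)\le C_\sigma(1+|x|^q)$, $x\in\mathbb{R}$; (iii) there is $r\in(0,1]$ with $|\sigma(x)-\sigma(y)|\le C_\sigma|x-y|^r$, $x,y\in\mathbb{R}$; (iv) $\sigma\in C(\mathbb{R})$ is differentiable Lebesgue-a.e. and there is $q'>0$ with $|\sigma'(x)|\le C_\sigma(1+|x|^{q'})$ for Lebesgue-a.e. $x$. Condition (C): $\left(\int_0^T\sigma^2(Y_s)ds\right)\left(\int_0^T\sigma^{-2}(Y_s)ds\right)-T^2>0$ with probability 1. Discretization. For $n\in\mathbb{N}$ let $t_i=iT/n$, $i=0,\dots,n$, $\Delta B^H_i=B^H_{t_{i+1}}-B^H_{t_i}$, $Y^n_{t_j}=Y_0e^{-\alpha t_j}+e^{-\alpha t_{j-1}}\sum_{i=0}^{j-1}e^{\alpha t_i}\Delta B^H_i$ (so $Y^n_0=Y_0$), and $Y^n_s=Y^n_{t_i}$ for $s\in[t_i,t_{i+1})$. Put $\sigma_{Y,n}^2=\int_0^T\sigma^2(Y^n_s)ds$ (with $\sigma_{Y,n}>0$ its positive square root) and $m_{Y,n}=X_0+bT-\frac12\sigma_{Y,n}^2$. *)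

(* Defs.v *)
From mathcomp Require Import all_boot all_order all_algebra.
From mathcomp Require Import all_classical all_reals all_analysis.

Set Implicit Arguments.
Unset Strict Implicit.
Unset Printing Implicit Defensive.

Import Order.TTheory GRing.Theory Num.Theory.
Import numFieldNormedType.Exports.

Local Open Scope classical_set_scope.
Local Open Scope ring_scope.

(* [is_RS_integral f h a b I]: the Riemann-Stieltjes integral of f with respect
   to h over [a, b] exists, as the limit of tagged sums when the mesh tends to
   0, and equals I.  With h = id this is the Riemann integral. *)
Definition RS_sum (R : realType) (f h : R -> R) (a b : R) (s : seq R)
    (tag : nat -> R) : R :=
  \sum_(i < size s)
    f (tag i) * (h (nth b (a :: s) i.+1) - h (nth b (a :: s) i)).

Definition is_RS_integral (R : realType) (f h : R -> R) (a b I : R) : Prop :=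
  forall e : R, 0 < e -> exists2 delta : R, 0 < delta &
    forall (s : seq R) (tag : nat -> R), itv_partition a b s ->
      (forall i, (i < size s)%N ->
         nth b (a :: s) i <= tag i <= nth b (a :: s) i.+1 /\
         nth b (a :: s) i.+1 - nth b (a :: s) i < delta) ->
      `|RS_sum f h a b s tag - I| < e.

Definition Riemann_integrable (R : realType) (f : R -> R) (a b : R) : Prop :=
  exists I : R, is_RS_integral f id a b I.

(* Functions on R^+ are represented by functions on R of which only the values
   on [0, +oo[ are constrained.  Jump discontinuities are permitted, not
   required, and no condition on the discontinuities is imposed beyond local
   Riemann integrability. *)
Definition conditionA (R : realType) (f : R -> R) : Prop :=
  [/\ forall x, 0 <= x -> 0 <= f x,
      measurable_fun (`[0%R, +oo[%classic : set R) f,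
      exists Cf p : R, [/\ 0 < Cf, 0 < p &
        forall x, 0 <= x -> f x <= Cf * (1 + x `^ p)] &
      forall a b : R, 0 <= a -> a <= b -> Riemann_integrable f a b].

Definition conditionB (R : realType) (sigma : R -> R) (r : R) : Prop :=
  0 < r <= 1 /\
  exists Csigma : R, 0 < Csigma /\
  [/\ exists2 sigma_min : R, 0 < sigma_min & forall x, sigma_min <= sigma x,
      exists2 q : R, 0 < q < 1 &
        forall x, sigma x <= Csigma * (1 + `|x| `^ q),
      forall x y, `|sigma x - sigma y| <= Csigma * `|x - y| `^ r &
      [/\ continuous sigma,
          {ae lebesgue_measure, forall x : R, derivable sigma x 1} &
          exists2 q' : R, 0 < q' &
            {ae lebesgue_measure, forall x : R,
               `|derive1 sigma x| <= Csigma * (1 + `|x| `^ q')}]].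

Section probability.
Context {R : realType} {d : measure_display} {Omega : measurableType d}.
Variable P : probability Omega R.

(* The case v = 0 is separated because [normal_prob m 0] is by convention the
   uniform distribution on [0, 1] and not the Dirac mass at m. *)
Definition has_normal_law (X : Omega -> R) (m v : R) : Prop :=
  0 <= v /\
  if v == 0 then {ae P, forall w, X w = m}
  else forall A : set R, measurable A ->
    P (X @^-1` A) = normal_prob m (Num.sqrt v) A.

Definition gaussian_process (D : set R) (X : R -> Omega -> R) : Prop :=
  forall (k : nat) (t : 'I_k -> R) (a : 'I_k -> R), (forall i, D (t i)) ->
    exists m v, has_normal_law (fun w => \sum_(i < k) a i * X (t i) w) m v.

Definition independent_systems (F G : set (set Omega)) : Prop :=
  forall A B, F A -> G B -> P (A `&` B) = (P A * P B)%E.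

Definition sigma_rv (X : Omega -> R) : set (set Omega) :=
  preimage_set_system setT X measurable.

Definition sigma_process (X : R -> Omega -> R) (D : set R) : set (set Omega) :=
  <<s \bigcup_(t in D) sigma_rv (X t) >>.

Definition standard_wiener (T : R) (W : R -> {RV P >-> R}) : Prop :=
  [/\ {ae P, forall w, W 0 w = 0},
      forall s t, 0 <= s -> s < t -> t <= T ->
        has_normal_law (fun w => W t w - W s w) 0 (t - s),
      forall s t, 0 <= s -> s < t -> t <= T ->
        independent_systems (sigma_process W `[0, s])
                            (sigma_rv (fun w => W t w - W s w)) &
      forall w, {within `[0, T], continuous (fun t => W t w)}].

Definition fractional_brownian (T H : R) (B : R -> {RV P >-> R}) : Prop :=
  [/\ gaussian_process `[0, T] B,
      forall t, 0 <= t <= T -> ('E_P[B t] = 0)%E,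
      forall s t, 0 <= s <= T -> 0 <= t <= T ->
        covariance P (B s) (B t) =
        (2^-1 * (s `^ (2 * H) + t `^ (2 * H) - `|t - s| `^ (2 * H)))%:E &
      forall w, {within `[0, T], continuous (fun t => B t w)}].

Definition natural_filtration (W B : R -> Omega -> R) (t : R) :
    set (set Omega) :=
  <<s sigma_process W `[0, t] `|` sigma_process B `[0, t] >>.

(* The step process sum_(i < sp_size) sp_val i 1_(sp_time i, sp_time i.+1] on
   [0, t], with bounded and F-adapted coefficients. *)
Record simple_process (F : R -> set (set Omega)) (t : R) := SimpleProcess {
  sp_size : nat ;
  sp_time : nat -> R ;
  sp_val : nat -> Omega -> R ;
  sp_time_ge0 : 0 <= sp_time 0 ;
  sp_time_le : sp_time sp_size <= t ;
  sp_time_mono : forall i, (i < sp_size)%N -> sp_time i <= sp_time i.+1 ;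
  sp_adapted : forall i, (i < sp_size)%N -> sigma_rv (sp_val i) `<=` F (sp_time i) ;
  sp_bounded : forall i, (i < sp_size)%N ->
    exists M : R, forall w, `|sp_val i w| <= M }.

Definition sp_eval F t (phi : simple_process F t) (s : R) (w : Omega) : R :=
  \sum_(i < sp_size phi)
    sp_val phi i w * \1_(`]sp_time phi i, sp_time phi i.+1]) s.

Definition sp_integral F t (phi : simple_process F t) (W : R -> Omega -> R)
    (w : Omega) : R :=
  \sum_(i < sp_size phi)
    sp_val phi i w * (W (sp_time phi i.+1) w - W (sp_time phi i) w).

(* [is_ito_integral F W u t I]: I is a version of the Ito integral of u with
   respect to W over [0, t], that is the L^2(P) limit of the integrals of simple
   processes converging to u in L^2(P x ds). *)
Definition is_ito_integral (F : R -> set (set Omega)) (W u : R -> Omega -> R)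
    (t : R) (I : Omega -> R) : Prop :=
  exists phi : nat -> simple_process F t,
    (fun k => \int[P]_w \int[lebesgue_measure]_(s in `[0%R, t])
        (((sp_eval (phi k) s w - u s w) ^+ 2)%:E))%E @ \oo --> 0%E /\
    (fun k => ('E_P[fun w => ((sp_integral (phi k) W w - I w) ^+ 2)%R])%E) @ \oo
      --> 0%E.

(* Y is the fractional Ornstein-Uhlenbeck process driven by B; the integrand
   of the stochastic integral is smooth and deterministic and the integral is
   the pathwise Riemann-Stieltjes one. *)
Definition fractional_OU (T alpha Y0 : R) (B Y : R -> Omega -> R) : Prop :=
  forall t w, 0 <= t <= T ->
    is_RS_integral (fun s => expR (- alpha * (t - s))) (fun s => B s w) 0 t
      (Y t w - Y0 * expR (- alpha * t)).

Definition int_square (T : R) (sigma : R -> R) (y : R -> Omega -> R)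
    (w : Omega) : R :=
  \int[lebesgue_measure]_(s in `[0, T]) (sigma (y s w) ^+ 2).

Definition conditionC (T : R) (sigma : R -> R) (Y : R -> Omega -> R) : Prop :=
  {ae P, forall w,
    0 < int_square T sigma Y w *
        (\int[lebesgue_measure]_(s in `[0, T]) (sigma (Y s w) ^- 2)) - T ^+ 2}.

(* Z t stands for the Ito integral of sigma(Y) over [0, t]. *)
Definition price (S0 b : R) (sigma : R -> R) (Y Z : R -> Omega -> R) (t : R)
    (w : Omega) : R :=
  S0 * expR (b * t + Z t w - 2^-1 * int_square t sigma Y w).

Definition log_price S0 b sigma Y Z t w : R := ln (price S0 b sigma Y Z t w).

End probability.

Section discretization.
Context {R : realType} {Omega : Type}.
Variables (T alpha Y0 : R) (B : R -> Omega -> R) (n : nat).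

Definition grid (i : nat) : R := i%:R * T / n%:R.

(* For j = 0 the sum is empty, so the truncated j.-1 is harmless. *)
Definition Yn_grid (j : nat) (w : Omega) : R :=
  Y0 * expR (- alpha * grid j) +
  expR (- alpha * grid j.-1) *
    \sum_(i < j) expR (alpha * grid i) * (B (grid i.+1) w - B (grid i) w).

(* For s in [grid i, grid i.+1[, [truncn (s * n / T)] is i. *)
Definition Yn (s : R) (w : Omega) : R :=
  Yn_grid (Num.truncn (s * n%:R / T)) w.

End discretization.

(* The oriented integral of g from 0 to y. *)
Definition primitive0 (R : realType) (g : R -> R) (y : R) : R :=
  if 0 <= y then \int[lebesgue_measure]_(z in `[0, y]) g z
  else - \int[lebesgue_measure]_(z in `[y, 0]) g z.

(* Main.v *)
Require Import Defs.
From HB Require Import structures.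
From mathcomp Require Import all_boot all_order all_algebra.
From mathcomp Require Import all_classical all_reals all_analysis.
From mathcomp Require Import measurable_realfun ring lra.

Set Implicit Arguments.
Unset Strict Implicit.
Unset Printing Implicit Defensive.

Import Order.TTheory GRing.Theory Num.Theory.
Import numFieldNormedType.Exports.

Local Open Scope classical_set_scope.
Local Open Scope ring_scope.

(* Conditionally on B, the logarithm of the price is Gaussian with mean
   m - v / 2 and variance v, where v = int_square T sigma Y is the integrated
   variance.  Hence E g(X_T) = E Phi(v) with Phi(v) the Gaussian mean of g, and an
   integration by parts turns the approximating integral into E Phi(v_n), where
   v_n is the integrated variance of the discretized process.  The density of
   N(m - v / 2, v) is Lipschitz in v, with a constant that is exponential in v;
   the exponential moments of v and v_n are finite because Y and Y_n have Gaussian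
   tails and sigma has sublinear growth, and E |v - v_n| is of order n^(-rH) since
   E (Y - Y_n)^2 is of order n^(-2H), by Abel summation in the integrals and sums
   against B and E (B_t - B_s)^2 = (t - s)^(2H).  The conditional law of X_T
   is reached through the Euler sums of the stochastic integral: their conditional
   law is exactly Gaussian (peel off the increments of W one at a time), and they
   converge to the Ito integral by the isometry. *)

(** Since f may jump, nothing can be gained by comparing g(X_T) with an approximation path by path.
    All regularity comes from the Gaussian smoothing given B, and the lower bound on sigma keeps the
    variance above sigma_min^2 T, where the density is smooth in v. For the same reason the L^2
    convergence of the Euler sums says nothing directly about g: it controls Lipschitz test
    functions only. Piecewise linear approximations of indicators of half-lines are therefore
    treated first; they determine the law of X_T, and the identity then extends to every nonnegative
    measurable g. Abel summation succeeds because the integrand exp(alpha s) is monotone. It leaves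
    nonnegative weights on increments of B with a common end point, so that only the variances of
    these increments enter and never their covariances. The exponent rH arises by scaling: (Y - Y_n)
    / n^(-H) has bounded second moments, the Hoelder condition turns the scale n^(-H) into the
    prefactor n^(-rH), and an elementary Young inequality separates the remaining factors, whose
    expectations are bounded uniformly in n. *)

Lemma ge0_integral_law d d' (T : measurableType d) (T' : measurableType d')
    (R : realType) (P : {measure set T -> \bar R}) (m : {measure set T' -> \bar R})
    (X : T -> T') (f : T' -> \bar R) :
  measurable_fun setT X -> (forall A, measurable A -> P (X @^-1` A) = m A) ->
  measurable_fun setT f -> (forall x, 0 <= f x)%E ->
  (\int[P]_w f (X w) = \int[m]_x f x)%E.
Proof.
move=> mX law mf f0; rewrite -[LHS]/(\int[P]_w (f \o X) w)%E.
rewrite -(@ge0_integral_pushforward _ _ _ _ _ X mX P setT)//.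
by apply: (eq_measure_integral m) => A mA _; exact: law.
Qed.

(** * Freezing: integrating out a variable independent of a sigma-algebra *)

Section sub_sigma.
Context {R : realType} {d : measure_display} {Omega : measurableType d}.
Variables (P : probability Omega R) (G : set (set Omega)).
Hypothesis subG : <<s G >> `<=` measurable.

(** The identity, regarded as a random variable with values in [Omega] equipped with the smaller
    sigma-algebra. Its distribution is the restriction of P to that sigma-algebra. *)
Let toG : Omega -> g_sigma_algebraType G := id.

Let measurable_toG : measurable_fun setT toG.
Proof. by move=> _ A mA; rewrite setTI; exact: subG. Qed.

HB.instance Definition _ := isMeasurableFun.Build _ _ _ _ toG measurable_toG.

Lemma measurable_fun_sub_sigma d' (T : measurableType d')
    (X : g_sigma_algebraType G -> T) :
  measurable_fun setT X -> measurable_fun setT (X : Omega -> T).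
Proof. by move=> mX; exact: (measurableT_comp mX measurable_toG). Qed.

Section freezing.
Context d' (T : measurableType d') (m : probability T R) (V : Omega -> T).
Hypothesis mV : measurable_fun setT V.
Hypothesis lawV : forall A, measurable A -> P (V @^-1` A) = m A.
Hypothesis indepV : forall A B, <<s G >> A -> measurable B ->
  P (A `&` V @^-1` B) = (P A * P (V @^-1` B))%E.

(** By independence the pair (identity, V) has as law the product of the restriction of P and of m;
    this is checked on rectangles, and Tonelli's theorem concludes. The function K may depend on the
    whole past through its first argument, so several past-measurable quantities can be frozen at
    once. *)
Lemma integral_freezing (K : g_sigma_algebraType G * T -> \bar R) :
  measurable_fun setT K -> (forall x, 0 <= K x)%E ->
  (\int[P]_w K (w, V w) = \int[P]_w \int[m]_y K (w, y))%E.
Proof.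
move=> mK K0; pose PG := distribution P (toG : {RV P >-> g_sigma_algebraType G}).
pose XV (w : Omega) : g_sigma_algebraType G * T := (w, V w).
have mXV : measurable_fun setT XV.
  by apply/measurable_fun_pairP; split => //; exact: measurable_toG.
rewrite -[LHS]/(\int[P]_w K (XV w))%E (ge0_integral_law (m := (PG \x m)%E) mXV)//.
  rewrite fubini_tonelli1// (ge0_integral_distribution (toG : {RV P >-> g_sigma_algebraType G}))//.
  - exact: measurable_fun_fubini_tonelli_F.
  - by move=> x; exact: integral_ge0.
move=> A mA; pose hXV := isMeasurableFun.Build _ _ _ _ XV mXV.
pose XV' : {RV P >-> (g_sigma_algebraType G * T)%type} := HB.pack XV hXV.
apply/esym; apply: (@product_measure_unique _ _ _ _ _ PG m (distribution P XV')) => //.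
move=> {mA}A B mA mB.
by rewrite /= -lawV// -indepV.
Qed.

End freezing.

End sub_sigma.

(** * Integration against a measure given by a density *)

Section density.
Import HBNNSimple.
Context d (T : measurableType d) (R : realType).
Variables (m m' : {measure set T -> \bar R}) (q : T -> R).
Hypothesis mq : measurable_fun setT q.
Hypothesis q0 : forall x, 0 <= q x.
Hypothesis m'E : forall A, measurable A -> m' A = (\int[m]_(x in A) (q x)%:E)%E.

Let integral_density_nnsfun (h : {nnsfun T >-> R}) :
  (\int[m']_x (h x)%:E = \int[m]_x ((h x)%:E * (q x)%:E))%E.
Proof.
have mqE : measurable_fun setT (EFin \o q) by exact/measurable_EFinP.
rewrite integralT_nnsfun sintegralE.
under [RHS]eq_integral.
  move=> x _; rewrite fimfunE -fsumEFin// ge0_mule_fsuml; last first.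
    by move=> r; rewrite EFinM nnfun_muleindic_ge0.
  over.
rewrite [RHS]ge0_integral_fsum//; last 2 first.
  - move=> r; apply: emeasurable_funM => //.
    exact/measurable_EFinP/measurableT_comp.
  - by move=> r x _; apply: mule_ge0; rewrite ?lee_fin// -lee_fin EFinM nnfun_muleindic_ge0.
apply: eq_fsbigr => r _.
have mr : measurable (h @^-1` [set r]) by [].
under [RHS]eq_integral do rewrite EFinM -muleA.
have [r0|r0] := ltP r 0.
  have -> : h @^-1` [set r] = set0.
    apply/seteqP; split => // x /= hxr.
    by have : 0 <= h x by []; rewrite hxr leNgt r0.
  rewrite measure0 mule0; under eq_integral do rewrite indic0 mul0e mule0.
  by rewrite integral0.
rewrite ge0_integralZl_EFin//.
- congr (_ * _)%E; rewrite m'E// [LHS]integral_mkcond; apply: eq_integral => x _.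
  by rewrite /patch indicE; case: (x \in _); rewrite ?mul1e ?mul0e.
- by move=> x _; rewrite mule_ge0// lee_fin.
- apply: emeasurable_funM => //; apply/measurable_EFinP; exact: measurable_indic.
Qed.

Lemma ge0_integral_density (f : T -> \bar R) : measurable_fun setT f ->
  (forall x, 0 <= f x)%E -> (\int[m']_x f x = \int[m]_x (f x * (q x)%:E))%E.
Proof.
have mqE : measurable_fun setT (EFin \o q) by exact/measurable_EFinP.
move=> mf f0; pose f_ := nnsfun_approx measurableT mf.
transitivity (limn (fun n => \int[m']_x (f_ n x)%:E)%E).
  rewrite -monotone_convergence//=.
  - by apply: eq_integral => x _; apply/esym/cvg_lim => //; exact: cvg_nnsfun_approx.
  - by move=> n; exact/measurable_EFinP/measurable_funTS.
  - by move=> n x _; rewrite lee_fin.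
  - by move=> x _ a b ab; rewrite lee_fin//; exact/lefP/nd_nnsfun_approx.
under eq_fun do rewrite integral_density_nnsfun.
rewrite -monotone_convergence//=.
- apply: eq_integral => x _; apply/cvg_lim => //.
  have fx : (f_ n x)%:E @[n --> \oo] --> f x by exact: cvg_nnsfun_approx.
  exact: cvgeZr.
- by move=> n; apply: emeasurable_funM => //; exact/measurable_EFinP/measurable_funTS.
- by move=> n x _; rewrite mule_ge0// lee_fin.
- move=> x _ a b ab; apply: lee_wpmul2r => //; first by rewrite lee_fin.
  by rewrite lee_fin//; exact/lefP/nd_nnsfun_approx.
Qed.

End density.

(** * Gaussian integrals in closed form *)

Section gaussian.
Context {R : realType}.
Implicit Types (a c m s t u x k : R).
Local Notation mu := (@lebesgue_measure R).

Lemma ge0_integral_normal_prob m s (f : R -> \bar R) : measurable_fun setT f ->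
  (forall x, 0 <= f x)%E ->
  (\int[normal_prob m s]_x f x = \int[mu]_x (f x * (normal_pdf m s x)%:E))%E.
Proof.
move=> mf f0; apply: ge0_integral_density => //.
- exact: measurable_normal_pdf.
- exact: normal_pdf_ge0.
Qed.

Lemma normal_peakE s : 0 < s -> normal_peak s = s^-1 * (Num.sqrt (2 * pi))^-1.
Proof.
move=> s0; rewrite /normal_peak -mulrnAr sqrtrM ?sqr_ge0// sqrtr_sqr gtr0_norm//.
by rewrite invfM mulr_natl.
Qed.

Lemma normal_pdf_expE m s x : 0 < s ->
  normal_pdf m s x =
    s^-1 * (Num.sqrt (2 * pi))^-1 * expR (- ((x - m) ^+ 2 / (2 * s ^+ 2))).
Proof.
move=> s0; rewrite normal_pdfE ?gt_eqF// normal_peakE// /normal_fun; congr (_ * expR _).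
by rewrite mulNr mulr_natl.
Qed.

(** Completion of the square. Exponential moments are thereby reduced to the total mass of a shifted
    density. *)
Lemma normal_pdf_tilt a m s x : 0 < s ->
  expR (a * x) * normal_pdf m s x =
  expR (a * m + a ^+ 2 * s ^+ 2 / 2) * normal_pdf (m + a * s ^+ 2) s x.
Proof.
move=> s0; rewrite !normal_pdf_expE// !(mulrC (s^-1 * _)) !mulrA -!expRD.
by congr (expR _ / _ / _); field; rewrite gt_eqF.
Qed.

Lemma integral_normal_pdfZ k m s : 0 <= k ->
  (\int[mu]_x (k * normal_pdf m s x)%:E = k%:E)%E.
Proof.
move=> k0; under eq_integral do rewrite EFinM.
rewrite ge0_integralZl_EFin//= ?integral_normal_pdf ?mule1//.
- by move=> x _; rewrite lee_fin normal_pdf_ge0.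
- by apply/measurable_EFinP; exact: measurable_normal_pdf.
Qed.

Lemma integral_normal_exp a m s : 0 < s ->
  (\int[mu]_x (expR (a * x) * normal_pdf m s x)%:E =
   (expR (a * m + a ^+ 2 * s ^+ 2 / 2))%:E)%E.
Proof.
move=> s0; under eq_integral do rewrite normal_pdf_tilt//.
by rewrite integral_normal_pdfZ// expR_ge0.
Qed.

(** Bayes' factorization: as a function of z, the product of the two densities is the marginal
    density of x times the density of z given x, which has mean c (x - u) t^2 / S^2, standard
    deviation s t / S and mass 1. This is the step by which one increment of W is integrated out of
    an Euler sum. *)
Lemma normal_pdf_convolution c s t u x : 0 < s -> 0 < t ->
  (\int[normal_prob 0 t]_z (normal_pdf (u + c * z) s x)%:E =
   (normal_pdf u (Num.sqrt (s ^+ 2 + c ^+ 2 * t ^+ 2)) x)%:E)%E.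
Proof.
move=> s0 t0; set S := Num.sqrt _.
have S2 : S ^+ 2 = s ^+ 2 + c ^+ 2 * t ^+ 2.
  by rewrite sqr_sqrtr// addr_ge0 ?sqr_ge0// mulr_ge0 ?sqr_ge0.
have S0 : 0 < S by rewrite sqrtr_gt0 ltr_pwDl ?exprn_gt0// mulr_ge0 ?sqr_ge0.
have mpdf : measurable_fun setT (fun z => normal_pdf (u + c * z) s x).
  rewrite (_ : (fun z => _) = fun z => s^-1 * (Num.sqrt (2 * pi))^-1 *
      expR (- ((x - (u + c * z)) ^+ 2 / (2 * s ^+ 2)))); last first.
    by apply/funext => z; rewrite normal_pdf_expE.
  apply: measurable_funM => //; apply: measurableT_comp => //.
  apply: measurable_funN; apply: measurable_funM => //.
  apply: measurable_funX; apply: measurable_funB => //.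
  by apply: measurable_funD => //; exact: measurable_funM.
rewrite ge0_integral_normal_prob; last 2 first.
- exact/measurable_EFinP.
- by move=> z; rewrite lee_fin normal_pdf_ge0.
under eq_integral => z _.
  rewrite -EFinM (_ : _ * _ = normal_pdf u S x *
      normal_pdf (c * (x - u) * t ^+ 2 / S ^+ 2) (s * t / S) z); last first.
    rewrite !normal_pdf_expE// ?divr_gt0 ?mulr_gt0//.
    rewrite mulrACA [RHS]mulrACA -!expRD; congr (_ * expR _).
      by field; rewrite !gt_eqF//= sqrtr_gt0 mulr_gt0// pi_gt0.
    rewrite subr0 [in RHS]exprMn exprVn exprMn S2; field.
    by rewrite exprMn -S2 !gt_eqF// exprn_gt0.
  over.
by rewrite /= integral_normal_pdfZ// normal_pdf_ge0.
Qed.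

Let measurable_center_pdf m s (h : R -> R) : measurable_fun setT h ->
  measurable_fun setT (fun x => (h (x - m) * normal_pdf m s x)%:E).
Proof.
move=> mh; apply/measurable_EFinP; apply: measurable_funM.
  by apply: (measurableT_comp mh); exact: measurable_funB.
exact: measurable_normal_pdf.
Qed.

(* With v = s^2 and k = (2 + u) u / (2 v), both [E exp (k X^2)] for u < 0 and
   [E exp (- k X^2)] for u > 0 are equal to 1 / (1 + u) for the centered law. *)
Let integral_normal_exp_sqr m s u : 0 < s -> -1 < u ->
  (\int[mu]_x (expR (- ((2 + u) * u / (2 * s ^+ 2)) * (x - m) ^+ 2) *
               normal_pdf m s x)%:E = ((1 + u)^-1)%:E)%E.
Proof.
move=> s0 u1; have u0 : 0 < 1 + u by lra.
have k0 : 0 <= (1 + u)^-1 by rewrite invr_ge0 ltW.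
rewrite -[RHS](integral_normal_pdfZ m (s / (1 + u)) k0).
apply: eq_integral => x _; congr (_ %:E).
rewrite !normal_pdf_expE ?divr_gt0//.
rewrite mulrCA -expRD [RHS]mulrA; congr (_ * expR _).
  by field; rewrite !gt_eqF//= sqrtr_gt0 mulr_gt0// pi_gt0.
by field; rewrite !gt_eqF.
Qed.

(** The inequalities 1 + k y^2 <= exp (k y^2) and 1 - k y^2 <= exp (- k y^2) squeeze the second
    moment between exponential integrals known exactly. Both bounds tend to s^2 as u tends to 0. *)
Lemma integral_normal_var m s : 0 < s ->
  (\int[mu]_x ((x - m) ^+ 2 * normal_pdf m s x)%:E = (s ^+ 2)%:E)%E.
Proof.
move=> s0; set M := (\int[mu]_x _)%E.
have M0 : (0 <= M)%E.
  by apply: integral_ge0 => x _; rewrite lee_fin mulr_ge0 ?sqr_ge0// normal_pdf_ge0.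
have mX2 : measurable_fun setT (fun y : R => y ^+ 2) by exact: measurable_funX.
have mexp k : measurable_fun setT (fun y : R => expR (k * y ^+ 2)).
  by apply: measurableT_comp => //; exact: measurable_funM.
have s2 : 0 < s ^+ 2 by rewrite exprn_gt0.
have upper u : 0 < u < 1 -> (((2 - u) * u / (2 * s ^+ 2))%:E * M <= (u / (1 - u))%:E)%E.
  move=> /andP[u0 u1]; set k := (2 - u) * u / (2 * s ^+ 2).
  have k0 : 0 < k by rewrite divr_gt0 ?mulr_gt0//; lra.
  have := @integral_normal_exp_sqr m s (- u) s0; rewrite ltrN2 => /(_ u1).
  have -> : - ((2 + - u) * - u / (2 * s ^+ 2)) = k by rewrite /k; lra.
  move=> E.
  have : ((1%:E + k%:E * M) <= ((1 - u)^-1)%:E)%E.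
    rewrite -E -(integral_normal_pdfZ m s ler01) -ge0_integralZl_EFin//; last 3 first.
    - by move=> x _; rewrite lee_fin mulr_ge0 ?sqr_ge0// normal_pdf_ge0.
    - exact: (@measurable_center_pdf m s (fun y => y ^+ 2)).
    - exact: ltW.
    rewrite -ge0_integralD//=; last 4 first.
    - by move=> x _; rewrite lee_fin mul1r normal_pdf_ge0.
    - by apply/measurable_EFinP; apply: measurable_funM => //; exact: measurable_normal_pdf.
    - by move=> x _; rewrite -EFinM lee_fin mulr_ge0 ?(ltW k0)// mulr_ge0 ?sqr_ge0// normal_pdf_ge0.
    - apply: emeasurable_funM => //.
      exact: (@measurable_center_pdf m s (fun y => y ^+ 2)).
    apply: ge0_le_integral => //.
    - move=> x _; rewrite -EFinM -EFinD lee_fin addr_ge0 ?mul1r ?normal_pdf_ge0//.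
      by rewrite mulr_ge0 ?(ltW k0)// mulr_ge0 ?sqr_ge0// normal_pdf_ge0.
    - apply: emeasurable_funD; first by apply/measurable_EFinP; apply: measurable_funM => //; exact: measurable_normal_pdf.
      apply: emeasurable_funM => //.
      exact: (@measurable_center_pdf m s (fun y => y ^+ 2)).
    - exact: (@measurable_center_pdf m s (fun y => expR (k * y ^+ 2))).
    - move=> x _; rewrite -EFinM -EFinD lee_fin mulrA -mulrDl.
      by rewrite ler_wpM2r ?normal_pdf_ge0// expR_ge1Dx.
  rewrite addeC -leeBrDr// -EFinB => /le_trans; apply; rewrite lee_fin.
  by rewrite le_eqVlt; apply/orP; left; apply/eqP; field; lra.
have Mfin : M \is a fin_num.
  rewrite ge0_fin_numE// ltNge leye_eq; apply/negP => /eqP My.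
  (* A single instance of the upper bound already excludes an infinite second moment. *)
  have := upper 2^-1 ltac:(lra); rewrite My gt0_muley//.
  by rewrite lte_fin divr_gt0 ?mulr_gt0//; lra.
move: M0 upper; rewrite -(fineK Mfin); set v := fine M => v0 upper.
have lower u : 0 < u < 1 -> u / (1 + u) <= (2 + u) * u / (2 * s ^+ 2) * v.
  move=> /andP[u0 u1]; set k := (2 + u) * u / (2 * s ^+ 2).
  have k0 : 0 < k by rewrite divr_gt0 ?mulr_gt0//; lra.
  have /(_ ltac:(lra)) := @integral_normal_exp_sqr m s u s0; rewrite -/k => E.
  have : (1%:E <= ((1 + u)^-1)%:E + k%:E * M)%E.
    rewrite -E -(integral_normal_pdfZ m s ler01) -ge0_integralZl_EFin//; last 3 first.
    - by move=> x _; rewrite lee_fin mulr_ge0 ?sqr_ge0// normal_pdf_ge0.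
    - exact: (@measurable_center_pdf m s (fun y => y ^+ 2)).
    - exact: ltW.
    rewrite -ge0_integralD//=; last 4 first.
    - by move=> x _; rewrite lee_fin mulr_ge0 ?expR_ge0// normal_pdf_ge0.
    - exact: (@measurable_center_pdf m s (fun y => expR (- k * y ^+ 2))).
    - by move=> x _; rewrite -EFinM lee_fin mulr_ge0 ?(ltW k0)// mulr_ge0 ?sqr_ge0// normal_pdf_ge0.
    - apply: emeasurable_funM => //.
      exact: (@measurable_center_pdf m s (fun y => y ^+ 2)).
    apply: ge0_le_integral => //.
    - by move=> x _; rewrite lee_fin mul1r normal_pdf_ge0.
    - by apply/measurable_EFinP; apply: measurable_funM => //; exact: measurable_normal_pdf.
    - apply: emeasurable_funD; first exact: (@measurable_center_pdf m s (fun y => expR (- k * y ^+ 2))).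
      apply: emeasurable_funM => //.
      exact: (@measurable_center_pdf m s (fun y => y ^+ 2)).
    - move=> x _; rewrite -EFinM -EFinD lee_fin (mulrA k) -mulrDl.
      rewrite ler_wpM2r ?normal_pdf_ge0//.
      by have := expR_ge1Dx (- k * (x - m) ^+ 2); lra.
  rewrite -(fineK Mfin) -/v -EFinM -EFinD lee_fin -lerBlDl; apply: le_trans.
  by rewrite le_eqVlt; apply/orP; left; apply/eqP; field; lra.
have {}upper u : 0 < u < 1 -> (1 - u) * (2 - u) * v <= 2 * s ^+ 2.
  move=> u01; have /andP[u0 u1] := u01; have := upper u u01.
  rewrite -EFinM lee_fin -(ler_pM2l (_ : 0 < (1 - u) * (2 * s ^+ 2) / u)); last first.
    by rewrite divr_gt0 ?mulr_gt0//; lra.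
  have -> : (1 - u) * (2 * s ^+ 2) / u * ((2 - u) * u / (2 * s ^+ 2) * v) = (1 - u) * (2 - u) * v.
    by field; rewrite !gt_eqF.
  by move=> /le_trans; apply; rewrite le_eqVlt; apply/orP; left; apply/eqP; field; lra.
have {}lower u : 0 < u < 1 -> 2 * s ^+ 2 <= (1 + u) * (2 + u) * v.
  move=> u01; have /andP[u0 u1] := u01; have := lower u u01.
  rewrite -(ler_pM2l (_ : 0 < (1 + u) * (2 * s ^+ 2) / u)); last first.
    by rewrite divr_gt0 ?mulr_gt0//; lra.
  have -> : (1 + u) * (2 * s ^+ 2) / u * ((2 + u) * u / (2 * s ^+ 2) * v) = (1 + u) * (2 + u) * v.
    by field; rewrite !gt_eqF.
  by apply: le_trans; rewrite le_eqVlt; apply/orP; left; apply/eqP; field; lra.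
rewrite lee_fin in v0.
congr (_ %:E); apply/eqP; rewrite eq_le; apply/andP; split.
- rewrite leNgt; apply/negP => lt.
  (* Here u v = (v - s^2) / 4, so (1 - u) (2 - u) v >= 2 v - 3 u v exceeds 2 s^2 by at least 5 (v -
     s^2) / 4, against the upper bound. The choice of u in the other case is symmetric. *)
  pose u := (v - s ^+ 2) / (4 * v).
  have v0' : 0 < v by apply: lt_trans lt.
  have uv : u * v = (v - s ^+ 2) / 4 by rewrite /u; field; rewrite gt_eqF.
  have u1 : 0 < u < 1.
    by rewrite divr_gt0 ?subr_gt0 ?mulr_gt0//= /u ltr_pdivrMr ?mulr_gt0//; lra.
  by have := upper u u1; move: u1 => /andP[u0 u1]; nra.
- rewrite leNgt; apply/negP => lt.
  pose u := (s ^+ 2 - v) / (4 * s ^+ 2).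
  have uv : u * s ^+ 2 = (s ^+ 2 - v) / 4 by rewrite /u; field; rewrite gt_eqF.
  have u1 : 0 < u < 1.
    by rewrite divr_gt0 ?subr_gt0 ?mulr_gt0//= /u ltr_pdivrMr ?mulr_gt0//; lra.
  have := lower u u1; move: u1 => /andP[u0 u1].
  have : u * v <= u * s ^+ 2 by rewrite ler_pM2l// ltW.
  by nra.
Qed.

End gaussian.

Lemma ge0_integrable d (T : measurableType d) (R : realType)
    (m : {measure set T -> \bar R}) (f : T -> R) :
  measurable_fun setT f -> (forall x, 0 <= f x) ->
  (\int[m]_x (f x)%:E < +oo)%E -> m.-integrable setT (EFin \o f).
Proof.
move=> mf f0 fy; apply/integrableP; split; first exact/measurable_EFinP.
by under eq_integral do rewrite gee0_abs ?lee_fin//.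
Qed.

(** * Moments and exponential moments of the normal law *)

Section normal_moments.
Context {R : realType}.
Implicit Types (a m s x e : R).

Lemma expR_le_inv x : x < 1 -> expR x <= (1 - x)^-1.
Proof.
move=> x1; rewrite -[leLHS]invrK -expRN lef_pV2 ?posrE ?expR_gt0 ?subr_gt0//.
exact: expR_ge1Dx.
Qed.

Lemma normal_prob_exp a m s : 0 < s ->
  (\int[normal_prob m s]_x (expR (a * x))%:E =
   (expR (a * m + a ^+ 2 * s ^+ 2 / 2))%:E)%E.
Proof.
move=> s0; rewrite ge0_integral_normal_prob.
- by rewrite -integral_normal_exp.
- by apply/measurable_EFinP; apply: measurableT_comp => //; exact: measurable_funM.
- by move=> x; rewrite lee_fin expR_ge0.
Qed.

Lemma normal_prob_var m s : 0 < s ->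
  (\int[normal_prob m s]_x ((x - m) ^+ 2)%:E = (s ^+ 2)%:E)%E.
Proof.
move=> s0; rewrite ge0_integral_normal_prob.
- by rewrite -(integral_normal_var m s0).
- by apply/measurable_EFinP; apply: measurable_funX; exact: measurable_funB.
- by move=> x; rewrite lee_fin sqr_ge0.
Qed.

Lemma integrable_normal_center m s : 0 < s ->
  (normal_prob m s).-integrable setT (fun x => (x - m)%:E).
Proof.
move=> s0; have mf : measurable_fun setT (fun x : R => x - m) by exact: measurable_funB.
apply/integrableP; split; first exact/measurable_EFinP.
apply: (@le_lt_trans _ _ (\int[normal_prob m s]_x (1%:E + ((x - m) ^+ 2)%:E))%E).
  apply: ge0_le_integral => //.
  - by apply: measurableT_comp => //; exact/measurable_EFinP.
  - apply: emeasurable_funD => //; apply/measurable_EFinP; exact: measurable_funX.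
  - move=> x _; rewrite abse_EFin -EFinD lee_fin -(real_normK (num_real (x - m))).
    by have := sqr_ge0 (`|x - m| - 1); have := normr_ge0 (x - m); nra.
rewrite ge0_integralD//.
- by rewrite normal_prob_var// integral_cst//= mul1e probability_setT -EFinD ltry.
- by move=> x _; rewrite lee_fin sqr_ge0.
- by apply/measurable_EFinP; exact: measurable_funX.
Qed.

(** Integrating 1 + a (x - m) <= exp (a (x - m)) gives a M <= exp (a^2 s^2 / 2) - 1 for every real
    a. The right-hand side is of second order at a = 0, which forces M = 0. *)
Lemma normal_prob_mean m s : 0 < s ->
  (\int[normal_prob m s]_x (x - m)%:E = 0)%E.
Proof.
move=> s0; have I := integrable_normal_center m s0.
have Ifin := integrable_fin_num measurableT I.
move: (fineK Ifin); set M := fine _ => ME.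
have s2 : 0 < s ^+ 2 by rewrite exprn_gt0.
have bnd a : a * M <= expR (a ^+ 2 * s ^+ 2 / 2) - 1.
  have Eexp : (\int[normal_prob m s]_x (expR (a * (x - m)))%:E)%E =
      (expR (a ^+ 2 * s ^+ 2 / 2))%:E.
    under eq_integral do rewrite mulrBr addrC expRD EFinM.
    rewrite ge0_integralZl_EFin ?expR_ge0//.
    - rewrite normal_prob_exp// -EFinM -expRD; congr (expR _)%:E; lra.
    - by apply/measurable_EFinP; apply: measurableT_comp => //; exact: measurable_funM.
  have Iexp : (normal_prob m s).-integrable setT (EFin \o (fun x => expR (a * (x - m)))).
    apply: ge0_integrable => [|x|]; last by rewrite Eexp ltry.
      apply: measurableT_comp => //; apply: measurable_funM => //.
      exact: measurable_funB.
    exact: expR_ge0.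
  rewrite -lee_fin EFinM ME -integralZl// EFinB -Eexp.
  rewrite leeBrDr// -(_ : \int[normal_prob m s]_x 1 = 1)%E; last first.
    by rewrite integral_cst//= mul1e probability_setT.
  rewrite -integralD//=; last 2 first.
  - exact: (@integrableZl _ _ _ (normal_prob m s)).
  - exact: (finite_measure_integrable_cst (normal_prob m s) 1).
  apply: le_integral => //.
  - apply: integrableD => //; first exact: (@integrableZl _ _ _ (normal_prob m s)).
    exact: (finite_measure_integrable_cst (normal_prob m s) 1).
  - by move=> x _; rewrite -EFinM -EFinD lee_fin addrC expR_ge1Dx.
rewrite -ME; congr (_ %:E).
(* For y <= 1/2, exp y <= 1 / (1 - y) <= 1 + 2 y, used with y = a^2 s^2 / 2. *)
have key (a : R) : a ^+ 2 * s ^+ 2 <= 1 -> a * M <= a ^+ 2 * s ^+ 2.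
  move=> a1; apply: (le_trans (bnd a)).
  have y0 : 0 <= a ^+ 2 * s ^+ 2 by rewrite mulr_ge0 ?sqr_ge0.
  have : expR (a ^+ 2 * s ^+ 2 / 2) <= 1 + 2 * (a ^+ 2 * s ^+ 2 / 2).
    apply: (le_trans (expR_le_inv _)); first lra.
    rewrite -[leLHS]mul1r ler_pdivrMr; last lra.
    by move: (_ * _) y0 a1 => y y0 y1; nra.
  lra.
apply/eqP; rewrite -sqrf_eq0 eq_le sqr_ge0 andbT leNgt; apply/negP => M2.
(* With a = k M, the inequality [key] reads k M^2 <= (k M^2) (k s^2). The value of k makes k s^2 <=
   1/2 and k M^2 <= 1, hence a contradiction when M^2 > 0. *)
pose k := (2 * s ^+ 2 + M ^+ 2 + 1)^-1.
have d0 : 0 < 2 * s ^+ 2 + M ^+ 2 + 1 by lra.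
have k0 : 0 < k by rewrite invr_gt0.
have ks : k * s ^+ 2 <= 2^-1 by rewrite mulrC ler_pdivrMr//; lra.
have kM : k * M ^+ 2 <= 1 by rewrite mulrC ler_pdivrMr//; lra.
have ks0 : 0 <= k * s ^+ 2 by rewrite mulr_ge0 ?ltW.
have E : (k * M) ^+ 2 * s ^+ 2 = (k * M ^+ 2) * (k * s ^+ 2) by ring.
have /key : (k * M) ^+ 2 * s ^+ 2 <= 1 by rewrite E; nra.
have p0 : 0 < k * M ^+ 2 by rewrite mulr_gt0.
have -> : k * M * M = k * M ^+ 2 by rewrite expr2 mulrA.
by rewrite E; nra.
Qed.

Lemma normal_prob_sqr m s : 0 < s ->
  (\int[normal_prob m s]_x (x ^+ 2)%:E = (m ^+ 2 + s ^+ 2)%:E)%E.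
Proof.
move=> s0; pose g := normal_prob m s.
have Ivar : g.-integrable setT (EFin \o (fun x => (x - m) ^+ 2)).
  apply: ge0_integrable => [|x|]; last by rewrite normal_prob_var ?ltry.
    by apply: measurable_funX; exact: measurable_funB.
  exact: sqr_ge0.
have Imean := integrable_normal_center m s0.
have Icst := finite_measure_integrable_cst g (m ^+ 2) measurableT.
transitivity (\int[g]_x (((x - m) ^+ 2)%:E + ((2 * m)%:E * (x - m)%:E + (m ^+ 2)%:E)))%E.
  by apply: eq_integral => x _; rewrite -EFinM -!EFinD; congr (_ %:E); ring.
have IZ := integrableZl measurableT (2 * m) Imean.
rewrite integralD//; last exact: integrableD.
rewrite integralD// normal_prob_var// integralZl// normal_prob_mean// mule0 add0e.
by rewrite integral_cst//= probability_setT mule1 -EFinD addrC.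
Qed.

(* [x ^ 2 <= 2 m ^ 2 + 2 (x - m) ^ 2], and the exponential of the second term
   is absorbed by doubling the standard deviation. *)
Lemma normal_prob_exp_sqr m s e : 0 < s -> 0 <= e -> 8 * e * s ^+ 2 <= 1 ->
  (\int[normal_prob m s]_x (expR (e * x ^+ 2))%:E <=
   (2 * expR (2 * e * m ^+ 2))%:E)%E.
Proof.
move=> s0 e0 es.
have c0 : 0 <= 2 * expR (2 * e * m ^+ 2) by rewrite mulr_ge0 ?expR_ge0.
rewrite -(integral_normal_pdfZ m (2 * s) c0) ge0_integral_normal_prob; last 2 first.
- apply/measurable_EFinP; apply: measurableT_comp => //; exact: measurable_funM.
- by move=> x; rewrite lee_fin expR_ge0.
apply: ge0_le_integral => //.
- by move=> x _; rewrite -EFinM lee_fin mulr_ge0 ?expR_ge0// normal_pdf_ge0.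
- apply: emeasurable_funM; apply/measurable_EFinP; last exact: measurable_normal_pdf.
  apply: measurableT_comp => //; exact: measurable_funM.
- apply/measurable_EFinP; apply: measurable_funM => //; exact: measurable_normal_pdf.
move=> x _; rewrite -EFinM lee_fin !normal_pdf_expE ?mulr_gt0//.
have p0 : 0 < Num.sqrt (2 * pi) :> R by rewrite sqrtr_gt0 mulr_gt0// pi_gt0.
rewrite mulrCA -expRD [leRHS]mulrACA -expRD.
have -> : 2 * ((2 * s)^-1 / Num.sqrt (2 * pi)) = s^-1 / Num.sqrt (2 * pi).
  by field; rewrite !gt_eqF.
apply: ler_wpM2l; first by rewrite ltW// divr_gt0 ?invr_gt0.
rewrite ler_expR.
have -> : (x - m) ^+ 2 / (2 * (2 * s) ^+ 2) = (x - m) ^+ 2 / (2 * s ^+ 2) / 4.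
  by field; rewrite gt_eqF.
have E : 2 * e * (x - m) ^+ 2 <= (x - m) ^+ 2 / (2 * s ^+ 2) / 2.
  rewrite -subr_ge0 (_ : _ - _ = (1 - 8 * e * s ^+ 2) * ((x - m) ^+ 2 / (4 * s ^+ 2))).
    by rewrite mulr_ge0 ?subr_ge0// divr_ge0 ?sqr_ge0// mulr_ge0 ?sqr_ge0.
  by field; rewrite gt_eqF.
have : 0 <= (x - m) ^+ 2 / (2 * s ^+ 2) by rewrite divr_ge0 ?sqr_ge0// mulr_ge0 ?sqr_ge0.
have := sqr_ge0 (x - 2 * m); nra.
Qed.

End normal_moments.

(** * Random variables with a possibly degenerate normal law *)

Section normal_law.
Context {R : realType} {d : measure_display} {Omega : measurableType d}.
Variable P : probability Omega R.
Implicit Types (X : Omega -> R) (m v e K : R).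

Lemma ge0_integral_normal_law X m v (f : R -> \bar R) : measurable_fun setT X ->
  has_normal_law P X m v -> v != 0 ->
  measurable_fun setT f -> (forall x, 0 <= f x)%E ->
  (\int[P]_w f (X w) = \int[normal_prob m (Num.sqrt v)]_x f x)%E.
Proof.
move=> mX [_ + v0] mf f0; rewrite (negbTE v0) => law.
exact: (ge0_integral_law (m := normal_prob m (Num.sqrt v)) mX).
Qed.

Lemma normal_law_sqr X m v : measurable_fun setT X -> has_normal_law P X m v ->
  (\int[P]_w (X w ^+ 2)%:E = (m ^+ 2 + v)%:E)%E.
Proof.
move=> mX law; have [v0 +] := law.
have [->|vn0] := eqVneq v 0.
  move=> Xm; rewrite (ge0_ae_eq_integral (g := cst (m ^+ 2)%:E))//.
  - by rewrite integral_cst//= probability_setT mule1 addr0.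
  - by apply/measurable_EFinP; exact: measurable_funX.
  - by move=> w _; rewrite lee_fin sqr_ge0.
  - by move=> w _; rewrite lee_fin sqr_ge0.
  - by apply: filterS Xm => w -> _.
move=> _; have vp : 0 < v by rewrite lt_neqAle eq_sym vn0.
rewrite (ge0_integral_normal_law (f := fun x => (x ^+ 2)%:E) mX law)//.
- by rewrite normal_prob_sqr ?sqrtr_gt0// sqr_sqrtr.
- by apply/measurable_EFinP; exact: measurable_funX.
- by move=> x; rewrite lee_fin sqr_ge0.
Qed.

(** For a Gaussian variable a bound K on the second moment m^2 + v controls both parameters, hence
    also an exponential moment of the square. The universal constant 4 is 2 exp (2 e m^2) with 2 e
    m^2 <= 1/4, the exponential being bounded by 2. *)
Lemma normal_law_exp_sqr X m v e K : measurable_fun setT X ->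
  has_normal_law P X m v -> 0 <= e -> 8 * e * K <= 1 ->
  (\int[P]_w (X w ^+ 2)%:E <= K%:E)%E ->
  (\int[P]_w (expR (e * X w ^+ 2))%:E <= 4%:E)%E.
Proof.
move=> mX law e0 eK; rewrite (normal_law_sqr mX law) lee_fin => mvK.
have [v0 +] := law.
have m20 := sqr_ge0 m.
have mexp : measurable_fun setT (fun x : R => (expR (e * x ^+ 2))%:E).
  by apply/measurable_EFinP; apply: measurableT_comp => //; exact: measurable_funM.
have em : 2 * e * m ^+ 2 <= 4^-1 by nra.
have em0 : 0 <= 2 * e * m ^+ 2 by nra.
have expm : expR (2 * e * m ^+ 2) <= 2.
  apply: (le_trans (expR_le_inv _)); first lra.
  rewrite -[leLHS]mul1r ler_pdivrMr; lra.
have [v00|vn0] := eqVneq v 0.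
  move=> Xm; rewrite (ge0_ae_eq_integral (g := cst (expR (e * m ^+ 2))%:E))//.
  - rewrite integral_cst//= probability_setT mule1 lee_fin.
    apply: (le_trans (y := 2)); last lra.
    by apply: le_trans expm; rewrite ler_expR; lra.
  - exact: (measurableT_comp mexp).
  - by move=> w _; rewrite lee_fin expR_ge0.
  - by apply: filterS Xm => w -> _.
move=> _; have vp : 0 < v by rewrite lt_neqAle eq_sym vn0.
rewrite (ge0_integral_normal_law (f := fun x => (expR (e * x ^+ 2))%:E) mX law)//.
  apply: (le_trans (normal_prob_exp_sqr _ _ e0 _)); rewrite ?sqrtr_gt0 ?sqr_sqrtr//; first nra.
  by rewrite lee_fin; lra.
Qed.

End normal_law.

(** * The Gaussian density as a function of its variance *)

Section normal_mixture_estimates.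
Context {R : realType}.
Implicit Types (a m s t u v x y : R).
Local Notation mu := (@lebesgue_measure R).

Lemma sqr_le_expR_norm u : u ^+ 2 <= 4 * expR `|u|.
Proof.
have h : 1 + `|u| / 2 <= expR (`|u| / 2) by exact: expR_ge1Dx.
have -> : expR `|u| = expR (`|u| / 2) ^+ 2 by rewrite -expRM_natl; congr expR; lra.
rewrite -(real_normK (num_real u)); have := normr_ge0 u; nra.
Qed.

Lemma normr_le_expR u : `|u| <= expR `|u|.
Proof. by have := expR_ge1Dx `|u|; lra. Qed.

Lemma expR_norm_le a u : 0 <= a -> expR (a * `|u|) <= expR (a * u) + expR (- a * u).
Proof.
move=> a0; have := expR_ge0 (a * u); have := expR_ge0 (- a * u).
by case: (ger0P u) => _; rewrite ?mulrN -?mulNr; lra.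
Qed.

Lemma expR_lip x y : `|expR x - expR y| <= `|x - y| * expR (Num.max x y).
Proof.
wlog xy : x y / y <= x.
  move=> H; have /orP[yx|xy] := le_total y x; first exact: H.
  by rewrite (distrC (expR _)) (distrC x) maxC; exact: H.
rewrite max_l// !ger0_norm ?subr_ge0 ?ler_expR//.
have := expR_ge1Dx (y - x); have := expR_gt0 x.
rewrite expRD expRN => x0 h.
have -> : expR y = expR x * (expR y / expR x) by rewrite mulrC divfK ?gt_eqF.
by nra.
Qed.

Lemma ln_lip (v0 v v' : R) : 0 < v0 -> v0 <= v -> v0 <= v' ->
  `|ln v - ln v'| <= `|v - v'| / v0.
Proof.
move=> v00; wlog vv : v v' / v' <= v.
  move=> H V V'; have /orP[vv|vv] := le_total v' v; first exact: H.
  by rewrite (distrC v) (distrC (ln v)); exact: H.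
move=> V V'; have v'0 : 0 < v' by exact: lt_le_trans V'.
have vp : 0 < v by exact: lt_le_trans V.
rewrite !ger0_norm ?subr_ge0 ?ler_ln ?posrE// -ln_div ?posrE//.
have -> : v / v' = 1 + (v - v') / v' by field; rewrite gt_eqF.
apply: (@le_trans _ _ ((v - v') / v')).
  by apply: le_ln1Dx; apply: lt_le_trans (_ : 0 <= _); rewrite ?ltrN10// divr_ge0 ?subr_ge0// ltW.
by rewrite ler_wpM2l ?subr_ge0// lef_pV2 ?posrE.
Qed.

(* The Gaussian law of the log-price given a total variance [v]. *)
Definition lognormal_pdf m v x := normal_pdf (m - v / 2) (Num.sqrt v) x.

(** The common majorant of densities, of their differences and of kernels. The sum of two
    exponentials dominates exp (a |x - m|) while its integral against the Gaussian factor stays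
    explicit. *)
Definition envelope a m v x :=
  (expR (a * (x - m)) + expR (- a * (x - m))) * expR (- ((x - m) ^+ 2 / (2 * v))).

Lemma envelope_ge0 a m v x : 0 <= envelope a m v x.
Proof. by rewrite mulr_ge0 ?addr_ge0 ?expR_ge0. Qed.

Lemma measurable_envelope a m v : measurable_fun setT (envelope a m v).
Proof.
have mx : measurable_fun setT (fun x : R => x - m) by exact: measurable_funB.
apply: measurable_funM.
  by apply: measurable_funD; apply: measurableT_comp => //; exact: measurable_funM.
apply: measurableT_comp => //; apply: measurable_funN; apply: measurable_funM => //.
exact: measurable_funX.
Qed.

Lemma integral_envelope a m v : 0 < v ->
  (\int[mu]_x (envelope a m v x)%:E <=
   (2 * Num.sqrt (2 * pi) * expR ((1 + a ^+ 2 / 2) * v))%:E)%E.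
Proof.
move=> v0; have s0 : 0 < Num.sqrt v by rewrite sqrtr_gt0.
have p0 : 0 < Num.sqrt (2 * pi) :> R by rewrite sqrtr_gt0 mulr_gt0// pi_gt0.
(* The normalizing factor is absorbed into an exponential of v, so that the final bound is purely
   exponential in v. *)
have sv : Num.sqrt v <= expR v.
  have h := expR_ge1Dx v; have := sqr_sqrtr (ltW v0); nra.
pose k a : R := Num.sqrt v * Num.sqrt (2 * pi) * expR (- a * m).
have E a' x : (expR (a' * (x - m)) * expR (- ((x - m) ^+ 2 / (2 * v)))) =
    k a' * (expR (a' * x) * normal_pdf m (Num.sqrt v) x).
  rewrite normal_pdf_expE// sqr_sqrtr ?ltW// /k.
  rewrite mulrBr expRD mulNr.
  by field; rewrite !gt_eqF.
have k0 a' : 0 <= k a' by rewrite /k !mulr_ge0 ?expR_ge0// ltW.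
have mpdf a' : measurable_fun setT (fun x => (expR (a' * x) * normal_pdf m (Num.sqrt v) x)%:E).
  apply/measurable_EFinP; apply: measurable_funM; last exact: measurable_normal_pdf.
  by apply: measurableT_comp => //; exact: measurable_funM.
have pdf0 a' x : (0 <= (expR (a' * x) * normal_pdf m (Num.sqrt v) x)%:E)%E.
  by rewrite lee_fin mulr_ge0 ?expR_ge0 ?normal_pdf_ge0.
pose q a' x : \bar R := (k a' * (expR (a' * x) * normal_pdf m (Num.sqrt v) x))%:E.
have -> : (\int[mu]_x (envelope a m v x)%:E = \int[mu]_x (q a x + q (- a)%R x))%E.
  by apply: eq_integral => x _; rewrite /envelope mulrDl EFinD /q -(E a) -(E (- a)).
have mq a' : measurable_fun setT (q a').
  by rewrite /q; under eq_fun do rewrite EFinM; exact: measurable_funeM.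
have q0 a' x : (0 <= q a' x)%E by rewrite /q EFinM mule_ge0// lee_fin.
have I a' : (\int[mu]_x q a' x =
    (Num.sqrt v * Num.sqrt (2 * pi) * expR (a' ^+ 2 * v / 2))%:E)%E.
  under eq_integral do rewrite /q EFinM.
  rewrite ge0_integralZl_EFin//; last exact: mpdf.
  rewrite integral_normal_exp// -EFinM /k.
  congr (_%:E); rewrite -[LHS]mulrA -expRD sqr_sqrtr ?ltW//; congr (_ * expR _); lra.
rewrite ge0_integralD//; [|exact: mq|exact: mq].
rewrite (I a) (I (- a)) -EFinD lee_fin sqrrN.
have -> : (1 + a ^+ 2 / 2) * v = v + a ^+ 2 * v / 2 by field.
rewrite expRD; set e := expR (_ / 2); set p := Num.sqrt (2 * pi).
have e0 : 0 <= e by exact: expR_ge0.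
have : 0 <= p * e * (expR v - Num.sqrt v) by rewrite !mulr_ge0 ?subr_ge0 ?(ltW p0).
lra.
Qed.

(** The factor v^(-1/2) is moved into the exponent, so that two densities can be compared with
    [expR_lip]. Because the mean is m - v / 2, the linear term (x - m) / 2 does not involve v and
    cancels in differences. *)
Lemma lognormal_pdfE m v x : 0 < v -> lognormal_pdf m v x =
  (Num.sqrt (2 * pi))^-1 *
    expR (- (ln v / 2) - (x - m) ^+ 2 / (2 * v) - (x - m) / 2 - v / 8).
Proof.
move=> v0; rewrite /lognormal_pdf normal_pdf_expE ?sqrtr_gt0// sqr_sqrtr ?ltW//.
have -> : (Num.sqrt v)^-1 = expR (- (ln v / 2)).
  rewrite expRN; congr (_^-1); apply/eqP.
  rewrite -(@eqrXn2 _ 2%N)// ?sqrtr_ge0 ?expR_ge0// sqr_sqrtr ?ltW//.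
  by rewrite -expRM_natl (_ : 2%:R * _ = ln v) ?lnK//; lra.
rewrite mulrC mulrA -expRD mulrC; congr (_ * expR _); field.
by rewrite gt_eqF.
Qed.

(** Above v0 the exponents are Lipschitz in v up to a factor quadratic in x - m, which exp |x - m|
    dominates. The variance v + v' of the envelope is an upper bound of both v and v'. *)
Lemma lognormal_pdf_lip m (v0 : R) : 0 < v0 -> exists2 K : R, 0 <= K &
  forall v v' x, v0 <= v -> v0 <= v' ->
  `|lognormal_pdf m v x - lognormal_pdf m v' x| <=
    `|v - v'| * (K * envelope 2 m (v + v') x).
Proof.
move=> v00; pose p : R := Num.sqrt (2 * pi).
have p0 : 0 < p by rewrite sqrtr_gt0 mulr_gt0// pi_gt0.
(* The three terms are the Lipschitz constants of ln v / 2, of v / 8 and of u^2 / (2 v), the last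
   one after u^2 <= 4 exp |u|. *)
pose K1 := (2 * v0)^-1 + 8^-1 + 2 * v0 ^- 2.
have K10 : 0 <= K1 by rewrite !addr_ge0 ?mulr_ge0 ?invr_ge0 ?exprn_ge0 ?mulr_ge0 ?ltW.
exists (p^-1 * expR (- (ln v0 / 2)) * K1).
  by rewrite !mulr_ge0 ?expR_ge0 ?invr_ge0 ?(ltW p0).
move=> v v' x V V'; have vp : 0 < v by exact: lt_le_trans V.
have v'p : 0 < v' by exact: lt_le_trans V'.
rewrite !lognormal_pdfE// -mulrBr normrM gtr0_norm ?invr_gt0//.
set u := x - m; set A := - _ - _ - _ - _; set B := - (ln v' / 2) - _ - _ - _.
have -> : `|v - v'| * (p^-1 * expR (- (ln v0 / 2)) * K1 * envelope 2 m (v + v') x) =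
    p^-1 * (expR (- (ln v0 / 2)) * (K1 * (`|v - v'| * envelope 2 m (v + v') x))).
  by ring.
rewrite ler_wpM2l ?invr_ge0 ?(ltW p0)// /envelope -/u.
apply: le_trans (expR_lip A B) _.
have AB : `|A - B| <= `|v - v'| * (K1 * expR `|u|).
  have -> : A - B = (v - v') * (u ^+ 2 / (2 * v * v') - 8^-1) - (ln v - ln v') / 2.
    by rewrite /A /B; field; rewrite !gt_eqF.
  apply: le_trans (ler_normB _ _) _; rewrite !normrM (ger0_norm (_ : 0 <= 2^-1))//.
  have h1 := ln_lip v00 V V'.
  have h2 : `|u ^+ 2 / (2 * v * v') - 8^-1| <= 2 * v0 ^- 2 * expR `|u| + 8^-1.
    apply: le_trans (ler_normB _ _) _; rewrite (ger0_norm (_ : 0 <= 8^-1))// lerD2r.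
    rewrite ger0_norm; last first.
      by rewrite divr_ge0 ?sqr_ge0// !mulr_ge0 ?(ltW vp) ?(ltW v'p).
    have -> : 2 * v0 ^- 2 * expR `|u| = 4 * expR `|u| / (2 * v0 ^+ 2) by field; rewrite gt_eqF.
    rewrite ler_pM ?sqr_ge0 ?invr_ge0 ?mulr_ge0 ?(ltW vp) ?(ltW v'p) ?sqr_le_expR_norm//.
    rewrite lef_pV2 ?posrE ?mulr_gt0 ?exprn_gt0// -mulrA ler_pM2l// expr2.
    by rewrite ler_pM ?(ltW v00).
  have e1 : 1 <= expR `|u| by rewrite -expR0 ler_expR.
  have i0 : 0 < v0^-1 by rewrite invr_gt0.
  have -> : `|v - v'| * (K1 * expR `|u|) = `|v - v'| * (2 * v0 ^- 2 * expR `|u| + 8^-1 * expR `|u|) + `|v - v'| / v0 * 2^-1 * expR `|u|.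
    by rewrite /K1; field; rewrite gt_eqF.
  apply: lerD.
    rewrite ler_wpM2l// (le_trans h2)// lerD2l; lra.
  apply: (@le_trans _ _ (`|v - v'| / v0 * 2^-1)); first by rewrite ler_wpM2r.
  by rewrite ler_peMr// mulr_ge0// divr_ge0// ltW.
(* The linear term costs exp (|u| / 2) and the factor exp |u| comes from [AB]; together they are
   below exp (2 |u|), whence the exponent 2 of the envelope. *)
have mAB : expR (Num.max A B) <= expR (- (ln v0 / 2)) * expR (`|u| / 2) *
    expR (- (u ^+ 2 / (2 * (v + v')))).
  rewrite -!expRD ler_expR ge_max.
  have b w : v0 <= w -> w <= v + v' ->
      - (ln w / 2) - u ^+ 2 / (2 * w) - u / 2 - w / 8 <=
      - (ln v0 / 2) + `|u| / 2 - u ^+ 2 / (2 * (v + v')).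
    move=> Vw wv; have w0 : 0 < w by exact: lt_le_trans Vw.
    have h1 : ln v0 <= ln w by rewrite ler_ln ?posrE.
    have h2 : u ^+ 2 / (2 * (v + v')) <= u ^+ 2 / (2 * w).
      by rewrite ler_wpM2l ?sqr_ge0// lef_pV2 ?posrE ?mulr_gt0 ?addr_gt0// ler_pM2l.
    have h3 := ler_norm (- u); rewrite normrN in h3.
    lra.
  by rewrite !b//; lra.
apply: le_trans (ler_pM (normr_ge0 _) (expR_ge0 _) AB mAB) _.
set e1 := expR (- _); set e2 := expR (- _); set e3 := expR (`|u| / 2).
have -> : `|v - v'| * (K1 * expR `|u|) * (e1 * e3 * e2) =
  e1 * (K1 * (`|v - v'| * (expR `|u| * e3 * e2))) by ring.
rewrite ler_wpM2l ?expR_ge0// ler_wpM2l// ler_wpM2l// ler_wpM2r ?expR_ge0//.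
rewrite -expRD; apply: (@le_trans _ _ (expR (2 * `|u|))).
  by rewrite ler_expR; have := normr_ge0 u; lra.
exact: expR_norm_le.
Qed.

End normal_mixture_estimates.

(** * Gaussian means of a function of exponential growth, in terms of the variance *)

Section lognormal_mean.
Context {R : realType}.
Implicit Types (a m u v x : R).
Local Notation mu := (@lebesgue_measure R).

(** Envelopes absorb two-sided exponentials. Of the four products, two make up the sum on the right,
    and each of the two mixed ones is at most that sum, which gives the factor 3. *)
Lemma envelope_mul a a' m v x : 0 <= a -> 0 <= a' ->
  (expR (a * (x - m)) + expR (- a * (x - m))) * envelope a' m v x <=
  3 * envelope (a + a') m v x.
Proof.
move=> a0 a'0; rewrite /envelope !mulrA ler_wpM2r ?expR_ge0//; set u := x - m.
have h b : b <= a + a' -> - b <= a + a' -> expR (b * u) <= expR ((a + a') * u) + expR (- (a + a') * u).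
  move=> b1 b2; apply: le_trans (expR_norm_le u _); last lra.
  rewrite ler_expR; have [u0|u0] := ger0P u; first by rewrite ler_wpM2r.
  by rewrite -[leLHS]mulrNN ler_pM2r ?oppr_gt0.
have h1 := h (a - a') ltac:(lra) ltac:(lra).
have h2 := h (a' - a) ltac:(lra) ltac:(lra).
have E b c : expR (b * u) * expR (c * u) = expR ((b + c) * u) by rewrite -expRD mulrDl.
have -> : (expR (a * u) + expR (- a * u)) * (expR (a' * u) + expR (- a' * u)) =
  expR (a * u) * expR (a' * u) + expR (a * u) * expR (- a' * u) +
  (expR (a' * u) * expR (- a * u) + expR (- a * u) * expR (- a' * u)) by ring.
rewrite !E -(opprD a a'); move: h1 h2.
set A := expR (_ * u); set B := expR (_ * u); set C := expR (_ * u); set D := expR (_ * u).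
lra.
Qed.

Lemma measurable_lognormal_pdf d (T : measurableType d) m (V X : T -> R) :
  measurable_fun setT V -> measurable_fun setT X -> (forall w, 0 < V w) ->
  measurable_fun setT (fun w => lognormal_pdf m (V w) (X w)).
Proof.
move=> mV mX V0.
(* Division by 2 V is written as the exponential of - ln (2 V), so that measurability follows by
   composition. *)
rewrite (_ : (fun w => _) = fun w => (Num.sqrt (2 * pi))^-1 *
    expR (- (ln (V w) / 2) - (X w - m) ^+ 2 * expR (- ln (2 * V w)) - (X w - m) / 2 - V w / 8)); last first.
  apply/funext => w; rewrite lognormal_pdfE// (expRN (ln (2 * V w))) lnK//.
  by rewrite posrE mulr_gt0.
have mXm : measurable_fun setT (fun w => X w - m) by exact: measurable_funB.
apply: measurable_funM => //; apply: measurableT_comp => //.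
apply: measurable_funB; last exact: measurable_funM.
apply: measurable_funB; last exact: measurable_funM.
apply: measurable_funB.
  apply: measurable_funN; apply: measurable_funM => //.
  by apply: measurableT_comp => //; exact: measurable_ln.
apply: measurable_funM; first exact: measurable_funX.
apply: measurableT_comp => //; apply: measurable_funN; apply: measurableT_comp.
  exact: measurable_ln.
exact: measurable_funM.
Qed.

Definition lognormal_mean (h : R -> R) m v : \bar R :=
  (\int[mu]_x (h x * lognormal_pdf m v x)%:E)%E.

Section bounds.
Variables (h : R -> R) (m v0 C a : R).
Hypotheses (mh : measurable_fun setT h) (h0 : forall x, 0 <= h x).
Hypotheses (v00 : 0 < v0) (a0 : 0 <= a) (C0 : 0 <= C).
Hypothesis hC : forall x, h x <= C * (expR (a * (x - m)) + expR (- a * (x - m))).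

Lemma lognormal_pdf_ge0 v x : 0 <= lognormal_pdf m v x.
Proof. exact: normal_pdf_ge0. Qed.

Lemma lognormal_pdf_le : exists2 K : R, 0 <= K &
  forall v x, v0 <= v -> lognormal_pdf m v x <= K * envelope 1 m v x.
Proof.
exists ((Num.sqrt (2 * pi))^-1 * expR (- (ln v0 / 2))).
  by rewrite mulr_ge0 ?expR_ge0// invr_ge0 sqrtr_ge0.
move=> v x v0v; have vp : 0 < v by exact: lt_le_trans v0v.
rewrite lognormal_pdfE// -[leRHS]mulrA ler_wpM2l ?invr_ge0 ?sqrtr_ge0// /envelope.
have h1 : ln v0 <= ln v by rewrite ler_ln ?posrE.
apply: (@le_trans _ _ (expR (- (ln v0 / 2)) * (expR (1 * `|x - m|) * expR (- ((x - m) ^+ 2 / (2 * v)))))).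
  rewrite -!expRD ler_expR.
  by have := ler_norm (- (x - m)); rewrite normrN; have := normr_ge0 (x - m); lra.
by rewrite ler_wpM2l ?expR_ge0// ler_wpM2r ?expR_ge0// expR_norm_le.
Qed.

Let integral_envelope_le (b c v : R) : 0 <= c -> 0 < v ->
  (\int[mu]_x (c * envelope b m v x)%:E <=
   (c * (2 * Num.sqrt (2 * pi)) * expR ((1 + b ^+ 2 / 2) * v))%:E)%E.
Proof.
move=> c0 vp; under eq_integral do rewrite EFinM.
rewrite ge0_integralZl_EFin//.
- by rewrite -mulrA EFinM lee_wpmul2l// integral_envelope.
- by move=> x _; rewrite lee_fin envelope_ge0.
- by apply/measurable_EFinP; exact: measurable_envelope.
Qed.

Let measurable_hpdf v : 0 < v -> measurable_fun setT (fun x => h x * lognormal_pdf m v x).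
Proof. by move=> v_gt0; apply: measurable_funM => //; exact: measurable_lognormal_pdf. Qed.

Lemma lognormal_mean_growth : exists K k : R, [/\ 0 <= K, 0 <= k &
  forall v, v0 <= v -> (lognormal_mean h m v <= (K * expR (k * v))%:E)%E].
Proof.
have [K K0 HK] := lognormal_pdf_le.
exists (3 * K * C * (2 * Num.sqrt (2 * pi))), (1 + (a + 1) ^+ 2 / 2); split.
- by rewrite !mulr_ge0 ?sqrtr_ge0.
- by rewrite addr_ge0 ?divr_ge0 ?sqr_ge0.
move=> v v0v; have vp : 0 < v by exact: lt_le_trans v0v.
have c0 : 0 <= 3 * K * C by rewrite !mulr_ge0.
apply: le_trans (integral_envelope_le (a + 1) c0 vp).
apply: ge0_le_integral => //.
- by move=> x _; rewrite lee_fin mulr_ge0 ?lognormal_pdf_ge0.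
- by apply/measurable_EFinP; exact: measurable_hpdf.
- by apply/measurable_EFinP; apply: measurable_funM => //; exact: measurable_envelope.
move=> x _; rewrite lee_fin.
apply: le_trans (ler_pM (h0 x) (lognormal_pdf_ge0 _ _) (hC x) (HK v x v0v)) _.
have := envelope_mul m v x a0 ler01.
set e := envelope 1 m v x; set q := (_ + _) => qe.
have -> : C * q * (K * e) = C * K * (q * e) by ring.
have -> : 3 * K * C * envelope (a + 1) m v x = C * K * (3 * envelope (a + 1) m v x) by ring.
by rewrite ler_wpM2l// mulr_ge0.
Qed.

Lemma integrable_lognormal_mean v : v0 <= v ->
  mu.-integrable setT (EFin \o (fun x => h x * lognormal_pdf m v x)).
Proof.
move=> v0v; have vp : 0 < v by exact: lt_le_trans v0v.
have [K [k [_ _ /(_ v v0v) H]]] := lognormal_mean_growth.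
apply: ge0_integrable => [|x|]; first exact: measurable_hpdf.
- by rewrite mulr_ge0 ?lognormal_pdf_ge0.
- by apply: le_lt_trans H _; rewrite ltry.
Qed.

(** The Lipschitz bound on the density is integrated against h. The regularity in v is that of the
    density alone, h being only measurable and of exponential growth. *)
Lemma lognormal_mean_lip : exists K k : R, [/\ 0 <= K, 0 <= k &
  forall v v', v0 <= v -> v0 <= v' ->
  (`|lognormal_mean h m v - lognormal_mean h m v'| <=
    (`|v - v'| * (K * expR (k * (v + v'))))%:E)%E].
Proof.
have [K K0 HK] := lognormal_pdf_lip m v00.
exists (3 * K * C * (2 * Num.sqrt (2 * pi))), (1 + (a + 2) ^+ 2 / 2); split.
- by rewrite !mulr_ge0 ?sqrtr_ge0.
- by rewrite addr_ge0 ?divr_ge0 ?sqr_ge0.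
move=> v v' V V'; have vp : 0 < v by exact: lt_le_trans V.
have v'p : 0 < v' by exact: lt_le_trans V'.
have I := integrable_lognormal_mean V; have I' := integrable_lognormal_mean V'.
rewrite /lognormal_mean -integralB//.
apply: le_trans (le_abse_integral _ _ _) _ => //.
  by apply: emeasurable_funB; apply/measurable_EFinP; exact: measurable_hpdf.
have c0 : 0 <= `|v - v'| * (3 * K * C) by rewrite !mulr_ge0.
rewrite mulrA mulrA; apply: le_trans (integral_envelope_le (a + 2) c0 (addr_gt0 vp v'p)).
apply: ge0_le_integral => //.
- apply: measurableT_comp => //.
  by apply: emeasurable_funB; apply/measurable_EFinP; exact: measurable_hpdf.
- by apply/measurable_EFinP; apply: measurable_funM => //; exact: measurable_envelope.
move=> x _; rewrite -[X in (abse X <= _)%E]EFinB abse_EFin lee_fin -mulrBr normrM ger0_norm//.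
apply: le_trans (ler_pM (h0 x) (normr_ge0 _) (hC x) (HK v v' x V V')) _.
have := envelope_mul m (v + v') x a0 (ler0n _ 2).
set e := envelope 2 m _ x; set q := (_ + _) => qe.
have -> : C * q * (`|v - v'| * (K * e)) = `|v - v'| * (C * K) * (q * e) by ring.
have -> : `|v - v'| * (3 * K * C) * envelope (a + 2) m (v + v') x =
  `|v - v'| * (C * K) * (3 * envelope (a + 2) m (v + v') x) by ring.
by rewrite ler_wpM2l// !mulr_ge0.
Qed.

End bounds.

End lognormal_mean.

(** * The kernel of the approximating integral and its antiderivative *)

Section gaussian_kernel.
Context {R : realType}.
Implicit Types (m s x z : R).
Local Notation mu := (@lebesgue_measure R).

(** The normal density up to the factor [Num.sqrt (2 * pi)]. The kernel of the statement is minus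
    its derivative in x. *)
Definition gauss_primitive m s x := s^-1 * expR (- ((x - m) ^+ 2 / (2 * s ^+ 2))).

Definition gauss_kernel m s x :=
  (x - m) / s ^+ 3 * expR (- ((x - m) ^+ 2 / (2 * s ^+ 2))).

Lemma is_derive_gauss_primitive m s x : s != 0 ->
  is_derive x 1 (fun y => - gauss_primitive m s y) (gauss_kernel m s x).
Proof.
move=> s0; rewrite /gauss_primitive /gauss_kernel.
apply: is_derive_eq.
by rewrite /GRing.scale /=; field.
Qed.

Lemma continuous_gauss_kernel m s : continuous (gauss_kernel m s).
Proof.
move=> x; apply: differentiable_continuous; apply/derivable1_diffP.
by rewrite /gauss_kernel; exact: ex_derive.
Qed.

Lemma gauss_primitive_cvgy m s : 0 < s -> gauss_primitive m s x @[x --> +oo] --> 0.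
Proof.
move=> s0; rewrite -[0](mulr0 s^-1); apply: cvgM; first exact: cvg_cst.
have c0 : 0 < (2 * s ^+ 2)^-1 by rewrite invr_gt0 mulr_gt0 ?exprn_gt0.
apply: (@squeeze_cvgr _ _ _ _ (cst 0) (fun x => expR (- ((x - m) * (2 * s ^+ 2)^-1)))).
(* For x >= m + 1 the square of x - m dominates x - m itself. *)
- near=> x; rewrite /= expR_ge0 ler_expR lerN2.
  rewrite ler_pM2r// expr2 ler_peMr//.
    by rewrite subr_ge0; near: x; apply: nbhs_pinfty_ge; rewrite num_real.
  by rewrite lerBrDr; near: x; apply: nbhs_pinfty_ge; rewrite num_real.
- exact: cvg_cst.
- apply: (@cvg_comp _ _ _ (fun x => (x - m) * (2 * s ^+ 2)^-1) (fun y => expR (- y)) _ +oo); last exact: cvgr_expR.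
  by apply: gt0_cvgMly => //; exact: cvg_addrr.
Unshelve. all: by end_near. Qed.

Section tail.
Variables (m s : R).
Hypothesis s0 : 0 < s.

Let derivE x : ((fun y => - gauss_primitive m s y)^`())%classic x = gauss_kernel m s x.
Proof. by rewrite derive1E; have [_ ->] := is_derive_gauss_primitive m x (lt0r_neq0 s0). Qed.

Let cont x : {for x, continuous (fun y => - gauss_primitive m s y)}.
Proof. exact/differentiable_continuous/derivable1_diffP. Qed.

Lemma integrable_gauss_kernel : mu.-integrable setT (EFin \o gauss_kernel m s).
Proof.
have me : measurable_fun setT (fun x => s ^- 3 * envelope 1 m (s ^+ 2) x).
  by apply: measurable_funM => //; exact: measurable_envelope.
apply: (@le_integrable _ _ _ mu setT _ _ (EFin \o (fun x => s ^- 3 * envelope 1 m (s ^+ 2) x))).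
- by [].
- apply/measurable_EFinP; apply: continuous_measurable_fun; exact: continuous_gauss_kernel.
- move=> x _; rewrite !abse_EFin lee_fin /gauss_kernel /envelope.
  rewrite [leRHS]ger0_norm; last first.
    by rewrite mulr_ge0 ?invr_ge0 ?exprn_ge0 ?(ltW s0)// mulr_ge0 ?addr_ge0 ?expR_ge0.
  rewrite !normrM (ger0_norm (expR_ge0 _)) [`|x - m| * _]mulrC -!mulrA.
  rewrite ger0_norm ?invr_ge0 ?exprn_ge0 ?(ltW s0)//.
  rewrite ler_wpM2l ?invr_ge0 ?exprn_ge0 ?(ltW s0)// ler_wpM2r ?expR_ge0//.
  apply: le_trans (normr_le_expR _) _.
  by rewrite -[X in expR X]mul1r expR_norm_le.
apply: ge0_integrable => //.
  by move=> x; rewrite mulr_ge0 ?invr_ge0 ?exprn_ge0 ?(ltW s0)// envelope_ge0.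
under eq_integral do rewrite EFinM.
rewrite ge0_integralZl_EFin//.
- apply: (@le_lt_trans _ _ ((s ^- 3)%:E * (2 * Num.sqrt (2 * pi) * expR ((1 + 1 ^+ 2 / 2) * s ^+ 2))%:E)%E).
    by rewrite lee_wpmul2l ?lee_fin ?invr_ge0 ?exprn_ge0 ?(ltW s0)// integral_envelope// exprn_gt0.
  by rewrite -EFinM ltry.
- by move=> x _; rewrite lee_fin envelope_ge0.
- by apply/measurable_EFinP; exact: measurable_envelope.
- by rewrite invr_ge0 exprn_ge0// ltW.
Qed.

Let tail_ge z : m <= z ->
  (\int[mu]_(x in `[z, +oo[) (gauss_kernel m s x)%:E = (gauss_primitive m s z)%:E)%E.
Proof.
move=> mz; rewrite (@ge0_continuous_FTC2y _ _ (fun y => - gauss_primitive m s y) _ 0).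
- by rewrite sub0e EFinN oppeK.
- move=> x zx; rewrite /gauss_kernel mulr_ge0 ?expR_ge0// divr_ge0 ?exprn_ge0 ?(ltW s0)//.
  by rewrite subr_ge0 (le_trans mz).
- by apply: continuous_subspaceT => x; exact: continuous_gauss_kernel.
- by rewrite -[0]oppr0; apply: cvgN; exact: gauss_primitive_cvgy.
- by [].
- exact/cvg_at_right_filter/cont.
- by move=> x _; exact: derivE.
Qed.

(** The improper fundamental theorem of calculus is applied to an integrand of constant sign, and
    the kernel changes sign at m. For z < m the compact piece from z to m is added to the tail from
    m. *)
Lemma gauss_kernel_tail z :
  (\int[mu]_(x in `[z, +oo[) (gauss_kernel m s x)%:E = (gauss_primitive m s z)%:E)%E.
Proof.
have [/tail_ge//|zm] := leP m z.
have -> : [set` `[z, +oo[] = [set` `[z, m[] `|` [set` `[m, +oo[] :> set R.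
  by rewrite -itv_bndbnd_setU// bnd_simp// ltW.
rewrite integral_setU//; last 2 first.
- by apply: measurable_funTS; exact: (measurable_int _ integrable_gauss_kernel).
- apply/disj_setPS => x [] /=; rewrite !in_itv/= => /andP[_ xm] /andP[mx _].
  by move: xm; rewrite ltNge mx.
rewrite tail_ge// integral_itv_bndo_bndc; last first.
  by apply/measurable_funTS; exact: (measurable_int _ integrable_gauss_kernel).
rewrite (@continuous_FTC2 _ _ (fun y => - gauss_primitive m s y))//.
- by rewrite -EFinB opprK -EFinD; congr (_ %:E); lra.
- by apply: continuous_subspaceT => x; exact: continuous_gauss_kernel.
- split => //; first exact/cvg_at_right_filter/cont.
  exact/cvg_at_left_filter/cont.
Qed.

End tail.

(** Reflection about the origin turns the half-line below m into a tail, since the kernel is odd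
    about its mean. The total integral is therefore 0, and every head is the opposite of the
    corresponding tail. *)
Lemma gauss_kernel_head m s z : 0 < s ->
  (\int[mu]_(x in `]-oo, z]) (gauss_kernel m s x)%:E = (- gauss_primitive m s z)%:E)%E.
Proof.
move=> s0.
have mk D : measurable_fun D (EFin \o gauss_kernel m s).
  by apply: measurable_funTS; exact: (measurable_int _ (integrable_gauss_kernel m s0)).
have split y : (\int[mu]_x (gauss_kernel m s x)%:E =
    \int[mu]_(x in `]-oo, y]) (gauss_kernel m s x)%:E + (gauss_primitive m s y)%:E)%E.
  rewrite -(gauss_kernel_tail m s0 y) -integral_itv_bndo_bndc//.
  rewrite -integral_setU//; last 2 first.
  - exact: mk.
  - apply/disj_setPS => x [] /=; rewrite !in_itv/= => xy; rewrite andbT => yx.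
    by move: xy; rewrite ltNge yx.
  by rewrite -itv_bndbnd_setU// set_itvE.
have half : (\int[mu]_(x in `]-oo, m]) (gauss_kernel m s x)%:E = (- gauss_primitive m s m)%:E)%E.
  have cG : {within `]-oo, (- (- m))%R], continuous (fun x => - gauss_kernel m s x)}.
    by apply: continuous_subspaceT => x; apply: cvgN; exact: continuous_gauss_kernel.
  have := ge0_integration_by_substitutionNy cG.
  rewrite opprK => H.
  have {}H := H _.
  under eq_integral do rewrite -[gauss_kernel m s _]opprK EFinN.
  have neg x : x <= m -> 0 <= - gauss_kernel m s x.
    move=> xm; rewrite /gauss_kernel -mulNr -mulNr.
    by rewrite mulr_ge0 ?expR_ge0// divr_ge0 ?exprn_ge0 ?(ltW s0)// opprB subr_ge0.
  rewrite integral_ge0N; last by move=> x /=; rewrite in_itv/= lee_fin => /neg.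
  rewrite H; last by move=> x; rewrite in_itv/= => /ltW/neg.
  rewrite (_ : (fun x => _) = (fun x => (gauss_kernel (- m) s x)%:E)); last first.
    apply/funext => x /=; rewrite /gauss_kernel; congr (_ %:E).
    by rewrite -mulNr -mulNr; congr (_ * _ * expR (- (_ / _))); [lra|rewrite -sqrrN; congr (_ ^+ 2); lra].
  by rewrite gauss_kernel_tail// /gauss_primitive !subrr.
have fin : (\int[mu]_(x in `]-oo, z]) (gauss_kernel m s x)%:E \is a fin_num)%E.
  apply: integrable_fin_num => //; apply: (integrableS measurableT) => //.
  exact: integrable_gauss_kernel.
have := split z; rewrite (split m) half -EFinD addNr => /esym/eqP.
rewrite -(fineK fin) -EFinD eqe addr_eq0 => /eqP ->.
by [].
Qed.

End gaussian_kernel.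

(** * Integration by parts against the kernel *)

Section integration_by_parts.
Context {R : realType}.
Implicit Types (x z v : R).
Local Notation mu := (@lebesgue_measure R).
Variables (g : R -> R) (m0 C a : R).
Hypotheses (mg : measurable_fun setT g) (g0 : forall x, 0 <= g x).
Hypotheses (a0 : 0 <= a) (C0 : 0 <= C).
Hypothesis gC : forall x, g x <= C * (expR (a * (x - m0)) + expR (- a * (x - m0))).

Local Notation G := (primitive0 g).

(* The density of the oriented integral: [G x] is the integral of [slice x]. *)
Let slice x z := (if (0 <= z) && (z <= x) then g z else 0) -
                 (if (x <= z) && (z <= 0) then g z else 0).

Let slice_gt0 x z : 0 < x -> slice x z = (g \_ `[0, x]) z.
Proof.
move=> x0; rewrite /slice /patch mem_setE in_itv/=.
case: ifPn => _; case: ifPn; rewrite ?subr0// => /andP[xz z0].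
- by have := lt_le_trans x0 (le_trans xz z0); rewrite ltxx.
- by have := lt_le_trans x0 (le_trans xz z0); rewrite ltxx.
Qed.

Let slice_lt0 x z : x < 0 -> slice x z = - (g \_ `[x, 0]) z.
Proof.
move=> x0; rewrite /slice /patch mem_setE in_itv/= [in X in X - _]ifF ?sub0r//.
by apply/negP => /andP[z0 zx]; have := le_lt_trans (le_trans z0 zx) x0; rewrite ltxx.
Qed.

Let slice0 z : slice 0 z = 0.
Proof. by rewrite /slice andbC subrr. Qed.

Let C1 := 2 * C * expR (a * `|m0|).

Let g_le x z : `|z| <= `|x| -> g z <= C1 * expR (a * `|x|).
Proof.
move=> zx; apply: le_trans (gC z) _.
have h b : `|b| = a -> expR (b * (z - m0)) <= expR (a * `|m0|) * expR (a * `|x|).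
  move=> ba; rewrite -expRD ler_expR -mulrDr.
  apply: le_trans (ler_norm _) _; rewrite normrM ba ler_wpM2l//.
  by apply: le_trans (ler_normB _ _) _; rewrite addrC lerD2l.
have h1 := h a (ger0_norm a0); have h2 := h (- a); rewrite normrN ger0_norm// in h2.
have {}h2 := h2 erefl.
rewrite /C1 -!mulrA (mulrCA 2) ler_wpM2l// mulr_natl mulr2n; exact: lerD.
Qed.

Let C10 : 0 <= C1. Proof. by rewrite /C1 !mulr_ge0 ?expR_ge0. Qed.

Let integral_itv_le (u w x : R) : u <= w -> `|u| <= `|x| -> `|w| <= `|x| -> w - u <= `|x| ->
  (\int[mu]_(z in `[u, w]) (g z)%:E <= (C1 * expR ((a + 1) * `|x|))%:E)%E.
Proof.
move=> uw ux wx wux.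
apply: (@le_trans _ _ (\int[mu]_(z in `[u, w]) (C1 * expR (a * `|x|))%:E)%E).
  apply: ge0_le_integral => //.
  - by move=> z _; rewrite lee_fin.
  - by apply/measurable_EFinP; exact: measurable_funTS.
  - move=> z; rewrite /= in_itv/= => /andP[uz zw]; rewrite lee_fin g_le// ler_norml.
    move: ux wx; rewrite !ler_norml => /andP[ux _] /andP[_ wx].
    by rewrite (le_trans ux uz) (le_trans zw wx).
rewrite integral_cst//= lebesgue_measure_itv/= lte_fin.
case: ifPn => _; last by rewrite mule0 lee_fin mulr_ge0 ?expR_ge0.
rewrite -EFinB -EFinM lee_fin -mulrA ler_wpM2l// mulrDl mul1r expRD ler_wpM2l ?expR_ge0//.
exact: le_trans wux (normr_le_expR x).
Qed.

(** For fixed x the slice has constant sign in z, so that its absolute integral is |G x|. This is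
    what makes the exchange of integrals below legitimate. *)
Let integral_slice_abs x :
  (\int[mu]_z `|(slice x z)%:E| = `|G x|%:E)%E /\ (\int[mu]_z (slice x z)%:E = (G x)%:E)%E /\
  `|G x| <= C1 * expR ((a + 1) * `|x|).
Proof.
have fin (u w : R) : u <= w -> `|u| <= `|x| -> `|w| <= `|x| -> w - u <= `|x| ->
    (\int[mu]_(z in `[u, w]) (g z)%:E)%E = (\int[mu]_(z in `[u, w]) g z)%:E /\
    0 <= \int[mu]_(z in `[u, w]) g z <= C1 * expR ((a + 1) * `|x|).
  move=> uw ux wx wux; have le := integral_itv_le uw ux wx wux.
  have ge : (0 <= \int[mu]_(z in `[u, w]) (g z)%:E)%E.
    by apply: integral_ge0 => z _; rewrite lee_fin.
  have f : (\int[mu]_(z in `[u, w]) (g z)%:E \is a fin_num)%E.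
    by rewrite ge0_fin_numE// (le_lt_trans le)// ltry.
  split; first by rewrite fineK.
  by rewrite -!lee_fin fineK// ge.
have mpatch D : (\int[mu]_z ((g \_ D) z)%:E = \int[mu]_(z in D) (g z)%:E)%E.
  rewrite [RHS]integral_mkcond; apply: eq_integral => z _.
  by rewrite /patch; case: ifP.
have patch0 D z : 0 <= (g \_ D) z by rewrite /patch; case: ifP.
have [x0|x0|->] := ltgtP x 0.
- have [E /andP[ge le]] := fin x 0 (ltW x0) (lexx _) ltac:(by rewrite normr0)
    ltac:(by rewrite sub0r ltr0_norm).
  have GE : G x = - \int[mu]_(z in `[x, 0]) g z by rewrite /primitive0 leNgt x0.
  split; [|split].
  + under eq_integral do rewrite slice_lt0// EFinN abseN gee0_abs ?lee_fin//.
    by rewrite mpatch GE normrN ger0_norm.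
  + under eq_integral do rewrite slice_lt0// EFinN.
    by rewrite integral_ge0N ?mpatch ?E ?GE// => z _; rewrite lee_fin.
  + by rewrite GE normrN ger0_norm.
- have [E /andP[ge le]] := fin 0 x (ltW x0) ltac:(by rewrite normr0) (lexx _)
    ltac:(by rewrite subr0 gtr0_norm).
  have GE : G x = \int[mu]_(z in `[0, x]) g z by rewrite /primitive0 ltW.
  split; [|split].
  + under eq_integral do rewrite slice_gt0// gee0_abs ?lee_fin//.
    by rewrite mpatch GE ger0_norm.
  + under eq_integral do rewrite slice_gt0//.
    by rewrite mpatch E GE.
  + by rewrite GE ger0_norm.
- have GE : G 0 = 0 by rewrite /primitive0 lexx set_itv1 Rintegral_set1.
  rewrite GE normr0; split; [|split].
  + by under eq_integral do rewrite slice0 abse0; rewrite integral0.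
  + by under eq_integral do rewrite slice0; rewrite integral0.
  + by rewrite mulr_ge0 ?expR_ge0.
Qed.

Let measurable_slice : measurable_fun setT (fun p : R * R => slice p.1 p.2).
Proof.
apply: measurable_funB; apply: measurable_fun_ifT => //.
- by apply: measurable_and; exact: measurable_fun_ler.
- exact: (measurableT_comp mg).
- by apply: measurable_and; exact: measurable_fun_ler.
- exact: (measurableT_comp mg).
Qed.

Let integrable_slice x : mu.-integrable setT (fun z => (slice x z)%:E).
Proof.
have [mabs [_ _]] := integral_slice_abs x.
apply/integrableP; split; last by rewrite mabs ltry.
by apply/measurable_EFinP; apply: (measurableT_comp measurable_slice (pair1_measurable x)).
Qed.

(** The case distinction in the oriented integral disappears once G is a section integral of one
    jointly measurable function; Tonelli's theorem is applied to the positive and negative parts of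
    that function. *)
Lemma measurable_primitive0 : measurable_fun setT G.
Proof.
pose S (p : R * R) : \bar R := (slice p.1 p.2)%:E.
have mS : measurable_fun setT S by exact/measurable_EFinP.
apply/measurable_EFinP.
have -> : EFin \o G = (fubini_F mu S^\+ \- fubini_F mu S^\-)%E.
  apply/funext => x; have [_ [E _]] := integral_slice_abs x.
  rewrite -[LHS]E integralE.
  rewrite -[RHS]/(fubini_F mu S^\+ x - fubini_F mu S^\- x)%E /fubini_F.
  by congr (_ - _)%E; apply: eq_integral => z _; rewrite ?funepos.unlock ?funeneg.unlock.
apply: emeasurable_funB; apply: measurable_fun_fubini_tonelli_F => //.
- exact: measurable_funepos.
- exact: measurable_funeneg.
Qed.

(** As g may jump, G need not be differentiable everywhere, and the integration by parts is carried
    out as an exchange of integrals: G x is an integral over z, and for fixed z the integral of the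
    kernel over x is a tail if z > 0 and minus a head if z < 0. Both are [gauss_primitive]. *)
Lemma integration_by_parts_gauss m s : 0 < s ->
  mu.-integrable setT (EFin \o (fun x => G x * gauss_kernel m s x)) ->
  (\int[mu]_x (G x * gauss_kernel m s x)%:E =
   \int[mu]_z (g z * gauss_primitive m s z)%:E)%E.
Proof.
move=> s0 /integrableP[mGk Gk].
pose J (p : R * R) : \bar R := (gauss_kernel m s p.1 * slice p.1 p.2)%:E.
have mJ : measurable_fun setT J.
  apply/measurable_EFinP; apply: measurable_funM measurable_slice.
  apply: (measurableT_comp _ measurable_fst).
  by apply: continuous_measurable_fun; exact: continuous_gauss_kernel.
have IJ : (mu \x mu)%E.-integrable setT J.
  apply/(integrable12ltyP mu mu mJ); apply: le_lt_trans Gk; rewrite le_eqVlt.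
  apply/orP; left; apply/eqP; apply: eq_integral => x _.
  transitivity (\int[mu]_z (`|gauss_kernel m s x|%:E * `|(slice x z)%:E|))%E.
    by apply: eq_integral => z _; rewrite /J /= normrM EFinM.
  have [mabs _] := integral_slice_abs x.
  rewrite ge0_integralZl_EFin//.
  - by rewrite mabs -EFinM -normrM mulrC.
  - by apply: measurableT_comp => //; exact: (measurable_int _ (integrable_slice x)).
transitivity (\int[mu]_x \int[mu]_z J (x, z))%E.
  apply: eq_integral => x _; rewrite /J /=.
  have [mabs [ms _]] := integral_slice_abs x.
  transitivity (\int[mu]_z ((gauss_kernel m s x)%:E * (slice x z)%:E))%E; last first.
    by apply: eq_integral => z _; rewrite EFinM.
  by rewrite integralZl// ms -EFinM mulrC.
rewrite (Fubini IJ); apply: ae_eq_integral => //.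
- exact: (measurable_fubini_G IJ).
- apply/measurable_EFinP; apply: measurable_funM => //; apply: measurable_funM => //.
  apply: measurableT_comp => //; apply: measurable_funN; apply: measurable_funM => //.
  by apply: measurable_funX; exact: measurable_funB.
(* At z = 0 the slice is carried by x of both signs and the inner integral would be doubled; this
   one point is discarded. *)
have N0 : mu.-negligible [set (0 : R)].
  by apply/negligibleP => //; exact: lebesgue_measure_set1.
have IK := integrable_gauss_kernel m s0.
apply: negligibleS N0 => z /= H; apply: contrapT => z0; apply: H => _.
have {z0}[z0|z0|//] := ltgtP z 0.
- transitivity (\int[mu]_x ((- g z)%:E * ((EFin \o gauss_kernel m s) \_ `]-oo, z]) x))%E.
    apply: eq_integral => x _; rewrite /J /patch mem_setE in_itv/= /slice (leNgt 0) z0/=.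
    rewrite (ltW z0) andbT sub0r; case: ifP => _; last by rewrite oppr0 mulr0 mule0.
    by rewrite -EFinM mulrC.
  rewrite integralZl//; last by apply/(integrable_mkcond _ _).1 => //; exact: integrableS IK.
  by rewrite -integral_mkcond gauss_kernel_head// -EFinM mulrNN.
- transitivity (\int[mu]_x ((g z)%:E * ((EFin \o gauss_kernel m s) \_ `[z, +oo[) x))%E.
    apply: eq_integral => x _; rewrite /J /patch mem_setE in_itv/= /slice (leNgt z 0) z0/=.
    rewrite (ltW z0) !andbT andbF subr0/=; case: ifP => _; last by rewrite mulr0 mule0.
    by rewrite -EFinM mulrC.
  rewrite integralZl//; last by apply/(integrable_mkcond _ _).1 => //; exact: integrableS IK.
  by rewrite -integral_mkcond gauss_kernel_tail// -EFinM.
Qed.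

(** Gives integrability on the line for each v, and later on the product with [Omega], where v is
    random with finite exponential moments. The kernel is centered at m0 - v / 2; recentering it at
    m0 costs at most exp |x - m0|, and its linear factor at most exp |x - m0| times exp v. *)
Lemma primitive0_gauss_growth (v0 : R) : 0 < v0 -> exists K k : R, [/\ 0 <= K, 0 <= k &
  forall v, v0 <= v ->
  (\int[mu]_x `|G x * gauss_kernel (m0 - v / 2) (Num.sqrt v) x|%:E <=
    (K * expR (k * v))%:E)%E].
Proof.
move=> v00; have s00 : 0 < Num.sqrt v0 by rewrite sqrtr_gt0.
pose C2 := C1 * expR ((a + 1) * `|m0|) * (Num.sqrt v0) ^- 3 * 3.
have C20 : 0 <= C2 by rewrite !mulr_ge0 ?expR_ge0 ?invr_ge0 ?exprn_ge0 ?(ltW s00).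
(* In the envelope exponent, a + 1 is the growth of G and 2 that of the recentered kernel. The rate
   is that of [integral_envelope] plus 1 for the factor exp v. *)
exists (C2 * (2 * Num.sqrt (2 * pi))), (2 + (a + 1 + 2) ^+ 2 / 2); split.
- by rewrite !mulr_ge0 ?sqrtr_ge0.
- by rewrite addr_ge0 ?divr_ge0 ?sqr_ge0.
move=> v v0v; have vp : 0 < v by exact: lt_le_trans v0v.
have sp : 0 < Num.sqrt v by rewrite sqrtr_gt0.
have mk : measurable_fun setT (gauss_kernel (m0 - v / 2) (Num.sqrt v)).
  by apply: continuous_measurable_fun; exact: continuous_gauss_kernel.
apply: (@le_trans _ _ (\int[mu]_x ((C2 * expR v) * envelope (a + 1 + 2) m0 v x)%:E)%E).
  apply: ge0_le_integral => //.
  - apply/measurable_EFinP; apply: measurableT_comp => //; apply: measurable_funM => //.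
    exact: measurable_primitive0.
  - by apply/measurable_EFinP; apply: measurable_funM => //; exact: measurable_envelope.
  move=> x _; rewrite lee_fin normrM; set u := x - m0.
  have hG : `|G x| <= C1 * expR ((a + 1) * `|m0|) * (expR ((a + 1) * u) + expR (- (a + 1) * u)).
    have [_ [_ /le_trans]] := integral_slice_abs x; apply.
    rewrite -mulrA ler_wpM2l//.
    apply: (@le_trans _ _ (expR ((a + 1) * `|m0|) * expR ((a + 1) * `|u|))).
      rewrite -expRD ler_expR -mulrDr ler_wpM2l ?addr_ge0//.
      by have := ler_normD m0 u; rewrite /u addrC subrK.
    by rewrite ler_wpM2l ?expR_ge0// expR_norm_le// addr_ge0.
  have hk : `|gauss_kernel (m0 - v / 2) (Num.sqrt v) x| <=
      (Num.sqrt v0) ^- 3 * expR v * envelope 2 m0 v x.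
    rewrite /gauss_kernel normrM (ger0_norm (expR_ge0 _)) sqr_sqrtr ?(ltW vp)//.
    have -> : x - (m0 - v / 2) = u + v / 2 by rewrite /u; ring.
    have -> : - ((u + v / 2) ^+ 2 / (2 * v)) = - (u ^+ 2 / (2 * v)) + (- u / 2 - v / 8).
      by field; rewrite gt_eqF.
    rewrite expRD normrM [`|u + _| * _]mulrC normfV normrX (ger0_norm (sqrtr_ge0 _)).
    have h1 : `|u + v / 2| <= expR `|u| * expR v.
      have e1 := expR_ge1Dx `|u|; have e2 := expR_ge1Dx v; have n0 := normr_ge0 u.
      have v20 : 0 <= v / 2 by rewrite divr_ge0// ltW.
      apply: le_trans (ler_normD _ _) _; rewrite (ger0_norm v20).
      apply: (@le_trans _ _ ((1 + `|u|) * (1 + v))); first nra.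
      by rewrite ler_pM// addr_ge0// ltW.
    have h2 : expR (- u / 2 - v / 8) <= expR `|u|.
      by rewrite ler_expR; have := ler_norm (- u); rewrite normrN; have := normr_ge0 u; lra.
    have h3 : (Num.sqrt v) ^- 3 <= (Num.sqrt v0) ^- 3.
      by rewrite lef_pV2 ?posrE ?exprn_gt0// ler_pXn2r ?nnegrE ?sqrtr_ge0// ler_wsqrtr.
    apply: (@le_trans _ _ ((Num.sqrt v0) ^- 3 * (expR `|u| * expR v) *
        (expR (- (u ^+ 2 / (2 * v))) * expR `|u|))).
      rewrite ler_pM ?mulr_ge0 ?expR_ge0 ?invr_ge0 ?exprn_ge0 ?sqrtr_ge0//.
        by rewrite ler_pM ?invr_ge0 ?exprn_ge0 ?sqrtr_ge0.
      by rewrite ler_wpM2l ?expR_ge0.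
    have -> : (Num.sqrt v0) ^- 3 * (expR `|u| * expR v) * (expR (- (u ^+ 2 / (2 * v))) * expR `|u|) =
       (Num.sqrt v0) ^- 3 * expR v * (expR `|u| * expR `|u| * expR (- (u ^+ 2 / (2 * v)))) by ring.
    rewrite ler_wpM2l ?mulr_ge0 ?expR_ge0 ?invr_ge0 ?exprn_ge0 ?sqrtr_ge0//.
    rewrite /envelope -/u ler_wpM2r ?expR_ge0// -expRD.
    by rewrite (_ : _ + _ = 2 * `|u|) ?expR_norm_le//; lra.
  apply: le_trans (ler_pM (normr_ge0 _) (normr_ge0 _) hG hk) _.
  have := envelope_mul m0 v x (addr_ge0 a0 ler01) (ler0n _ 2); rewrite -/u.
  set q := (_ + _); set e := envelope 2 _ _ _; set e3 := envelope _ _ _ _ => qe.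
  have -> : C1 * expR ((a + 1) * `|m0|) * q * ((Num.sqrt v0) ^- 3 * expR v * e) =
    C1 * expR ((a + 1) * `|m0|) * (Num.sqrt v0) ^- 3 * expR v * (q * e) by ring.
  have -> : C2 * expR v * e3 = C1 * expR ((a + 1) * `|m0|) * (Num.sqrt v0) ^- 3 * expR v * (3 * e3).
    by rewrite /C2; ring.
  by rewrite ler_wpM2l// !mulr_ge0 ?expR_ge0 ?invr_ge0 ?exprn_ge0 ?sqrtr_ge0.
under eq_integral do rewrite EFinM.
rewrite ge0_integralZl_EFin//; last 3 first.
- by move=> x _; rewrite lee_fin envelope_ge0.
- by apply/measurable_EFinP; exact: measurable_envelope.
- by rewrite mulr_ge0 ?expR_ge0.
apply: (@le_trans _ _ ((C2 * expR v)%:E *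
   (2 * Num.sqrt (2 * pi) * expR ((1 + (a + 1 + 2) ^+ 2 / 2) * v))%:E)%E).
  by rewrite lee_wpmul2l ?lee_fin ?mulr_ge0 ?expR_ge0// integral_envelope.
rewrite -EFinM lee_fin.
have -> : (2 + (a + 1 + 2) ^+ 2 / 2) * v = v + (1 + (a + 1 + 2) ^+ 2 / 2) * v by field.
by rewrite expRD le_eqVlt; apply/orP; left; apply/eqP; ring.
Qed.

End integration_by_parts.

(** * Abel summation with monotone coefficients *)

Section abel_summation.
Context {R : realType}.
Implicit Types (a x u : nat -> R) (m k : nat).

Let increment a k : R := a k - (if k is k'.+1 then a k' else 0).

Let sum_increment a m : \sum_(k < m.+1) increment a k = a m.
Proof.
elim: m => [|m IH]; first by rewrite big_ord1 /increment subr0.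
by rewrite big_ord_recr/= IH /increment addrC subrK.
Qed.

(** Summation by parts, arranged so that all increments of x end at the last point m. The new
    weights are nonnegative as soon as a is nonnegative and nondecreasing. *)
Let abel a x m : \sum_(k < m) a k * (x k.+1 - x k) =
  \sum_(k < m) increment a k * (x m - x k).
Proof.
elim: m => [|m IH]; first by rewrite !big_ord0.
rewrite big_ord_recr/= IH big_ord_recr/=.
have -> : \sum_(k < m) increment a k * (x m.+1 - x k) =
    \sum_(k < m) increment a k * (x m - x k) +
    (\sum_(k < m) increment a k) * (x m.+1 - x m).
  by rewrite mulr_suml -big_split/=; apply: eq_bigr => k _; ring.
rewrite -addrA -mulrDl; congr (_ + _ * _).
by rewrite -(sum_increment a m) big_ord_recr.
Qed.

Let increment_ge0 a m : (forall k, (k < m)%N -> 0 <= a k) ->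
  (forall k, (k.+1 < m)%N -> a k <= a k.+1) -> forall k, (k < m)%N -> 0 <= increment a k.
Proof.
move=> a0 ai [|k] km; rewrite /increment ?subr0 ?a0// subr_ge0; exact: ai.
Qed.

Lemma abel_sum_norm a x m (A M : R) : (forall k, (k < m)%N -> 0 <= a k <= A) ->
  (forall k, (k.+1 < m)%N -> a k <= a k.+1) ->
  (forall k, (k <= m)%N -> `|x k| <= M) -> 0 <= A ->
  `|\sum_(k < m) a k * (x k.+1 - x k)| <= A * (2 * M).
Proof.
move=> aA ai xM A0; have M0 : 0 <= M by exact: le_trans (xM 0%N _).
have c0 := @increment_ge0 a m (fun k km => (andP (aA k km)).1) ai.
rewrite abel; apply: le_trans (ler_norm_sum _ _ _) _.
apply: (@le_trans _ _ (\sum_(k < m) increment a k * (2 * M))).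
  apply: ler_sum => k _; rewrite normrM ger0_norm ?c0// ler_wpM2l ?c0//.
  by apply: le_trans (ler_normB _ _) _; rewrite mulr_natl mulr2n lerD// xM// ltnW.
rewrite -mulr_suml ler_wpM2r ?mulr_ge0//.
case: m aA {ai xM c0} => [_|m aA]; first by rewrite big_ord0.
by rewrite sum_increment; have /andP[] := aA m (ltnSn m).
Qed.

(* Abel summation followed by the Cauchy-Schwarz inequality with the weights
   [a k - a k.-1], of total mass at most [A]. *)
Lemma abel_sum_sqr a m (A : R) : (forall k, (k < m)%N -> 0 <= a k <= A) ->
  (forall k, (k.+1 < m)%N -> a k <= a k.+1) -> 0 <= A ->
  exists2 c : nat -> R, (forall k, (k < m)%N -> 0 <= c k) /\ \sum_(k < m) c k <= A &
  forall x, (\sum_(k < m) a k * (x k.+1 - x k)) ^+ 2 <=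
    A * \sum_(k < m) c k * (x m - x k) ^+ 2.
Proof.
move=> aA ai A0; exists (increment a).
  split; first exact: (@increment_ge0 a m (fun k km => (andP (aA k km)).1) ai).
  case: m aA {ai} => [_|m aA]; first by rewrite big_ord0.
  by rewrite sum_increment; have /andP[] := aA m (ltnSn m).
move=> x.
have c0 := @increment_ge0 a m (fun k km => (andP (aA k km)).1) ai.
have cA : \sum_(k < m) increment a k <= A.
  case: m aA {ai c0} => [_|m aA]; first by rewrite big_ord0.
  by rewrite sum_increment; have /andP[] := aA m (ltnSn m).
rewrite abel; pose y k := x m - x k.
rewrite -/(\sum_(k < m) increment a k * y k) -/(\sum_(k < m) increment a k * y k ^+ 2).
set S1 := \sum_(k < m) increment a k * y k.
set S2 := \sum_(k < m) increment a k * y k ^+ 2.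
have S20 : 0 <= S2 by apply: sumr_ge0 => k _; rewrite mulr_ge0 ?sqr_ge0 ?c0.
(* The weighted sum of (y k - t)^2 is nonnegative; the value t = S1 / A then gives the
   Cauchy-Schwarz inequality. *)
have key t : 0 <= S2 - 2 * t * S1 + t ^+ 2 * A.
  apply: (@le_trans _ _ (\sum_(k < m) increment a k * (y k - t) ^+ 2)).
    by apply: sumr_ge0 => k _; rewrite mulr_ge0 ?sqr_ge0 ?c0.
  have -> : \sum_(k < m) increment a k * (y k - t) ^+ 2 =
      S2 - 2 * t * S1 + t ^+ 2 * \sum_(k < m) increment a k.
    rewrite /S1 /S2 !mulr_sumr -sumrN -!big_split/=; apply: eq_bigr => k _; ring.
  by rewrite lerD2l ler_wpM2l ?sqr_ge0.
(* For A = 0 the expression in [key] is affine in t, and its nonnegativity for all t forces S1 =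
   0. *)
have [A_eq0|A_neq0] := eqVneq A 0.
  have S10 : S1 = 0.
    apply/eqP; rewrite -sqrf_eq0 eq_le sqr_ge0 andbT leNgt; apply/negP => S1p.
    have S1n : S1 != 0 by rewrite -sqrf_eq0 gt_eqF.
    have := key ((S2 + 1) / (2 * S1)); rewrite A_eq0 mulr0 addr0.
    by rewrite (_ : 2 * _ * S1 = S2 + 1); [lra|field].
  by rewrite S10 expr0n/= mulr_ge0.
have Ap : 0 < A by rewrite lt_neqAle eq_sym A_neq0.
have := key (S1 / A).
have -> : S2 - 2 * (S1 / A) * S1 + (S1 / A) ^+ 2 * A = (A * S2 - S1 ^+ 2) / A by field.
by rewrite pmulr_lge0 ?invr_gt0// subr_ge0.
Qed.

End abel_summation.

(** * Left-point sums of a Riemann-Stieltjes integral *)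

Section RS_left_sum.
Context {R : realType}.
Implicit Types (f h : R -> R) (a b I : R) (u : nat -> R).

Lemma is_RS_integral_left_sum f h a b I : is_RS_integral f h a b I ->
  forall e, 0 < e -> exists2 delta, 0 < delta &
    forall m u, u 0%N = a -> u m = b ->
      (forall i, (i < m)%N -> u i < u i.+1 < u i + delta) ->
      `|\sum_(i < m) f (u i) * (h (u i.+1) - h (u i)) - I| < e.
Proof.
move=> fI e e0; have [delta d0 H] := fI e e0; exists delta => // m u u0 um udelta.
pose s := mkseq (fun i => u i.+1) m.
have nths i : (i <= m)%N -> nth b (a :: s) i = u i.
  by case: i => [_|i im] /=; rewrite ?u0// nth_mkseq.
have ss : size s = m by rewrite size_mkseq.
have := H s u; rewrite /RS_sum ss => {}H.
suff : `|\sum_(i < m) f (u i) * (h (nth b (a :: s) i.+1) - h (nth b (a :: s) i)) - I| < e.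
  by under eq_bigr => i _ do rewrite !nths// 1?ltnW//.
apply: H => [|i im].
  split.
    apply/(pathP b) => i; rewrite ss => im.
    by rewrite nths 1?ltnW// nth_mkseq//; have /andP[] := udelta i im.
  by rewrite (last_nth b) ss nths// um.
rewrite !nths// 1?ltnW//; have /andP[h1 h2] := udelta i im.
by rewrite lexx (ltW h1); split=> //; rewrite ltrBlDl.
Qed.

(** The partitions of [itv_partition] are strictly increasing, so a degenerate interval has only the
    empty one, whose sum is 0. *)
Lemma is_RS_integral_point f h a I : is_RS_integral f h a a I -> I = 0.
Proof.
move=> fI; apply/eqP; rewrite -normr_eq0 eq_le normr_ge0 andbT.
apply/ler_addgt0Pr => e e0; rewrite add0r.
have [delta _ /(_ 0%N (fun=> a) erefl erefl)] := is_RS_integral_left_sum fI e0.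
rewrite big_ord0 sub0r normrN => H; apply/ltW/H; by case.
Qed.

End RS_left_sum.

Section square_integrable.
Context {R : realType} {d : measure_display} {Omega : measurableType d}.
Variable P : probability Omega R.
Implicit Types X Y : Omega -> R.

Lemma integrable_mul_sqr X Y : measurable_fun setT X -> measurable_fun setT Y ->
  (\int[P]_w (X w ^+ 2)%:E < +oo)%E -> (\int[P]_w (Y w ^+ 2)%:E < +oo)%E ->
  P.-integrable setT (EFin \o (fun w => X w * Y w)).
Proof.
move=> mX mY X2 Y2.
have IX : P.-integrable setT (EFin \o (fun w => X w ^+ 2)).
  by apply: ge0_integrable => // [|w]; [exact: measurable_funX|exact: sqr_ge0].
have IY : P.-integrable setT (EFin \o (fun w => Y w ^+ 2)).
  by apply: ge0_integrable => // [|w]; [exact: measurable_funX|exact: sqr_ge0].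
apply: (le_integrable _ _ _ (integrableD measurableT IX IY)) => //.
  by apply/measurable_EFinP; exact: measurable_funM.
move=> w _; change (`|X w * Y w|%:E <= `|X w ^+ 2 + Y w ^+ 2|%:E)%E.
rewrite lee_fin [leRHS]ger0_norm ?addr_ge0 ?sqr_ge0// normrM.
rewrite -(real_normK (num_real (X w))) -(real_normK (num_real (Y w))).
by have := sqr_ge0 (`|X w| - `|Y w|); have := normr_ge0 (X w); have := normr_ge0 (Y w); nra.
Qed.

End square_integrable.

(** * Sums against the increments of fractional Brownian motion *)

Section fractional_brownian_sums.
Context {R : realType} {d : measure_display} {Omega : measurableType d}.
Variables (P : probability Omega R) (T H : R) (B : R -> {RV P >-> R}).
Hypotheses (H01 : 2^-1 < H < 1) (fbm : fractional_brownian T H B).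

Let H0 : 0 < H.
Proof. by case/andP: H01 => /(lt_trans _) ->. Qed.

(** Expanding the square of an increment requires finite second moments; they come from Gaussianity,
    applied to the combination with the single term B t. *)
Lemma fbm_sqr_lty t : 0 <= t <= T -> (\int[P]_w (B t w ^+ 2)%:E < +oo)%E.
Proof.
move=> tT; have [gB _ _ _] := fbm.
have [|m [v law]] := gB 1%N (fun=> t) (fun=> 1); first by move=> _; rewrite /= in_itv.
have mB : measurable_fun setT (fun w => \sum_(i < 1) 1 * B t w).
  by under eq_fun do rewrite big_ord1 mul1r; exact: measurable_funPT.
have := normal_law_sqr mB law.
by under eq_integral do rewrite big_ord1 mul1r; move=> ->; rewrite ltry.
Qed.

Lemma fbm_increment_sqr s t : 0 <= s <= T -> 0 <= t <= T ->
  (\int[P]_w ((B t w - B s w) ^+ 2)%:E = (`|t - s| `^ (2 * H))%:E)%E.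
Proof.
move=> sT tT; have [_ EB covB _] := fbm.
have Bs2 := fbm_sqr_lty sT; have Bt2 := fbm_sqr_lty tT.
have EM x y : 0 <= x <= T -> 0 <= y <= T -> (\int[P]_w (B x w * B y w)%:E =
    (2^-1 * (x `^ (2 * H) + y `^ (2 * H) - `|y - x| `^ (2 * H)))%:E)%E.
  move=> xT yT; rewrite -covB// covariance.unlock expectation.unlock.
  have Ex := EB x xT; have Ey := EB y yT; rewrite !expectation.unlock in Ex Ey.
  by rewrite Ex Ey; apply: eq_integral => w _; rewrite -[RHS]/(((B x w - 0) * (B y w - 0))%:E) !subr0.
have IM x y : 0 <= x <= T -> 0 <= y <= T -> P.-integrable setT (EFin \o (fun w => B x w * B y w)).
  by move=> xT yT; apply: integrable_mul_sqr => //; exact: fbm_sqr_lty.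
transitivity (\int[P]_w ((B t w * B t w)%:E + ((- 2)%:E * (B s w * B t w)%:E + (B s w * B s w)%:E)))%E.
  by apply: eq_integral => w _; rewrite -EFinM -!EFinD; congr (_%:E); ring.
have I2 := integrableZl measurableT (- 2) (IM _ _ sT tT).
rewrite integralD//; [|exact: IM|by apply: integrableD => //; exact: IM].
rewrite integralD//; last exact: IM.
rewrite integralZl//; last exact: IM.
rewrite !EM// -EFinM -!EFinD !subrr normr0 (powR0 (_ : 2 * H != 0)); last by rewrite mulf_neq0// gt_eqF.
by congr (_%:E); lra.
Qed.

(** After Abel summation only the increments B (u m) - B (u k) remain, each of variance at most (u m
    - u 0)^(2H). The bound does not depend on the mesh, so it passes to the limit integrals. *)
Lemma fbm_sum_sqr (a u : nat -> R) m (A : R) : 0 <= A ->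
  (forall k, (k < m)%N -> 0 <= a k <= A) -> (forall k, (k.+1 < m)%N -> a k <= a k.+1) ->
  (forall k, (k <= m)%N -> 0 <= u k <= T) -> (forall k, (k < m)%N -> u k <= u k.+1) ->
  (\int[P]_w ((\sum_(k < m) a k * (B (u k.+1) w - B (u k) w)) ^+ 2)%:E <=
   (A ^+ 2 * (u m - u 0%N) `^ (2 * H))%:E)%E.
Proof.
move=> A0 aA ai uT ui; have [c [c0 cA] cS] := abel_sum_sqr aA ai A0.
have ule i j : (i <= j <= m)%N -> u i <= u j.
  move=> /andP[]; elim: j => [|j IH]; first by rewrite leqn0 => /eqP ->.
  rewrite leq_eqVlt => /orP[/eqP -> //|ij] jm.
  by apply: le_trans (ui j jm); apply: IH => //; exact: ltnW.
have mB t : measurable_fun setT (B t) by [].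
have mD k : measurable_fun setT (fun w => (c k * (B (u m) w - B (u k) w) ^+ 2)%:E).
  by apply/measurable_EFinP; apply: measurable_funM => //; apply: measurable_funX; exact: measurable_funB.
apply: (@le_trans _ _ (\int[P]_w (A%:E * \sum_(k < m) (c k * (B (u m) w - B (u k) w) ^+ 2)%:E))%E).
  apply: ge0_le_integral => //.
  - by move=> w _; rewrite lee_fin sqr_ge0.
  - apply/measurable_EFinP; apply: measurable_funX; apply: measurable_sum => k.
    by apply: measurable_funM => //; exact: measurable_funB.
  - by apply: emeasurable_funM => //; apply: emeasurable_sum => k _; exact: mD.
  - by move=> w _; rewrite sumEFin -EFinM lee_fin; exact: (cS (fun k => B (u k) w)).
have nn (k : 'I_m) w : (0 <= (c k * (B (u m) w - B (u k) w) ^+ 2)%:E)%E.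
  by rewrite lee_fin mulr_ge0 ?sqr_ge0 ?c0.
rewrite ge0_integralZl_EFin//; last 2 first.
- by move=> w _; apply: sume_ge0 => k _; exact: nn.
- by apply: emeasurable_sum => k _; exact: mD.
rewrite ge0_integral_sum//.
have E (k : 'I_m) : (\int[P]_w (c k * (B (u m) w - B (u k) w) ^+ 2)%:E =
    (c k * `|u m - u k| `^ (2 * H))%:E)%E.
  under eq_integral do rewrite EFinM.
  rewrite ge0_integralZl_EFin ?c0//.
  - by rewrite fbm_increment_sqr// uT// ltnW.
  - by move=> w _; rewrite lee_fin sqr_ge0.
  - by apply/measurable_EFinP; apply: measurable_funX; exact: measurable_funB.
rewrite (eq_bigr _ (fun k _ => E k)) sumEFin -EFinM lee_fin expr2 -mulrA ler_wpM2l//.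
apply: (@le_trans _ _ (\sum_(k < m) c k * (u m - u 0%N) `^ (2 * H))).
  apply: ler_sum => k _; rewrite ler_wpM2l ?c0// ge0_ler_powR ?nnegrE//; first by rewrite mulr_ge0// ltW.
  - by rewrite subr_ge0 ule ?leqnn.
  - have ukm : u k <= u m by rewrite ule// leqnn ltnW.
    by rewrite ger0_norm ?subr_ge0// lerB// ule//= ltnW.
by rewrite -mulr_suml ler_wpM2r// powR_ge0.
Qed.

Lemma fbm_sum_exp_sqr (a u : nat -> R) m (e K : R) :
  (forall k, (k <= m)%N -> 0 <= u k <= T) -> 0 <= e -> 8 * e * K <= 1 ->
  (\int[P]_w ((\sum_(k < m) a k * (B (u k.+1) w - B (u k) w)) ^+ 2)%:E <= K%:E)%E ->
  (\int[P]_w (expR (e * (\sum_(k < m) a k * (B (u k.+1) w - B (u k) w)) ^+ 2))%:E <= 4%:E)%E.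
Proof.
move=> uT e0 eK SK; have [gB _ _ _] := fbm.
(* To match the form of [gaussian_process], the right and the left end points are listed as 2 m
   separate times with opposite coefficients. *)
pose t (i : 'I_(m + m)) := match fintype.split i with inl k => u k.+1 | inr k => u k end.
pose b (i : 'I_(m + m)) := match fintype.split i with inl k => a k | inr k => - a k end.
have tT i : `[0, T]%classic (t i).
  rewrite /= in_itv /t; case: (fintype.split i) => k /=; first exact: uT.
  by apply: uT; exact: ltnW.
have [n [v law]] := gB _ t b tT.
have E : (fun w => \sum_(i < m + m) b i * B (t i) w) =
    (fun w => \sum_(k < m) a k * (B (u k.+1) w - B (u k) w)).
  apply/funext => w; rewrite big_split_ord/= -big_split/=; apply: eq_bigr => k _.
  rewrite /b /t; case: split_ordP => j /eqP; rewrite ?eq_shift// => /eqP <-.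
  case: split_ordP => i /eqP; rewrite ?eq_shift// => /eqP <-.
  by rewrite mulNr mulrBr.
rewrite E in law; apply: (normal_law_exp_sqr _ law e0 eK SK).
by apply: measurable_sum => k; apply: measurable_funM => //; exact: measurable_funB.
Qed.

End fractional_brownian_sums.

(** * Limits of moment bounds and joint measurability of processes *)

Section measurability_and_limits.
Context {R : realType}.

(** Fatou's lemma, in the form that carries moment bounds from left sums over to the stochastic
    integral. *)
Lemma ge0_integral_limit_le d (T : measurableType d) (m : {measure set T -> \bar R})
    (X_ : nat -> T -> R) (X : T -> R) (phi : R -> R) (K : R) :
  (forall n, measurable_fun setT (X_ n)) -> (forall w, X_ n w @[n --> \oo] --> X w) ->
  continuous phi -> (forall x, 0 <= phi x) ->
  (forall n, (\int[m]_w (phi (X_ n w))%:E <= K%:E)%E) ->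
  (\int[m]_w (phi (X w))%:E <= K%:E)%E.
Proof.
move=> mX cX cphi phi0 K_.
have mphi n : measurable_fun setT (fun w => (phi (X_ n w))%:E).
  apply/measurable_EFinP; apply: measurableT_comp => //.
  exact: continuous_measurable_fun.
have -> : (\int[m]_w (phi (X w))%:E = \int[m]_w limn_einf (fun n => (phi (X_ n w))%:E))%E.
  apply: eq_integral => w _; have [] // := @cvg_limn_einf_sup R (fun n => (phi (X_ n w))%:E) (phi (X w))%:E.
  apply: cvg_EFin; first by near=> n.
  by apply: (cvg_comp _ _ (cX w)); exact: cphi.
apply: le_trans (fatou _ measurableT mphi _) _.
  by move=> n w _; rewrite lee_fin.
apply: le_trans (limn_einf_sup _) _; rewrite limn_esup_lim.
apply: lime_le; first exact: is_cvg_esups.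
near=> n; apply: ub_ereal_sup => _ [k _ <-]; exact: K_.
Unshelve. all: by end_near. Qed.

Lemma measurable_fun_nat_index d (T : measurableType d) d' (S : measurableType d')
    (X : nat -> T -> S) (j : T -> nat) :
  (forall n, measurable_fun setT (X n)) -> (forall n, measurable [set t | j t = n]) ->
  measurable_fun setT (fun t => X (j t) t).
Proof.
move=> mX mj _ A mA; rewrite setTI.
rewrite (_ : _ @^-1` A = \bigcup_n ([set t | j t = n] `&` X n @^-1` A)); last first.
  apply/seteqP; split => [t /= At|t [n _ [/= <-]]//]; by exists (j t).
apply: bigcup_measurable => n _; apply: measurableI; first exact: mj.
by rewrite -[_ @^-1` _]setTI; exact: mX.
Qed.

Lemma measurable_truncn_eq (n : nat) : measurable [set x : R | Num.truncn x = n].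
Proof.
have mt : measurable_fun setT (fun x : R => (Num.truncn x)%:R : R).
  by apply: nondecreasing_measurable => // x y xy; rewrite ler_nat le_truncn.
have -> : [set x : R | Num.truncn x = n] = (fun x : R => (Num.truncn x)%:R : R) @^-1` [set n%:R].
  apply/seteqP; split => x /=; first by move=> ->.
  by move/eqP; rewrite eqr_nat => /eqP.
by rewrite -[_ @^-1` _]setTI; exact: mt.
Qed.

Definition clamp (T s : R) := Num.min T (Num.max 0 s).

Lemma clamp_itv (T s : R) : 0 <= T -> 0 <= clamp T s <= T.
Proof. by move=> T0; rewrite /clamp le_min T0 le_max lexx/= ge_min lexx. Qed.

Lemma clamp_id (T s : R) : 0 <= s <= T -> clamp T s = s.
Proof. by move=> /andP[s0 sT]; rewrite /clamp max_r// min_r. Qed.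

Lemma measurable_clamp (T : R) : measurable_fun setT (clamp T).
Proof. by apply: measurable_minr => //; exact: measurable_maxr. Qed.

Lemma cvg_invn_shift (c : R) : c / n.+1%:R @[n --> \oo] --> 0.
Proof.
rewrite -[0](mulr0 c); apply: cvgM; first exact: cvg_cst.
exact: cvg_harmonic.
Qed.

Lemma measurable_continuous_process d (Omega : measurableType d) (T : R)
    (X : R -> Omega -> R) : 0 <= T -> (forall t, measurable_fun setT (X t)) ->
  (forall w, {within `[0, T], continuous (fun t => X t w)}) ->
  measurable_fun setT (fun p : R * Omega => X (clamp T p.1) p.2).
Proof.
move=> T0 mX cX.
(* Times are rounded down to multiples of 1 / (k + 1). They thus remain in [0, T], where the paths
   are continuous. *)
pose t_ (k : nat) (s : R) : R := (Num.truncn (k.+1%:R * clamp T s))%:R / k.+1%:R.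
apply: (@measurable_fun_cvg _ _ _ setT (fun k p => X (t_ k p.1) p.2)).
- move=> k; rewrite /t_.
  pose j (p : R * Omega) := Num.truncn (k.+1%:R * clamp T p.1).
  apply: (@measurable_fun_nat_index _ _ _ _ (fun n p => X (n%:R / k.+1%:R) p.2) j).
    by move=> n; exact: (measurableT_comp (mX _) measurable_snd).
  move=> n; rewrite (_ : [set _ | _] =
    (fun p : R * Omega => k.+1%:R * clamp T p.1) @^-1` [set x | Num.truncn x = n])//.
  rewrite -[_ @^-1` _]setTI.
  have m1 : measurable_fun setT (fun p : R * Omega => k.+1%:R * clamp T p.1).
    by apply: measurable_funM => //; exact: (measurableT_comp (measurable_clamp T) measurable_fst).
  exact: m1 _ _ (measurable_truncn_eq n).
move=> [s w] _ /=; have /andP[s0 sT] := clamp_itv s T0.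
set c := clamp T s.
have /subspace_continuousP := cX w => /(_ c).
rewrite /= in_itv/= s0 sT => /(_ isT) cXs.
have tin k : 0 <= t_ k s <= c.
  rewrite divr_ge0//= ler_pdivrMr ?ltr0n// [leRHS]mulrC -/c.
  by rewrite truncn_le mulr_ge0.
have tc : t_ k s @[k --> \oo] --> c.
  apply: (@squeeze_cvgr _ _ _ _ (fun k => c - 1 / k.+1%:R) (fun=> c)).
  - near=> k; have /andP[_ ->] := tin k; rewrite andbT lerBlDr -mulrDl ler_pdivlMr ?ltr0n//.
    by rewrite mulrC ltW// natr1 truncnS_gt.
  - by rewrite -[X in _ --> X]subr0; apply: cvgB; [exact: cvg_cst|exact: cvg_invn_shift].
  - exact: cvg_cst.
apply: (cvg_comp (t_ ^~ s) (fun t => X t w)); last exact: cXs.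
move=> A; rewrite /within/= => /tc nA; near=> k.
suff : `[0, T]%classic (t_ k s) by near: k.
by rewrite /= in_itv/=; have /andP[-> h] := tin k; rewrite (le_trans h).
Unshelve. all: by end_near. Qed.

Lemma continuous_segment_bounded (T : R) (f : R -> R) :
  {within `[0, T], continuous f} -> exists2 M, 0 <= M & forall t, 0 <= t <= T -> `|f t| <= M.
Proof.
have [T0 cf|T0 _] := leP 0 T; last first.
  by exists 0 => // t /andP[t0 tT]; have := le_lt_trans (le_trans t0 tT) T0; rewrite ltxx.
have cn : {within `[0, T], continuous (fun t => `|f t|)}.
  by move=> x; apply: continuous_comp; [exact: cf|exact: norm_continuous].
have [c _ H] := EVT_max T0 cn.
by exists `|f c| => // t tT; apply: H; rewrite in_itv.
Qed.

End measurability_and_limits.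

(** * Uniform partitions of an interval *)

Section linear_grid.
Context {R : realType}.
Implicit Types (a b T : R).

Definition linear_grid a b (N k : nat) : R := a + (b - a) * (k%:R / N%:R).

Lemma linear_grid0 a b N : linear_grid a b N 0 = a.
Proof. by rewrite /linear_grid mul0r mulr0 addr0. Qed.

Lemma linear_gridN a b N : (0 < N)%N -> linear_grid a b N N = b.
Proof.
move=> N0; rewrite /linear_grid divff ?mulr1 ?pnatr_eq0 -?lt0n//.
by rewrite addrC subrK.
Qed.

Lemma linear_gridS a b N k : linear_grid a b N k.+1 = linear_grid a b N k + (b - a) / N%:R.
Proof. by rewrite /linear_grid -natr1; ring. Qed.

Lemma linear_grid_le a b N k : a <= b -> linear_grid a b N k <= linear_grid a b N k.+1.
Proof. by move=> ab; rewrite linear_gridS lerDl divr_ge0 ?subr_ge0. Qed.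

Lemma linear_grid_itv a b N k : a <= b -> (k <= N)%N -> a <= linear_grid a b N k <= b.
Proof.
move=> ab; rewrite leq_eqVlt => /orP[/eqP ->|kN].
  case: N => [|N]; first by rewrite linear_grid0 lexx.
  by rewrite linear_gridN// lexx andbT.
have N0 : (0 < N)%N by exact: leq_ltn_trans kN.
rewrite /linear_grid lerDl mulr_ge0 ?subr_ge0 ?divr_ge0//=.
rewrite -lerBrDl ler_piMr ?subr_ge0// ler_pdivrMr ?ltr0n// mul1r ler_nat.
exact: ltnW.
Qed.

End linear_grid.

(** * The noise of the fractional Ornstein-Uhlenbeck process *)

Section ornstein_uhlenbeck.
Context {R : realType} {d : measure_display} {Omega : measurableType d}.
Variables (P : probability Omega R) (T H alpha Y0 : R) (B : R -> {RV P >-> R}).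
Variable Y : R -> Omega -> R.
Hypotheses (T0 : 0 < T) (H01 : 2^-1 < H < 1) (alpha0 : 0 < alpha).
Hypotheses (fbm : fractional_brownian T H B) (YOU : fractional_OU T alpha Y0 B Y).

(* [ou_noise t] is the integral of [s |-> exp (alpha s)] with respect to B over [0, t]. *)
Definition ou_noise t w := expR (alpha * t) * (Y t w - Y0 * expR (- alpha * t)).

Local Notation M := ou_noise.

Let left_sum a b N w := \sum_(k < N) expR (alpha * linear_grid a b N k) *
  (B (linear_grid a b N k.+1) w - B (linear_grid a b N k) w).

(** Multiplication by exp (alpha b) turns the kernel exp (- alpha (b - s)) into exp (alpha s), which
    is the same for all b. The partitions are left arbitrary, so that concatenated grids are covered
    as well as uniform ones. *)
Let noise_cvg b w (S : nat -> R) : 0 <= b <= T ->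
  (forall delta, 0 < delta -> \forall N \near \oo, exists m u, [/\ u 0%N = 0, u m = b,
     forall i, (i < m)%N -> u i < u i.+1 < u i + delta &
     S N = \sum_(i < m) expR (alpha * u i) * (B (u i.+1) w - B (u i) w)]) ->
  S N @[N --> \oo] --> M b w.
Proof.
move=> bT HS; apply/cvgrPdist_lt => e e0.
have e'0 : 0 < e * expR (- alpha * b) by rewrite mulr_gt0 ?expR_gt0.
have [delta d0 Hd] := is_RS_integral_left_sum (YOU w bT) e'0.
near=> N; have [m [u [u0 um udelta ->]]] : exists m u, [/\ u 0%N = 0, u m = b,
     forall i, (i < m)%N -> u i < u i.+1 < u i + delta &
     S N = \sum_(i < m) expR (alpha * u i) * (B (u i.+1) w - B (u i) w)].
  by near: N; exact: HS.
have := Hd m u u0 um udelta.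
have -> : \sum_(i < m) expR (- alpha * (b - u i)) * (B (u i.+1) w - B (u i) w) =
    expR (- alpha * b) * \sum_(i < m) expR (alpha * u i) * (B (u i.+1) w - B (u i) w).
  rewrite mulr_sumr; apply: eq_bigr => i _; rewrite mulrA -expRD; congr (expR _ * _); ring.
set S' := \sum_(i < m) _ => {}Hd.
have -> : M b w - S' = - (expR (alpha * b) * (expR (- alpha * b) * S' - (Y b w - Y0 * expR (- alpha * b)))).
  have E : expR (alpha * b) * expR (- alpha * b) = 1.
    by rewrite mulNr expRN divff// gt_eqF// expR_gt0.
  by rewrite mulrBr mulrA E mul1r opprB.
rewrite normrN normrM ger0_norm ?expR_ge0//.
by rewrite -ltr_pdivlMl ?expR_gt0// -expRN -(mulNr alpha) [ltRHS]mulrC.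
Unshelve. all: by end_near. Qed.

Lemma ou_noise0 w : M 0 w = 0.
Proof.
have T00 : (0 : R) <= 0 <= T by rewrite lexx ltW.
by rewrite /ou_noise (is_RS_integral_point (YOU w T00)) mulr0.
Qed.

Let near_lt (c delta : R) : 0 < delta -> \forall N \near \oo, c / N.+1%:R < delta.
Proof.
move=> d0; have /cvgrPdist_lt/(_ delta d0) := @cvg_invn_shift R c.
apply: filterS => N; rewrite sub0r normrN; apply: le_lt_trans; exact: ler_norm.
Qed.

Let grid_step (a b delta : R) N i : a < b -> (b - a) / N.+1%:R < delta ->
  linear_grid a b N.+1 i < linear_grid a b N.+1 i.+1 < linear_grid a b N.+1 i + delta.
Proof.
by move=> ab h; rewrite linear_gridS ltrDl divr_gt0 ?subr_gt0 ?ltr0n//= ltrD2l.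
Qed.

(** The definition of Y provides integrals from 0 only. The sum over [a, b] is obtained by
    subtracting the sum over [0, a] from the sum over the concatenation of the two grids. The cases
    a = b and a = 0 are separate because partitions are strictly increasing. *)
Lemma left_sum_cvg a b w : 0 <= a -> a <= b -> b <= T ->
  left_sum a b N.+1 w @[N --> \oo] --> M b w - M a w.
Proof.
move=> a0 ab bT.
have cvg0 t : 0 <= t <= T -> left_sum 0 t N.+1 w @[N --> \oo] --> M t w.
  move=> tT; have [->|t0] := eqVneq t 0.
    rewrite ou_noise0; apply: cvg_near_cst; near=> N.
    rewrite /left_sum big1// => k _.
    by rewrite /linear_grid subrr !mul0r subrr mulr0.
  have tp : 0 < t by rewrite lt_neqAle eq_sym t0; case/andP: tT.
  apply: noise_cvg => // delta d0; near=> N; exists N.+1, (linear_grid 0 t N.+1).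
  split; rewrite ?linear_grid0 ?linear_gridN// => i iN; apply: grid_step => //.
  by near: N; exact: near_lt.
have [<-|a_neq_b] := eqVneq a b.
  rewrite subrr; apply: cvg_near_cst; near=> N; rewrite /left_sum big1// => k _.
  by rewrite /linear_grid subrr !mul0r subrr mulr0.
have [->|a_neq0] := eqVneq a 0; first by rewrite ou_noise0 subr0; apply: cvg0; rewrite bT (le_trans a0).
have {}ab : a < b by rewrite lt_neqAle a_neq_b.
have {a_neq0}a0 : 0 < a by rewrite lt_neqAle eq_sym a_neq0.
have aT : 0 <= a <= T by rewrite (ltW a0) (le_trans (ltW ab)).
have cvgb : (left_sum 0 a N.+1 w + left_sum a b N.+1 w) @[N --> \oo] --> M b w.
  apply: noise_cvg => [|delta d0]; first by rewrite bT (le_trans (ltW a0) (ltW ab)).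
  near=> N; pose u i := if (i <= N.+1)%N then linear_grid 0 a N.+1 i
    else linear_grid a b N.+1 (i - N.+1).
  have ul i : (i <= N.+1)%N -> u i = linear_grid 0 a N.+1 i by rewrite /u => ->.
  have ur i : u (N.+1 + i)%N = linear_grid a b N.+1 i.
    rewrite /u addKn; case: i => [|i]; first by rewrite addn0 leqnn linear_grid0 linear_gridN.
    by rewrite ifF//; apply/negbTE; rewrite -ltnNge addnS ltnS leq_addr.
  exists (N.+1 + N.+1)%N, u; split.
  - by rewrite ul// linear_grid0.
  - by rewrite ur linear_gridN.
  - move=> i im; have [iN|Ni] := ltnP i N.+1.
      rewrite (ul i (ltnW iN)) (ul i.+1 iN); apply: grid_step => //.
      by near: N; exact: near_lt.
    have -> : i = (N.+1 + (i - N.+1))%N by rewrite subnKC.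
    rewrite -addnS !ur; apply: grid_step => //.
    by near: N; exact: near_lt.
  - rewrite big_split_ord/=; congr (_ + _); apply: eq_bigr => i _.
      by rewrite !ul// ltnW.
    by rewrite -addnS !ur.
rewrite (_ : (fun N => _) = (fun N => left_sum 0 a N.+1 w + left_sum a b N.+1 w - left_sum 0 a N.+1 w)).
  by apply: cvgB => //; exact: cvg0.
by apply/funext => N; rewrite addrC addKr.
Unshelve. all: by end_near. Qed.

Let left_sum_cvg0 t w : 0 <= t -> t <= T -> left_sum 0 t N.+1 w @[N --> \oo] --> M t w.
Proof. by move=> t0 tT; have := @left_sum_cvg 0 t w (lexx 0) t0 tT; rewrite ou_noise0 subr0. Qed.

Let measurable_left_sum a b N : measurable_fun setT (left_sum a b N).
Proof.
by apply: measurable_sum => k; apply: measurable_funM => //; exact: measurable_funB.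
Qed.

Lemma measurable_ou_noise t : 0 <= t <= T -> measurable_fun setT (M t).
Proof.
move=> /andP[t0 tT]; apply: (@measurable_fun_cvg _ _ _ setT (fun N => left_sum 0 t N.+1)).
  by move=> N; exact: measurable_left_sum.
by move=> w _; exact: left_sum_cvg0.
Qed.

Let grid_T a b N k : 0 <= a -> a <= b -> b <= T -> (k <= N)%N -> 0 <= linear_grid a b N k <= T.
Proof.
move=> a0 ab bT kN; have /andP[h1 h2] := linear_grid_itv ab kN.
by rewrite (le_trans a0 h1) (le_trans h2 bT).
Qed.

Let coef_itv a b N k : a <= b -> (k < N)%N ->
  expR (alpha * a) <= expR (alpha * linear_grid a b N k) <= expR (alpha * b).
Proof.
move=> ab kN; have /andP[h1 h2] := linear_grid_itv ab (ltnW kN).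
by rewrite !ler_expR !ler_pM2l// h1 h2.
Qed.

Let coef_mono a b N k : a <= b ->
  expR (alpha * linear_grid a b N k) <= expR (alpha * linear_grid a b N k.+1).
Proof. by move=> ab; rewrite ler_expR ler_pM2l// linear_grid_le. Qed.

Lemma ou_noise_bounded w : exists2 K, 0 <= K & forall t, 0 <= t <= T -> `|M t w| <= K.
Proof.
have [_ _ _ cB] := fbm; have [K K0 HK] := continuous_segment_bounded (cB w).
exists (expR (alpha * T) * (2 * K)); first by rewrite !mulr_ge0 ?expR_ge0.
move=> t tT; have /andP[t0 tT'] := tT.
have cN : `|left_sum 0 t N.+1 w| @[N --> \oo] --> `|M t w|.
  by apply: cvg_norm; exact: left_sum_cvg0.
rewrite -(cvg_lim _ cN)//; apply: limr_le; first exact: (cvgP _ cN).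
apply: nearW => N; apply: (@abel_sum_norm R (fun k => expR (alpha * linear_grid 0 t N.+1 k))
  (fun k => B (linear_grid 0 t N.+1 k) w) N.+1 _ K) => //.
- move=> k kN; rewrite expR_ge0/=; have /andP[_ h] := coef_itv t0 kN.
  by rewrite (le_trans h)// ler_expR ler_pM2l.
- by move=> k _; exact: coef_mono.
- by move=> k kN; apply: HK; exact: grid_T.
Qed.

Let sqr_cont : continuous (fun x : R => x ^+ 2). Proof. exact: sqr_continuous. Qed.

Lemma ou_noise_increment_sqr a b : 0 <= a -> a <= b -> b <= T ->
  (\int[P]_w ((M b w - M a w) ^+ 2)%:E <= (expR (alpha * T) ^+ 2 * (b - a) `^ (2 * H))%:E)%E.
Proof.
move=> a0 ab bT.
apply: (@ge0_integral_limit_le R _ _ P (fun N => left_sum a b N.+1) _ (fun x => x ^+ 2)) => //.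
- by move=> w; exact: left_sum_cvg.
- by move=> x; exact: sqr_ge0.
move=> N; rewrite -{2}(linear_gridN a b (ltn0Sn N)) -[in X in (_ - X) `^ _](linear_grid0 a b N.+1).
apply: (@fbm_sum_sqr _ _ _ P T H B H01 fbm (fun k => expR (alpha * linear_grid a b N.+1 k)) (linear_grid a b N.+1) N.+1) => //.
- move=> k kN; rewrite expR_ge0/=; have /andP[_ h] := coef_itv ab kN.
  by rewrite (le_trans h)// ler_expR ler_pM2l.
- by move=> k _; exact: coef_mono.
- by move=> k kN; exact: grid_T.
- by move=> k _; exact: linear_grid_le.
Qed.

(** Replacing the integrand by its value at a leaves the coefficients exp (alpha u k) - exp (alpha
    a), still nonnegative and nondecreasing but bounded by the oscillation of the exponential on
    [a, b]. This yields one more order in b - a. *)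
Lemma ou_noise_left_point a b : 0 <= a -> a <= b -> b <= T ->
  (\int[P]_w ((M b w - M a w - expR (alpha * a) * (B b w - B a w)) ^+ 2)%:E <=
   ((expR (alpha * b) - expR (alpha * a)) ^+ 2 * (b - a) `^ (2 * H))%:E)%E.
Proof.
move=> a0 ab bT.
apply: (@ge0_integral_limit_le R _ _ P (fun N w => left_sum a b N.+1 w - expR (alpha * a) * (B b w - B a w)) _ (fun x => x ^+ 2)) => //.
- move=> N; apply: measurable_funB; first exact: measurable_left_sum.
  by apply: measurable_funM => //; exact: measurable_funB.
- by move=> w; apply: cvgB; [exact: left_sum_cvg|exact: cvg_cst].
- by move=> x; exact: sqr_ge0.
move=> N.
pose u := linear_grid a b N.+1.
have -> : (fun w => ((left_sum a b N.+1 w - expR (alpha * a) * (B b w - B a w)) ^+ 2)%:E) =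
   (fun w => ((\sum_(k < N.+1) (expR (alpha * u k) - expR (alpha * a)) * (B (u k.+1) w - B (u k) w)) ^+ 2)%:E).
  apply/funext => w; congr ((_ ^+ 2)%:E).
  rewrite [RHS](eq_bigr (fun k : 'I_N.+1 => expR (alpha * u k) * (B (u k.+1) w - B (u k) w) -
    expR (alpha * a) * (B (u k.+1) w - B (u k) w))); last by move=> k _; rewrite mulrBl.
  rewrite sumrB -mulr_sumr; congr (_ - _ * _).
  rewrite -(big_mkord xpredT (fun k => B (u k.+1) w - B (u k) w)) telescope_sumr//.
  by rewrite /u linear_grid0 linear_gridN.
have -> : (b - a) `^ (2 * H) = (u N.+1 - u 0%N) `^ (2 * H).
  by rewrite /u linear_grid0 linear_gridN.
apply: (@fbm_sum_sqr _ _ _ P T H B H01 fbm (fun k => expR (alpha * u k) - expR (alpha * a)) u N.+1) => //.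
- by rewrite subr_ge0 ler_expR ler_pM2l.
- move=> k kN; have /andP[h1 h2] := coef_itv ab kN.
  by rewrite subr_ge0 h1 lerB.
- by move=> k _; rewrite lerB// coef_mono.
- by move=> k kN; exact: grid_T.
- by move=> k _; exact: linear_grid_le.
Qed.

Lemma ou_noise_exp_sqr e t : 0 <= e -> 8 * e * (expR (alpha * T) ^+ 2 * T `^ (2 * H)) <= 1 ->
  0 <= t <= T -> (\int[P]_w (expR (e * M t w ^+ 2))%:E <= 4%:E)%E.
Proof.
move=> e0 eK /andP[t0 tT].
apply: (@ge0_integral_limit_le R _ _ P (fun N => left_sum 0 t N.+1) _ (fun x => expR (e * x ^+ 2))).
- by move=> N; exact: measurable_left_sum.
- by move=> w; exact: left_sum_cvg0.
- move=> x; apply: (cvg_comp (fun x => e * x ^+ 2) expR); last exact: continuous_expR.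
  by apply: cvgM; [exact: cvg_cst|exact: sqr_cont].
- by move=> x; exact: expR_ge0.
move=> N; apply: (@fbm_sum_exp_sqr _ _ _ P T H B fbm (fun k => expR (alpha * linear_grid 0 t N.+1 k)) (linear_grid 0 t N.+1) N.+1 _ _ _ e0 eK).
  by move=> k kN; exact: grid_T.
apply: (@le_trans _ _ (expR (alpha * T) ^+ 2 *
    (linear_grid 0 t N.+1 N.+1 - linear_grid 0 t N.+1 0) `^ (2 * H))%:E).
  apply: (@fbm_sum_sqr _ _ _ P T H B H01 fbm (fun k => expR (alpha * linear_grid 0 t N.+1 k)) (linear_grid 0 t N.+1) N.+1) => //.
  - move=> k kN; rewrite expR_ge0/=; have /andP[_ h] := coef_itv t0 kN.
    by rewrite (le_trans h)// ler_expR ler_pM2l.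
  - by move=> k _; exact: coef_mono.
  - by move=> k kN; exact: grid_T.
  - by move=> k _; exact: linear_grid_le.
rewrite lee_fin ler_wpM2l ?sqr_ge0// linear_gridN// linear_grid0 subr0.
rewrite ge0_ler_powR ?nnegrE ?(ltW T0)// mulr_ge0//.
by case/andP: H01 => h _; apply: le_trans (ltW h).
Qed.

End ornstein_uhlenbeck.

(** * Elementary bounds on second moments *)

Section square_bounds.
Context {R : realType} {d : measure_display} {Omega : measurableType d}.
Variable P : probability Omega R.
Implicit Types (X : Omega -> R) (a b c : R).

Lemma integral_sqrD_le X X' a b : measurable_fun setT X -> measurable_fun setT X' ->
  (\int[P]_w (X w ^+ 2)%:E <= a%:E)%E -> (\int[P]_w (X' w ^+ 2)%:E <= b%:E)%E ->
  (\int[P]_w ((X w + X' w) ^+ 2)%:E <= (2 * (a + b))%:E)%E.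
Proof.
move=> mX mX' Xa Xb.
have mX2 : measurable_fun setT (fun w => (X w ^+ 2)%:E).
  by apply/measurable_EFinP; exact: measurable_funX.
have mX2' : measurable_fun setT (fun w => (X' w ^+ 2)%:E).
  by apply/measurable_EFinP; exact: measurable_funX.
apply: (@le_trans _ _ (\int[P]_w (2%:E * ((X w ^+ 2)%:E + (X' w ^+ 2)%:E)))%E).
  apply: ge0_le_integral => //.
  - by move=> w _; rewrite lee_fin sqr_ge0.
  - by apply/measurable_EFinP; apply: measurable_funX; exact: measurable_funD.
  - by apply: emeasurable_funM => //; exact: emeasurable_funD.
  - by move=> w _; rewrite -EFinD -EFinM lee_fin; have := sqr_ge0 (X w - X' w); nra.
rewrite ge0_integralZl_EFin//; last 2 first.
- by move=> w _; rewrite -EFinD lee_fin addr_ge0 ?sqr_ge0.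
- exact: emeasurable_funD.
rewrite EFinM lee_wpmul2l// ge0_integralD//.
- by rewrite EFinD; exact: leeD.
- by move=> w _; rewrite lee_fin sqr_ge0.
- by move=> w _; rewrite lee_fin sqr_ge0.
Qed.

Lemma integral_sqrZ_le X a c : measurable_fun setT X ->
  (\int[P]_w (X w ^+ 2)%:E <= a%:E)%E ->
  (\int[P]_w ((c * X w) ^+ 2)%:E <= (c ^+ 2 * a)%:E)%E.
Proof.
move=> mX Xa; under eq_integral do rewrite exprMn EFinM.
rewrite ge0_integralZl_EFin ?sqr_ge0//.
- by rewrite [leRHS]EFinM lee_wpmul2l// lee_fin sqr_ge0.
- by move=> w _; rewrite lee_fin sqr_ge0.
- by apply/measurable_EFinP; exact: measurable_funX.
Qed.

Lemma sum_sqr_le m (x : nat -> R) : (\sum_(i < m) x i) ^+ 2 <= m%:R * \sum_(i < m) x i ^+ 2.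
Proof.
elim: m => [|m IH]; first by rewrite !big_ord0 expr0n mul0r.
rewrite !big_ord_recr/= -natr1; move: IH.
have [->|m0] := eqVneq m 0%N.
  by rewrite !big_ord0 !add0r mul1r.
set S := \sum_(i < m) _; set Q := \sum_(i < m) _ => IH.
have mp : 0 < m%:R :> R by rewrite ltr0n lt0n.
have : 2 * S * x m <= Q + m%:R * x m ^+ 2.
  have : 0 <= (S - m%:R * x m) ^+ 2 / m%:R by rewrite divr_ge0 ?sqr_ge0.
  have -> : (S - m%:R * x m) ^+ 2 / m%:R = S ^+ 2 / m%:R - 2 * S * x m + m%:R * x m ^+ 2.
    by field; rewrite gt_eqF.
  have : S ^+ 2 / m%:R <= Q by rewrite ler_pdivrMr// mulrC.
  lra.
by move: IH; nra.
Qed.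

Lemma integral_sqr_sum_le m (X : nat -> Omega -> R) a :
  (forall i, (i < m)%N -> measurable_fun setT (X i)) ->
  (forall i, (i < m)%N -> (\int[P]_w (X i w ^+ 2)%:E <= a%:E)%E) ->
  (\int[P]_w ((\sum_(i < m) X i w) ^+ 2)%:E <= (m%:R ^+ 2 * a)%:E)%E.
Proof.
move=> mX Xa.
have mX2 (i : 'I_m) : measurable_fun setT (fun w => (X i w ^+ 2)%:E).
  by apply/measurable_EFinP; apply: measurable_funX; exact: mX.
apply: (@le_trans _ _ (\int[P]_w (m%:R%:E * \sum_(i < m) (X i w ^+ 2)%:E))%E).
  apply: ge0_le_integral => //.
  - by move=> w _; rewrite lee_fin sqr_ge0.
  - apply/measurable_EFinP; apply: measurable_funX.
    rewrite (_ : (fun w => _) = (fun w => \sum_(i < m) (if (i < m)%N then X i w else 0))).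
      apply: measurable_sum => i; rewrite ltn_ord; exact: mX.
    by apply/funext => w; apply: eq_bigr => i _; rewrite ltn_ord.
  - by apply: emeasurable_funM => //; apply: emeasurable_sum => i _; exact: mX2.
  - by move=> w _; rewrite sumEFin -EFinM lee_fin; exact: (sum_sqr_le m (X ^~ w)).
rewrite ge0_integralZl_EFin//; last 2 first.
- by move=> w _; apply: sume_ge0 => i _; rewrite lee_fin sqr_ge0.
- by apply: emeasurable_sum => i _; exact: mX2.
rewrite (_ : m%:R ^+ 2 * a = m%:R * (m%:R * a)); last by rewrite mulrA.
rewrite [leRHS]EFinM lee_wpmul2l// ge0_integral_sum//; last first.
  by move=> i w _; rewrite lee_fin sqr_ge0.
apply: (@le_trans _ _ (\sum_(i < m) a%:E)%E); first by apply: lee_sum => i _; exact: Xa.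
by rewrite sumEFin sumr_const card_ord mulr_natl.
Qed.

End square_bounds.

(** * The discretized process: exponential moments and L^2 error *)

Section discretized_ornstein_uhlenbeck.
Context {R : realType} {d : measure_display} {Omega : measurableType d}.
Variables (P : probability Omega R) (T H alpha Y0 : R) (B : R -> {RV P >-> R}).
Variable Y : R -> Omega -> R.
Hypotheses (T0 : 0 < T) (H01 : 2^-1 < H < 1) (alpha0 : 0 < alpha).
Hypotheses (fbm : fractional_brownian T H B) (YOU : fractional_OU T alpha Y0 B Y).

Local Notation M := (ou_noise alpha Y0 Y).
Local Notation Yg := (Yn_grid T alpha Y0 B).
Local Notation tg := (grid T).

Lemma grid_le n j k : (j <= k)%N -> tg n j <= tg n k.
Proof.
by move=> jk; rewrite /grid ler_wpM2r ?invr_ge0// ler_wpM2r ?ler_nat// ltW.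
Qed.

Lemma grid_itv n j : (0 < n)%N -> (j <= n)%N -> 0 <= tg n j <= T.
Proof.
move=> n0 jn; rewrite /grid divr_ge0 ?mulr_ge0 ?(ltW T0)//= ler_pdivrMr ?ltr0n//.
by rewrite mulrC ler_wpM2l ?ler_nat// ltW.
Qed.

Lemma gridS n j : tg n j.+1 = tg n j + T / n%:R.
Proof. by rewrite /grid -natr1 mulrDl mul1r mulrDl. Qed.

Lemma measurable_Yn_grid n j : measurable_fun setT (Yg n j).
Proof.
apply: measurable_funD => //; apply: measurable_funM => //.
by apply: measurable_sum => i; apply: measurable_funM => //; exact: measurable_funB.
Qed.

(** The index n is attained, at s = T; hence the large inequality on the index. *)
Lemma Yn_index n s : (0 < n)%N -> 0 <= s <= T ->
  [/\ (Num.truncn (s * n%:R / T) <= n)%N, tg n (Num.truncn (s * n%:R / T)) <= s &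
    s < tg n (Num.truncn (s * n%:R / T)) + T / n%:R].
Proof.
move=> n0 /andP[s0 sT]; set x := s * n%:R / T; have nR : 0 < n%:R :> R by rewrite ltr0n.
have x0 : 0 <= x by rewrite divr_ge0 ?mulr_ge0// ltW.
have /andP[h1 h2] := truncn_itv x0.
have xE : s = x * (T / n%:R) by rewrite /x; field; rewrite !gt_eqF.
have Tn0 : 0 < T / n%:R by rewrite divr_gt0.
split.
- by rewrite -(ler_nat R) (le_trans h1)// /x ler_pdivrMr// mulrC ler_wpM2l// ltW.
- by rewrite /grid -mulrA [leRHS]xE ler_wpM2r// ltW.
- by rewrite -gridS /grid -mulrA [ltLHS]xE ltr_pM2r.
Qed.

Let expT := expR (alpha * T).
Let K0 := expT ^+ 2 * T `^ (2 * H).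

Let K0_ge0 : 0 <= K0. Proof. by rewrite mulr_ge0 ?sqr_ge0 ?powR_ge0. Qed.

Let expT_ge t : t <= T -> expR (alpha * t) <= expT.
Proof. by move=> tT; rewrite ler_expR ler_pM2l. Qed.

Let exp_le1 t : 0 <= t -> expR (- alpha * t) <= 1.
Proof. by move=> t0; rewrite -expR0 ler_expR mulNr oppr_le0 mulr_ge0// ltW. Qed.

Let exp_sqr_shift (X Z : Omega -> R) e : 0 <= e -> measurable_fun setT X ->
  measurable_fun setT Z ->
  (forall w, Z w ^+ 2 <= 2 * Y0 ^+ 2 + 2 * X w ^+ 2) ->
  (\int[P]_w (expR (2 * e * X w ^+ 2))%:E <= 4%:E)%E ->
  (\int[P]_w (expR (e * Z w ^+ 2))%:E <= (4 * expR (2 * e * Y0 ^+ 2))%:E)%E.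
Proof.
move=> e0 mX mZ ZX X4.
have mexp c (V : Omega -> R) : measurable_fun setT V ->
    measurable_fun setT (fun w => (expR (c * V w ^+ 2))%:E).
  move=> mV; apply/measurable_EFinP; apply: measurableT_comp => //.
  by apply: measurable_funM => //; exact: measurable_funX.
rewrite [4 * _]mulrC [leRHS]EFinM.
apply: (@le_trans _ _ (\int[P]_w ((expR (2 * e * Y0 ^+ 2))%:E * (expR (2 * e * X w ^+ 2))%:E))%E).
  apply: ge0_le_integral => //.
  - exact: mexp.
  - by apply: emeasurable_funM => //; exact: mexp.
  - move=> w _; rewrite -EFinM -expRD lee_fin ler_expR.
    by have := ZX w; nra.
rewrite ge0_integralZl_EFin ?expR_ge0//; last exact: mexp.
by rewrite lee_wpmul2l// lee_fin expR_ge0.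
Qed.

(** K0 bounds the second moments of the noise and of its discretization. The value ensures 8 (2 e)
    K0 <= 1, as [normal_law_exp_sqr] requires at 2 e; the doubling accounts for the initial value,
    split off by (x + y)^2 <= 2 x^2 + 2 y^2. Adding 1 to K0 keeps the denominator positive. *)
Definition ou_exponent : R := (16 * (K0 + 1))^-1.

Let e0 : 0 < ou_exponent. Proof. by rewrite invr_gt0 mulr_gt0// ltr_pwDr. Qed.

Let eK0 : 8 * (2 * ou_exponent) * K0 <= 1.
Proof.
have h : ou_exponent * (16 * (K0 + 1)) = 1.
  by rewrite mulVf// mulf_neq0// gt_eqF// ltr_pwDr.
by have := e0; nra.
Qed.

Lemma ou_exponent_gt0 : 0 < ou_exponent. Proof. exact: e0. Qed.

Lemma ou_noiseE t w : Y t w = Y0 * expR (- alpha * t) + expR (- alpha * t) * M t w.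
Proof.
rewrite /ou_noise mulrA -expRD mulNr addNr expR0 mul1r; ring.
Qed.

Lemma measurable_ou t : 0 <= t <= T -> measurable_fun setT (Y t).
Proof.
move=> tT; rewrite (_ : Y t = fun w => Y0 * expR (- alpha * t) + expR (- alpha * t) * M t w).
  by apply: measurable_funD => //; apply: measurable_funM => //; exact: (measurable_ou_noise T0 YOU).
by apply/funext => w; rewrite -ou_noiseE.
Qed.

Let sqr_shift (e x : R) : 0 <= e <= 1 -> forall c, 0 <= c <= 1 ->
  (Y0 * e + c * x) ^+ 2 <= 2 * Y0 ^+ 2 + 2 * x ^+ 2.
Proof.
move=> /andP[h0 h1] c /andP[c0 c1].
have h2 : (Y0 * e) ^+ 2 <= Y0 ^+ 2 by rewrite exprMn ler_piMr ?sqr_ge0 ?exprn_ile1.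
have h3 : (c * x) ^+ 2 <= x ^+ 2 by rewrite exprMn ler_piMl ?sqr_ge0 ?exprn_ile1.
by have := sqr_ge0 (Y0 * e - c * x); nra.
Qed.

Lemma ou_exp_sqr t : 0 <= t <= T ->
  (\int[P]_w (expR (ou_exponent * Y t w ^+ 2))%:E <=
   (4 * expR (2 * ou_exponent * Y0 ^+ 2))%:E)%E.
Proof.
move=> tT; have /andP[t0 _] := tT.
apply: (@exp_sqr_shift (M t)).
- exact: ltW.
- exact: (measurable_ou_noise T0 YOU).
- exact: measurable_ou.
- by move=> w; rewrite ou_noiseE; apply: sqr_shift; rewrite expR_ge0 exp_le1.
- apply: (ou_noise_exp_sqr T0 H01 alpha0 fbm YOU _ eK0 tT).
  by rewrite mulr_ge0// ltW.
Qed.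

Lemma Yn_grid_exp_sqr n j : (0 < n)%N -> (j <= n)%N ->
  (\int[P]_w (expR (ou_exponent * Yg n j w ^+ 2))%:E <=
   (4 * expR (2 * ou_exponent * Y0 ^+ 2))%:E)%E.
Proof.
move=> n0 jn.
have gT k : (k <= j)%N -> 0 <= tg n k <= T by move=> kj; apply: grid_itv => //; exact: leq_trans jn.
have gj := gT _ (leqnn j); have gj1 := gT _ (leq_pred j).
pose S w := \sum_(i < j) expR (alpha * tg n i) * (B (tg n i.+1) w - B (tg n i) w).
have mS : measurable_fun setT S.
  by apply: measurable_sum => i; apply: measurable_funM => //; exact: measurable_funB.
apply: (@exp_sqr_shift S).
- exact: ltW.
- exact: mS.
- exact: measurable_Yn_grid.
- move=> w; apply: sqr_shift; rewrite expR_ge0 exp_le1//; [by case/andP: gj|by case/andP: gj1].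
- apply: (@fbm_sum_exp_sqr _ _ _ P T H B fbm (fun k => expR (alpha * tg n k)) (tg n) j _ _ _ _ eK0) => //.
    by rewrite mulr_ge0// ltW.
  apply: (@le_trans _ _ (expT ^+ 2 * (tg n j - tg n 0) `^ (2 * H))%:E).
    apply: (@fbm_sum_sqr _ _ _ P T H B H01 fbm (fun k => expR (alpha * tg n k)) (tg n) j) => //.
    + exact: expR_ge0.
    + by move=> k kj; rewrite expR_ge0 expT_ge//; case/andP: (gT _ (ltnW kj)).
    + by move=> k _; rewrite ler_expR ler_pM2l// grid_le.
    + by move=> k _; exact: grid_le.
  rewrite lee_fin ler_wpM2l ?sqr_ge0// {2}/grid !mul0r subr0.
  case/andP: gj => h1 h2; rewrite ge0_ler_powR ?nnegrE ?(ltW T0)// mulr_ge0//.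
  by case/andP: H01 => h _; apply: le_trans (ltW h).
Qed.

Let exp_neg_lip x y : 0 <= x -> 0 <= y ->
  `|expR (- alpha * x) - expR (- alpha * y)| <= alpha * `|x - y|.
Proof.
move=> x0 y0; apply: le_trans (expR_lip _ _) _.
rewrite -mulrBr normrM normrN (gtr0_norm alpha0).
rewrite ler_piMr ?mulr_ge0 ?(ltW alpha0)// -expR0 ler_expR ge_max.
by rewrite !mulNr !oppr_le0 !mulr_ge0 ?(ltW alpha0).
Qed.

Let exp_lip x y : 0 <= x -> x <= y -> y <= T ->
  expR (alpha * y) - expR (alpha * x) <= alpha * (y - x) * expT.
Proof.
move=> x0 xy yT; apply: le_trans (ler_norm _) _; apply: le_trans (expR_lip _ _) _.
rewrite -mulrBr normrM (gtr0_norm alpha0) (ger0_norm (_ : 0 <= y - x)) ?subr_ge0//.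
rewrite ler_wpM2l ?mulr_ge0 ?subr_ge0 ?(ltW alpha0)// ler_expR ge_max !ler_pM2l// yT.
exact: le_trans yT.
Qed.

Let H0 : 0 <= 2 * H.
Proof. by case/andP: H01 => h _; rewrite mulr_ge0//; apply: le_trans (ltW h). Qed.

Let rate n : R := n%:R `^ (- (2 * H)).

(** Because H < 1, deterministic errors of order 1 / n are dominated by n^(-H). *)
Let rate_ge n : (0 < n)%N -> n%:R ^- 2 <= rate n.
Proof.
move=> n0; rewrite -(powR_mulrn 2 (ler0n R n)) -powRN /rate ler_powR ?ler1n//.
by case/andP: H01 => _ h; rewrite lerN2; lra.
Qed.

Let rate_step n : (0 < n)%N -> (T / n%:R) `^ (2 * H) = T `^ (2 * H) * rate n.
Proof.
move=> n0; rewrite powRM ?(ltW T0) ?invr_ge0// -powR_inv1// -powRrM mulN1r.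
by [].
Qed.

(** The error has four parts: the decay of the initial value between t_j and s; the noise between
    t_j and s; the discrepancy between the damping factors at s and at t_(j-1); and the left-point
    errors of the steps before t_j. The first and third are of order 1 / n in L^2, the second and
    fourth are bounded by order n^(-H). *)
Lemma ou_discretization_error : exists2 K : R, 0 <= K &
  forall n s, (0 < n)%N -> 0 <= s <= T ->
  (\int[P]_w ((Y s w - Yn T alpha Y0 B n s w) ^+ 2)%:E <=
   (K * n%:R `^ (- (2 * H)))%:E)%E.
Proof.
pose A1 := (Y0 * alpha * T) ^+ 2.
pose A3 := (2 * alpha * T) ^+ 2 * K0.
pose A4 := (alpha * T * expT) ^+ 2 * T `^ (2 * H).
have A40 : 0 <= A4 by rewrite mulr_ge0 ?sqr_ge0 ?powR_ge0.
exists (2 * (2 * (2 * (A1 + K0) + A3) + A4)).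
  have : 0 <= A1 by exact: sqr_ge0.
  have : 0 <= A3 by rewrite mulr_ge0 ?sqr_ge0.
  have := K0_ge0; lra.
move=> n s n0 sT; rewrite -/(rate n) /Yn; set j := Num.truncn _.
have [jn tjs sjt] := Yn_index n0 sT; rewrite -/j in jn tjs sjt.
have /andP[s0 sT'] := sT.
have nR : 0 < n%:R :> R by rewrite ltr0n.
have Tn0 : 0 <= T / n%:R by rewrite divr_ge0// ltW.
have gT k : (k <= j)%N -> 0 <= tg n k <= T by move=> kj; apply: grid_itv => //; exact: leq_trans jn.
have /andP[tj0 tjT] := gT _ (leqnn j); have /andP[tj1 tj1T] := gT _ (leq_pred j).
have rn := rate_ge n0; have r0 : 0 <= rate n by exact: powR_ge0.
have mM t : 0 <= t <= T -> measurable_fun setT (M t) by exact: (measurable_ou_noise T0 YOU).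
have ms := mM _ sT; have mj := mM _ (gT _ (leqnn j)).
pose X1 (w : Omega) := Y0 * (expR (- alpha * s) - expR (- alpha * tg n j)).
pose X2 w := expR (- alpha * s) * (M s w - M (tg n j) w).
pose X3 w := (expR (- alpha * s) - expR (- alpha * tg n j.-1)) * (M (tg n j) w - M 0 w).
pose D i w := M (tg n i.+1) w - M (tg n i) w - expR (alpha * tg n i) * (B (tg n i.+1) w - B (tg n i) w).
pose X4 w := expR (- alpha * tg n j.-1) * \sum_(i < j) D i w.
have M00 w : M 0 w = 0 by exact: (ou_noise0 T0 YOU).
have mM0 : measurable_fun setT (M 0) by apply: mM; rewrite lexx ltW.
have mD i : (i < j)%N -> measurable_fun setT (D i).
  move=> ij; apply: measurable_funB; first by apply: measurable_funB; apply: mM; apply: gT => //; exact: ltnW.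
  by apply: measurable_funM => //; exact: measurable_funB.
have mX1 : measurable_fun setT X1 by exact: measurable_cst.
have mX2 : measurable_fun setT X2 by apply: measurable_funM => //; exact: measurable_funB.
have mX3 : measurable_fun setT X3 by apply: measurable_funM => //; exact: measurable_funB.
have msumD : measurable_fun setT (fun w => \sum_(i < j) D i w).
  rewrite (_ : (fun w => _) = (fun w => \sum_(i < j) (if (i < j)%N then D i w else 0))).
    by apply: measurable_sum => i; rewrite ltn_ord; exact: mD.
  by apply/funext => w; apply: eq_bigr => i _; rewrite ltn_ord.
have mX4 : measurable_fun setT X4 by exact: measurable_funM.
have -> : (fun w => ((Y s w - Yg n j w) ^+ 2)%:E) = (fun w => ((X1 w + X2 w + X3 w + X4 w) ^+ 2)%:E).
  apply/funext => w; congr ((_ ^+ 2)%:E).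
  rewrite /X4 /D sumrB -(big_mkord xpredT (fun i => M (tg n i.+1) w - M (tg n i) w)) telescope_sumr//.
  rewrite {3}/grid !mul0r M00 subr0 /X1 /X2 /X3 /Yn_grid ou_noiseE M00; ring.
have -> : 2 * (2 * (2 * (A1 + K0) + A3) + A4) * rate n =
  2 * (2 * (2 * (A1 * rate n + K0 * rate n) + A3 * rate n) + A4 * rate n) by ring.
have c1 x : 0 <= x -> expR (- alpha * x) ^+ 2 <= 1.
  by move=> x0; rewrite exprn_ile1 ?expR_ge0 ?exp_le1.
have sq (x y : R) : `|x| <= y -> x ^+ 2 <= y ^+ 2.
  by move=> xy; rewrite -(real_normK (num_real x)) lerXn2r ?nnegrE// (le_trans _ xy).
have nn2 : (n%:R^-1) ^+ 2 = n%:R ^- 2 :> R by rewrite exprVn.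
apply: integral_sqrD_le => //; first by apply: measurable_funD => //; exact: measurable_funD.
  apply: integral_sqrD_le => //; first exact: measurable_funD.
    apply: integral_sqrD_le => //.
    - pose c1' := (Y0 * (expR (- alpha * s) - expR (- alpha * tg n j))) ^+ 2.
      have -> : (\int[P]_w (X1 w ^+ 2)%:E = \int[P]_w cst c1'%:E w)%E by [].
      rewrite integral_cst//= probability_setT mule1 lee_fin.
      apply: (@le_trans _ _ ((Y0 * alpha * T) ^+ 2 * n%:R ^- 2)); last by rewrite ler_wpM2l ?sqr_ge0.
      have -> : (Y0 * alpha * T) ^+ 2 / n%:R ^+ 2 = Y0 ^+ 2 * (alpha * (T / n%:R)) ^+ 2.
        by rewrite -nn2; ring.
      rewrite /c1' [leLHS]exprMn ler_wpM2l ?sqr_ge0//.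
      apply: sq; apply: le_trans (exp_neg_lip s0 tj0) _.
      rewrite ler_wpM2l ?(ltW alpha0)// ger0_norm ?subr_ge0// lerBlDl; exact: ltW.
    - have sb : 0 <= s - tg n j by rewrite subr_ge0.
      have h := ou_noise_increment_sqr T0 H01 alpha0 fbm YOU tj0 tjs sT'.
      apply: le_trans (integral_sqrZ_le _ _ h) _; first exact: measurable_funB.
      rewrite lee_fin; apply: (@le_trans _ _ (1 * (expT ^+ 2 * (T / n%:R) `^ (2 * H)))).
        rewrite ler_pM ?sqr_ge0 ?c1 ?mulr_ge0 ?powR_ge0 ?sqr_ge0// ler_wpM2l ?sqr_ge0//.
        by rewrite ge0_ler_powR ?nnegrE// lerBlDl ltW.
      by rewrite mul1r rate_step// mulrA.
  have h := ou_noise_increment_sqr T0 H01 alpha0 fbm YOU (lexx 0) tj0 tjT.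
  apply: le_trans (integral_sqrZ_le _ _ h) _; first exact: measurable_funB.
  rewrite lee_fin; apply: (@le_trans _ _ ((2 * alpha * T) ^+ 2 * n%:R ^- 2 * K0)); last first.
    by rewrite /A3 -mulrA (mulrC _ K0) mulrA ler_wpM2l// mulr_ge0 ?sqr_ge0.
  rewrite ler_pM ?sqr_ge0 ?mulr_ge0 ?powR_ge0 ?sqr_ge0//; last first.
    by rewrite /K0 ler_wpM2l ?sqr_ge0// subr0 ge0_ler_powR ?nnegrE// ltW.
  rewrite -nn2 -exprMn; apply: sq; apply: le_trans (exp_neg_lip s0 tj1) _.
  rewrite -!mulrA (mulrCA 2) ler_wpM2l ?(ltW alpha0)//.
  (* The scheme damps by the exponential at t_(j-1), which can lie two steps before s. For j = 0 the
     truncated predecessor is 0 and the lag is a single step. *)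
  have s1 : s - tg n j.-1 <= 2 * (T / n%:R).
    move: sjt; case: (j) => [|k] /=; first by lra.
    by rewrite gridS; lra.
  rewrite ger0_norm// subr_ge0 (le_trans _ tjs)//; exact/grid_le/leq_pred.
(* Each left-point error is of order n^(-1-H) in L^2. The crude bound by the number of terms then
   costs a factor j <= n, which leaves n^(-H). *)
have hD i : (i < j)%N -> (\int[P]_w (D i w ^+ 2)%:E <=
    ((alpha * (T / n%:R) * expT) ^+ 2 * (T / n%:R) `^ (2 * H))%:E)%E.
  move=> ij; have /andP[a0 _] := gT _ (ltnW ij); have /andP[_ bT] := gT _ ij.
  have ab := grid_le n (leqnSn i).
  have E : tg n i.+1 - tg n i = T / n%:R by rewrite gridS addrC addKr.
  apply: le_trans (ou_noise_left_point T0 H01 alpha0 fbm YOU a0 ab bT) _.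
  rewrite lee_fin E ler_wpM2r ?powR_ge0//; apply: sq.
  rewrite ger0_norm ?subr_ge0 ?ler_expR ?ler_pM2l//.
  by rewrite -E exp_lip.
have h := integral_sqr_sum_le mD hD.
apply: le_trans (integral_sqrZ_le _ msumD h) _.
rewrite lee_fin -[leRHS]mul1r; apply: ler_pM => //; [|exact: c1|].
  by apply: mulr_ge0; [exact: sqr_ge0|apply: mulr_ge0; [exact: sqr_ge0|exact: powR_ge0]].
rewrite rate_step// /A4 mulrA mulrA ler_wpM2r// mulrA ler_wpM2r ?powR_ge0//.
rewrite -exprMn; apply: sq.
have -> : j%:R * (alpha * T / n%:R * expT) = (alpha * T * expT) * (j%:R / n%:R) by ring.
have c0 : 0 <= alpha * T * expT by rewrite !mulr_ge0 ?expR_ge0 ?(ltW T0) ?(ltW alpha0).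
have q0 : 0 <= j%:R / n%:R :> R by rewrite divr_ge0.
by rewrite normrM (ger0_norm c0) (ger0_norm q0) ler_piMr// ler_pdivrMr// mul1r ler_nat.
Qed.

End discretized_ornstein_uhlenbeck.

(** * Time integrals of jointly measurable processes *)

Section process_integrals.
Context {R : realType} {d : measure_display} {Omega : measurableType d}.
Variables (P : probability Omega R) (T : R).
Hypothesis T0 : 0 < T.
Local Notation mu := (@lebesgue_measure R).

(* Measurability on [0, T] x Omega, phrased through the retraction [clamp T] of R
   onto [0, T] because the processes are unspecified outside [0, T]. *)
Definition jointly_measurable (F : R -> Omega -> R) :=
  measurable_fun setT (fun p : R * Omega => F (clamp T p.1) p.2).

(** Setting the process to 0 outside [0, T] allows Tonelli's theorem to be used on the whole of R x
    Omega. *)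
Let extend (F : R -> Omega -> R) (p : R * Omega) : \bar R :=
  (if (0 <= p.1) && (p.1 <= T) then F (clamp T p.1) p.2 else 0)%:E.

Let measurable_extend F : jointly_measurable F -> measurable_fun setT (extend F).
Proof.
move=> mF; apply/measurable_EFinP; apply: measurable_fun_ifT => //.
by apply: measurable_and; apply: measurable_fun_ler.
Qed.

Let integral_extend F w : (\int[mu]_s extend F (s, w) = \int[mu]_(s in `[0%R, T]) (F s w)%:E)%E.
Proof.
rewrite [RHS]integral_mkcond; apply: eq_integral => s _; rewrite /patch /extend mem_setE in_itv/=.
by case: ifPn => // sT; rewrite clamp_id.
Qed.

Lemma jointly_measurable_section F s : 0 <= s <= T -> jointly_measurable F ->
  measurable_fun setT (F s).
Proof.
move=> sT mF; rewrite (_ : F s = (fun w => F (clamp T s) w)); last by rewrite clamp_id.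
exact: (measurableT_comp mF (pair1_measurable s)).
Qed.

Lemma jointly_measurable_path F w : jointly_measurable F ->
  measurable_fun `[0, T] (fun s => F s w).
Proof.
move=> mF; apply: (@eq_measurable_fun _ _ _ _ _ (fun s => F (clamp T s) w)).
  by move=> s; rewrite inE/= in_itv/= => sT; rewrite clamp_id.
by apply: measurable_funTS; exact: (measurableT_comp mF (pair2_measurable w)).
Qed.

Lemma measurable_process_integral F : jointly_measurable F ->
  (forall s w, 0 <= s <= T -> 0 <= F s w) ->
  measurable_fun setT (fun w => \int[mu]_(s in `[0%R, T]) (F s w)%:E)%E.
Proof.
move=> mF F0; rewrite (_ : (fun w => _) = fubini_G mu (extend F)).
  apply: measurable_fun_fubini_tonelli_G; first exact: measurable_extend.
  by move=> p; rewrite lee_fin; case: ifPn => // pT; apply: F0; apply: clamp_itv; exact: ltW.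
by apply/funext => w; rewrite /fubini_G integral_extend.
Qed.

Lemma integral_process_le F K : jointly_measurable F ->
  (forall s w, 0 <= s <= T -> 0 <= F s w) ->
  (forall s, 0 <= s <= T -> (\int[P]_w (F s w)%:E <= K%:E)%E) ->
  (\int[P]_w \int[mu]_(s in `[0%R, T]) (F s w)%:E <= (T * K)%:E)%E.
Proof.
move=> mF F0 FK.
have e0 p : (0 <= extend F p)%E.
  by rewrite lee_fin; case: ifPn => // pT; apply: F0; apply: clamp_itv; exact: ltW.
have me := measurable_extend mF.
have -> : (\int[P]_w \int[mu]_(s in `[0%R, T]) (F s w)%:E =
    \int[P]_w \int[mu]_s extend F (s, w))%E.
  by apply: eq_integral => w _; rewrite integral_extend.
rewrite -(@fubini_tonelli _ _ _ _ _ mu P (extend F) me e0).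
apply: (@le_trans _ _ (\int[mu]_s (K%:E * (\1_(`[0, T]%classic : set R) s)%:E))%E).
  apply: ge0_le_integral => //.
  - by move=> s _; exact: integral_ge0.
  - exact: measurable_fun_fubini_tonelli_F.
  - by apply: emeasurable_funM => //; apply/measurable_EFinP; exact: measurable_indic.
  - move=> s _; rewrite indicE mem_setE in_itv/=; have [sT|/negbTE sT] := boolP (0 <= s <= T).
      rewrite mule1 (eq_integral (fun w => (F s w)%:E)); first exact: FK.
      by move=> w _; rewrite /extend/= sT clamp_id.
    by rewrite mule0 (eq_integral (cst 0%E)) ?integral0// => w _; rewrite /extend/= sT.
have K0 : 0 <= K.
  have T00 : (0 : R) <= 0 <= T by rewrite lexx ltW.
  rewrite -lee_fin; apply: le_trans (FK 0 T00).
  by apply: integral_ge0 => w _; rewrite lee_fin F0.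
rewrite ge0_integralZl_EFin//; last first.
  by apply/measurable_EFinP; exact: measurable_indic.
rewrite integral_indic//= setIT lebesgue_measure_itv/= lte_fin T0.
by rewrite -EFinB -EFinM subr0 mulrC.
Qed.

End process_integrals.

(** * Sublinear growth of the volatility *)

Section subgaussian_volatility.
Context {R : realType}.
Variables (sigma : R -> R) (Csigma q : R).
Hypotheses (C0 : 0 < Csigma) (q01 : 0 < q < 1) (sigma_ge0 : forall x, 0 <= sigma x).
Hypothesis sigma_growth : forall x, sigma x <= Csigma * (1 + `|x| `^ q).

(** The threshold A = delta^(-1 / (1 - q)) is the point where t^(q - 1) equals delta: below it t^q
    <= A^q, above it t^q <= delta t. *)
Let powR_lt1_le (delta t : R) : 0 < delta -> 0 <= t ->
  t `^ q <= (delta `^ (- (1 - q)^-1)) `^ q + delta * t.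
Proof.
move=> d0 t0; case/andP: q01 => q0 q1; set A := delta `^ _.
have A0 : 0 < A by rewrite powR_gt0.
have [tA|At] := leP t A.
  rewrite -[leLHS]addr0 lerD ?mulr_ge0 ?(ltW d0)//.
  by rewrite ge0_ler_powR ?nnegrE ?(ltW q0) ?(ltW A0).
have tp : 0 < t by exact: lt_trans At.
rewrite -[leLHS]add0r lerD ?powR_ge0//.
have -> : t `^ q = t * t `^ (q - 1).
  have E : t `^ (1 + (q - 1)) = t `^ 1 * t `^ (q - 1).
    by apply: powRD; apply/implyP => _; rewrite (gt_eqF tp).
  by rewrite powRr1// in E; rewrite -E; congr (_ `^ _); lra.
rewrite mulrC ler_wpM2r//.
have AE : A `^ (1 - q) = delta^-1.
  by rewrite /A -powRrM mulNr mulVf ?powR_inv1 ?(ltW d0)// gt_eqF// subr_gt0.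
rewrite -opprB powRN -[leRHS]invrK -AE lef_pV2 ?posrE ?powR_gt0//.
by rewrite ge0_ler_powR ?nnegrE ?subr_ge0 ?(ltW q1) ?(ltW A0) ?(ltW At) ?(ltW tp).
Qed.

(** Since sigma(x)^2 grows like (x^2)^q with q < 1, any multiple of it is below an arbitrarily small
    multiple of x^2 up to a constant. A single small Gaussian exponent of Y therefore yields
    exponential moments of every order for the variance. *)
Lemma sqr_volatility_le (k e : R) : 0 <= k -> 0 < e ->
  exists2 c, 0 <= c & forall x, k * sigma x ^+ 2 <= c + e * x ^+ 2.
Proof.
move=> k0 e0; pose D := 2 * (k + 1) * Csigma ^+ 2.
have D0 : 0 < D by rewrite !mulr_gt0 ?exprn_gt0//; lra.
pose delta := e / D; have d0 : 0 < delta by rewrite divr_gt0.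
pose A := (delta `^ (- (1 - q)^-1)) `^ q; have A0 : 0 <= A by exact: powR_ge0.
exists (D * (1 + A)); first by rewrite mulr_ge0 ?(ltW D0) ?addr_ge0.
move=> x; have s0 := sigma_ge0 x; have sg := sigma_growth x.
have p0 : 0 <= `|x| `^ q by exact: powR_ge0.
have px : (`|x| `^ q) ^+ 2 <= A + delta * x ^+ 2.
  have := powR_lt1_le d0 (sqr_ge0 x); rewrite -/A.
  by rewrite -(real_normK (num_real x)) expr2 powRM// -expr2.
have h : sigma x ^+ 2 <= Csigma ^+ 2 * (2 * (1 + (`|x| `^ q) ^+ 2)).
  apply: (@le_trans _ _ ((Csigma * (1 + `|x| `^ q)) ^+ 2)).
    by rewrite lerXn2r// nnegrE// mulr_ge0 ?(ltW C0) ?addr_ge0.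
  rewrite exprMn ler_wpM2l ?sqr_ge0//; have := sqr_ge0 (1 - `|x| `^ q); nra.
apply: (@le_trans _ _ (D * (1 + (`|x| `^ q) ^+ 2))).
  apply: (@le_trans _ _ ((k + 1) * sigma x ^+ 2)); first by rewrite ler_wpM2r ?sqr_ge0// lerDl.
  have -> : D * (1 + `|x| `^ q ^+ 2) = (k + 1) * (Csigma ^+ 2 * (2 * (1 + (`|x| `^ q) ^+ 2))).
    by rewrite /D; ring.
  by rewrite ler_wpM2l// addr_ge0.
have -> : D * (1 + A) + e * x ^+ 2 = D * (1 + (A + delta * x ^+ 2)).
  by rewrite /delta; field; rewrite gt_eqF.
by rewrite ler_wpM2l ?(ltW D0)// lerD2l.
Qed.

End subgaussian_volatility.

(** * The integrated variance: exponential moments and differences *)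

Section integrated_variance.
Context {R : realType} {d : measure_display} {Omega : measurableType d}.
Variables (P : probability Omega R) (T : R) (sigma : R -> R) (smin Csigma q r : R).
Hypotheses (T0 : 0 < T) (smin0 : 0 < smin) (C0 : 0 < Csigma) (q01 : 0 < q < 1).
Hypothesis r01 : 0 < r <= 1.
Hypothesis sigma_min : forall x, smin <= sigma x.
Hypothesis sigma_growth : forall x, sigma x <= Csigma * (1 + `|x| `^ q).
Hypothesis sigma_holder : forall x y, `|sigma x - sigma y| <= Csigma * `|x - y| `^ r.
Hypothesis sigma_cont : continuous sigma.
Variables (eps Keps : R).
Hypotheses (eps0 : 0 < eps).
Local Notation mu := (@lebesgue_measure R).

(** What Y and all the Y_n have in common. The constants eps and Keps are fixed outside, so every
    estimate derived from this is uniform in n. *)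
Definition subgaussian_process (y : R -> Omega -> R) := [/\ jointly_measurable T y,
  forall w, exists K, forall s, 0 <= s <= T -> `|y s w| <= K &
  forall s, 0 <= s <= T -> (\int[P]_w (expR (eps * y s w ^+ 2))%:E <= Keps%:E)%E].

Local Notation V := (int_square T sigma).
Implicit Types y z : R -> Omega -> R.

Let sigma_gt0 x : 0 < sigma x. Proof. exact: lt_le_trans (sigma_min x). Qed.
Let sigma_ge0 x : 0 <= sigma x. Proof. exact: ltW. Qed.

Let measurable_sigma : measurable_fun setT sigma.
Proof. exact: continuous_measurable_fun. Qed.

Lemma integrable_itv_bounded (F : R -> R) c : measurable_fun `[0, T] F ->
  (forall s, 0 <= s <= T -> `|F s| <= c) -> mu.-integrable `[0, T] (EFin \o F).
Proof.
move=> mF Fc; apply: measurable_bounded_integrable => //.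
  by rewrite /= lebesgue_measure_itv/= lte_fin T0 -EFinB ltry.
exists c; split; first exact: num_real.
by move=> M cM s /=; rewrite in_itv/= => /Fc /le_trans; apply; exact: ltW.
Qed.

Lemma jointly_measurable_comp (phi : R -> R) y : measurable_fun setT phi ->
  jointly_measurable T y -> jointly_measurable T (fun s w => phi (y s w)).
Proof. by move=> mphi my; exact: (measurableT_comp mphi my). Qed.

Let sigma_bounded y w : subgaussian_process y ->
  exists2 c, 0 <= c & forall s, 0 <= s <= T -> 0 <= sigma (y s w) <= c.
Proof.
move=> [_ /(_ w)[K yK] _].
exists (Csigma * (1 + K `^ q)); first by rewrite mulr_ge0 ?(ltW C0) ?addr_ge0 ?powR_ge0.
move=> s sT; rewrite sigma_ge0/=; apply: le_trans (sigma_growth _) _.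
rewrite ler_wpM2l ?(ltW C0)// lerD2l; case/andP: q01 => q0 _.
have K0 : 0 <= K by exact: le_trans (yK s sT).
by rewrite ge0_ler_powR ?nnegrE ?(ltW q0)// yK.
Qed.

Let measurable_sqr : measurable_fun setT (fun x => sigma x ^+ 2).
Proof. exact: measurable_funX. Qed.

Lemma integrable_sqr_volatility y w : subgaussian_process y ->
  mu.-integrable `[0, T] (EFin \o (fun s => sigma (y s w) ^+ 2)).
Proof.
move=> sy; have [c c0 yc] := sigma_bounded w sy; have [my _ _] := sy.
apply: (@integrable_itv_bounded _ (c ^+ 2)).
  exact: (jointly_measurable_path w (jointly_measurable_comp measurable_sqr my)).
move=> s sT; have /andP[h1 h2] := yc s sT.
by rewrite ger0_norm ?sqr_ge0// lerXn2r ?nnegrE.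
Qed.

Lemma int_squareE y w : subgaussian_process y ->
  (\int[mu]_(s in `[0%R, T]) (sigma (y s w) ^+ 2)%:E)%E = (V y w)%:E.
Proof.
move=> sy; rewrite /int_square /Rintegral fineK//.
by apply: integrable_fin_num => //; exact: integrable_sqr_volatility.
Qed.

Lemma measurable_int_square y : subgaussian_process y -> measurable_fun setT (V y).
Proof.
move=> sy; apply/measurable_EFinP.
rewrite (_ : EFin \o _ = fun w => \int[mu]_(s in `[0%R, T]) (sigma (y s w) ^+ 2)%:E)%E; last first.
  by apply/funext => w; rewrite int_squareE.
have [my _ _] := sy.
apply: (measurable_process_integral T0 (jointly_measurable_comp measurable_sqr my)).
by move=> s w _; exact: sqr_ge0.
Qed.

Let integral_cst_itv c : (\int[mu]_(s in `[0%R, T]) c%:E = (c * T)%:E)%E.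
Proof.
by rewrite integral_cst//= lebesgue_measure_itv/= lte_fin T0 -EFinB subr0.
Qed.

Lemma int_square_ge y w : subgaussian_process y -> smin ^+ 2 * T <= V y w.
Proof.
move=> sy; rewrite -lee_fin -int_squareE// -integral_cst_itv.
apply: ge0_le_integral => //.
- by move=> s _; rewrite lee_fin sqr_ge0.
- exact: (measurable_int _ (integrable_sqr_volatility w sy)).
- by move=> s _; rewrite lee_fin lerXn2r ?nnegrE// ltW.
Qed.

Lemma exp_sqr_volatility k : 0 <= k -> exists2 K, 0 <= K &
  forall y s, subgaussian_process y -> 0 <= s <= T ->
  (\int[P]_w (expR (k * sigma (y s w) ^+ 2))%:E <= K%:E)%E.
Proof.
move=> k0; have [c c0 Hc] := sqr_volatility_le C0 q01 sigma_ge0 sigma_growth k0 eps0.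
exists (expR c * `|Keps|); first by rewrite mulr_ge0 ?expR_ge0.
move=> y s [my _ Ey] sT; have mys := jointly_measurable_section sT my.
have mexp : measurable_fun setT (fun w => (expR (eps * y s w ^+ 2))%:E).
  apply/measurable_EFinP; apply: measurableT_comp => //.
  by apply: measurable_funM => //; exact: measurable_funX.
apply: (@le_trans _ _ (\int[P]_w ((expR c)%:E * (expR (eps * y s w ^+ 2))%:E))%E).
  apply: ge0_le_integral => //.
  - apply/measurable_EFinP; apply: measurableT_comp => //.
    by apply: measurable_funM => //; exact: (measurableT_comp measurable_sqr).
  - by apply: emeasurable_funM.
  - by move=> w _; rewrite -EFinM -expRD lee_fin ler_expR.
rewrite ge0_integralZl_EFin ?expR_ge0// EFinM lee_wpmul2l ?lee_fin ?expR_ge0//.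
by apply: le_trans (Ey s sT) _; rewrite lee_fin ler_norm.
Qed.

(* Jensen's inequality, by integrating the tangent of [expR] at the mean value. *)
Let exp_int_square_le k y w : 0 <= k -> subgaussian_process y ->
  ((T * expR (k * V y w))%:E <=
   \int[mu]_(s in `[0%R, T]) (expR (k * T * sigma (y s w) ^+ 2))%:E)%E.
Proof.
move=> k0 sy; have [my _ _] := sy; set v := V y w; set E := expR (k * v).
have Is := integrable_sqr_volatility w sy.
have kT0 : 0 <= E * (k * T) by rewrite mulr_ge0 ?expR_ge0 ?mulr_ge0 ?(ltW T0).
have [c c0 yc] := sigma_bounded w sy.
have mpath : measurable_fun `[0, T] (fun s => sigma (y s w) ^+ 2).
  exact: (jointly_measurable_path w (jointly_measurable_comp measurable_sqr my)).
have Iexp : mu.-integrable `[0, T] (EFin \o (fun s => expR (k * T * sigma (y s w) ^+ 2))).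
  apply: (@integrable_itv_bounded _ (expR (k * T * c ^+ 2))).
    by apply: measurableT_comp => //; exact: measurable_funM.
  move=> s sT; rewrite ger0_norm ?expR_ge0// ler_expR ler_wpM2l ?mulr_ge0 ?(ltW T0)//.
  by have /andP[h1 h2] := yc s sT; rewrite lerXn2r ?nnegrE.
have Icst : mu.-integrable `[0, T] (EFin \o (fun=> E * (1 - k * v) : R)).
  by apply: (@integrable_itv_bounded _ `|E * (1 - k * v)|).
have IZ : mu.-integrable `[0, T] (fun s => (E * (k * T))%:E * (sigma (y s w) ^+ 2)%:E)%E.
  by apply: integrableZl.
have -> : (T * E)%:E = (\int[mu]_(s in `[0%R, T]) ((E * (1 - k * v))%:E +
    (E * (k * T))%:E * (sigma (y s w) ^+ 2)%:E))%E.
  rewrite integralD//= integral_cst_itv integralZl// int_squareE// -/v -EFinM -EFinD.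
  by congr (_%:E); ring.
apply: le_integral => //; first exact: integrableD.
move=> s _; rewrite -EFinM -EFinD lee_fin.
have -> : k * T * sigma (y s w) ^+ 2 = k * v + (k * T * sigma (y s w) ^+ 2 - k * v) by ring.
rewrite expRD -/E.
have := expR_ge1Dx (k * T * sigma (y s w) ^+ 2 - k * v).
have : 0 <= E by exact: expR_ge0.
set X := expR (_ - _) => E0 h.
have -> : E * (1 - k * v) + E * (k * T) * sigma (y s w) ^+ 2 =
  E * (1 + (k * T * sigma (y s w) ^+ 2 - k * v)) by ring.
by rewrite ler_wpM2l.
Qed.

Lemma exp_int_square k : 0 <= k -> exists2 K, 0 <= K &
  forall y, subgaussian_process y -> (\int[P]_w (expR (k * V y w))%:E <= K%:E)%E.
Proof.
move=> k0; have kT0 : 0 <= k * T by rewrite mulr_ge0 ?(ltW T0).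
have [K K0 HK] := exp_sqr_volatility kT0; exists K => // y sy.
have [my _ _] := sy.
have mexp : measurable_fun setT (fun x => expR (k * T * sigma x ^+ 2)).
  by apply: measurableT_comp => //; exact: measurable_funM.
rewrite -(@lee_pmul2l _ T%:E) ?lte_fin//.
rewrite -ge0_integralZl_EFin ?(ltW T0)//; last first.
  apply/measurable_EFinP; apply: measurableT_comp => //; apply: measurable_funM => //.
  exact: measurable_int_square.
have h := integral_process_le (P := P) T0 (jointly_measurable_comp mexp my) _ _.
rewrite -EFinM; apply: le_trans (h K _ _).
- apply: ge0_le_integral => //.
  + by move=> w _; rewrite -EFinM lee_fin mulr_ge0 ?expR_ge0// ltW.
  + apply: emeasurable_funM => //; apply/measurable_EFinP; apply: measurableT_comp => //.
    by apply: measurable_funM => //; exact: measurable_int_square.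
  + apply: (measurable_process_integral T0 (jointly_measurable_comp mexp my)).
    by move=> s w _; exact: expR_ge0.
  + by move=> w _; rewrite -EFinM; exact: exp_int_square_le.
- by move=> s w _; exact: expR_ge0.
- by move=> s sT; exact: HK.
Qed.

Let integralD_le (f g : Omega -> R) (a b : R) : measurable_fun setT f -> measurable_fun setT g ->
  (forall w, 0 <= f w) -> (forall w, 0 <= g w) ->
  (\int[P]_w (f w)%:E <= a%:E)%E -> (\int[P]_w (g w)%:E <= b%:E)%E ->
  (\int[P]_w (f w + g w)%:E <= (a + b)%:E)%E.
Proof.
move=> mf mg f0 g0 fa gb; under eq_integral do rewrite EFinD.
rewrite ge0_integralD//; first by rewrite EFinD; exact: leeD.
- by move=> w _; rewrite lee_fin.
- exact/measurable_EFinP.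
- by move=> w _; rewrite lee_fin.
- exact/measurable_EFinP.
Qed.

Let integralZ_le (f : Omega -> R) (a c : R) : measurable_fun setT f ->
  (forall w, 0 <= f w) -> 0 <= c ->
  (\int[P]_w (f w)%:E <= a%:E)%E -> (\int[P]_w (c * f w)%:E <= (c * a)%:E)%E.
Proof.
move=> mf f0 c0 fa; under eq_integral do rewrite EFinM.
rewrite ge0_integralZl_EFin//; first by rewrite EFinM lee_wpmul2l ?lee_fin.
- by move=> w _; rewrite lee_fin.
- exact/measurable_EFinP.
Qed.

Let powR_le_sqr (a : R) : 0 <= a -> (a `^ r) ^+ 2 <= 1 + a ^+ 2.
Proof.
move=> a0; have /andP[r0 r1] := r01; have p0 : 0 <= a `^ r by exact: powR_ge0.
have [a1|a1] := leP a 1.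
  have : a `^ r <= 1.
    by apply: le_trans (ge0_ler_powR (ltW r0) _ _ a1) _; rewrite ?nnegrE ?powR1.
  by move=> h; have := sqr_ge0 a; nra.
have : a `^ r <= a by rewrite -[leRHS](powRr1 a0) ler_powR// ltW.
by move=> h; nra.
Qed.

(** Write |x - x'| = rho a: the Hoelder bound becomes rho^r a^r, and e b a^r <= e^4 + b^4 + a^(2r)
    separates the weight e, the volatilities b and the normalized distance a. Since r <= 1, a^(2r)
    <= 1 + a^2, so only second moments of the distance are used. *)
Let sqr_difference_le (x x' rho e : R) : 0 < rho -> 0 <= e ->
  e * `|sigma x ^+ 2 - sigma x' ^+ 2| <= Csigma * rho `^ r *
    (e ^+ 4 + 32 * expR (sigma x ^+ 2) + 32 * expR (sigma x' ^+ 2) + 1 + rho ^- 2 * (x - x') ^+ 2).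
Proof.
move=> rho0 e0; rewrite subr_sqr normrM (ger0_norm (_ : 0 <= sigma x + sigma x')) ?addr_ge0//.
set b := sigma x + sigma x'; have b0 : 0 <= b by rewrite addr_ge0.
pose a := `|x - x'| / rho; have a0 : 0 <= a by rewrite divr_ge0// ltW.
have xE : `|x - x'| `^ r = rho `^ r * a `^ r.
  by rewrite -powRM ?(ltW rho0)// /a mulrC divfK// gt_eqF.
have X2 := powR_le_sqr a0; set X := a `^ r in xE X2 *.
have X0 : 0 <= X by exact: powR_ge0.
have aE : a ^+ 2 = rho ^- 2 * (x - x') ^+ 2.
  by rewrite /a exprMn exprVn mulrC real_normK ?num_real.
apply: (@le_trans _ _ (Csigma * rho `^ r * (e * b * X))).
  have -> : Csigma * rho `^ r * (e * b * X) = e * (Csigma * `|x - x'| `^ r * b).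
    by rewrite xE; ring.
  by rewrite ler_wpM2l// ler_wpM2r.
rewrite ler_wpM2l ?mulr_ge0 ?(ltW C0) ?powR_ge0// -aE.
have q4 (u : R) : (u ^+ 2) ^+ 2 <= 4 * expR (u ^+ 2).
  have := sqr_le_expR_norm (u ^+ 2).
  by rewrite ger0_norm ?sqr_ge0.
(* b^4 <= 8 (sigma(x)^4 + sigma(x')^4), and each fourth power is at most 4 times the exponential of
   the square: 32 in all. *)
have b4 : (b ^+ 2) ^+ 2 <= 32 * expR (sigma x ^+ 2) + 32 * expR (sigma x' ^+ 2).
  have h1 := q4 (sigma x); have h2 := q4 (sigma x').
  have h3 : b ^+ 2 <= 2 * (sigma x ^+ 2 + sigma x' ^+ 2).
    by rewrite /b; have := sqr_ge0 (sigma x - sigma x'); nra.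
  have h4 : (b ^+ 2) ^+ 2 <= (2 * (sigma x ^+ 2 + sigma x' ^+ 2)) ^+ 2.
    by rewrite lerXn2r// ?nnegrE ?sqr_ge0// mulr_ge0// addr_ge0 ?sqr_ge0.
  have := sqr_ge0 (sigma x ^+ 2 - sigma x' ^+ 2).
  by move: h1 h2 h4; nra.
have abx : e * b * X <= (e ^+ 2) ^+ 2 + (b ^+ 2) ^+ 2 + X ^+ 2.
  have := sqr_ge0 (e * b - X); have := sqr_ge0 (e ^+ 2 - b ^+ 2).
  have := sqr_ge0 (e ^+ 2); have := sqr_ge0 (b ^+ 2); have := sqr_ge0 X.
  by rewrite [in X in _ -> _ -> _ -> _ -> X]sqrrB exprMn; nra.
have -> : e ^+ 4 = (e ^+ 2) ^+ 2 by rewrite -exprM.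
lra.
Qed.

(** The scale rho is free and will be n^(-H). By hypothesis (y - z) / rho has second moments bounded
    by D, so the whole rate is carried by the prefactor rho^r. The exponential weight is the one
    left by [lognormal_mean_lip]. *)
Lemma weighted_variance_difference k D : 0 <= k -> exists2 K, 0 <= K &
  forall y z rho, subgaussian_process y -> subgaussian_process z -> 0 < rho ->
  (forall s, 0 <= s <= T -> (\int[P]_w ((y s w - z s w) ^+ 2)%:E <= (D * rho ^+ 2)%:E)%E) ->
  (\int[P]_w (expR (k * (V y w + V z w)) * `|V y w - V z w|)%:E <= (K * rho `^ r)%:E)%E.
Proof.
(* The fourth power of the weight is the product of exp (4 k V y) and exp (4 k V z), bounded by the
   sum of their squares; hence 8 k. *)
move=> k0; have k8 : 0 <= 8 * k by rewrite mulr_ge0.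
have [K8 K80 HK8] := exp_int_square k8.
have [K1 K10 HK1] := exp_sqr_volatility ler01.
have T00 := ltW T0; have C00 := ltW C0.
exists (Csigma * (T * (K8 + K8 + 32 * K1 + 32 * K1 + 1 + `|D|))).
  by rewrite !mulr_ge0// !addr_ge0// mulr_ge0.
move=> y z rho sy sz rho0 yz.
have [my _ _] := sy; have [mz _ _] := sz.
have mVy := measurable_int_square sy; have mVz := measurable_int_square sz.
have rho2 : 0 <= rho ^- 2 by rewrite invr_ge0 exprn_ge0// ltW.
have mexp c (X : Omega -> R) : measurable_fun setT X -> measurable_fun setT (fun w => expR (c * X w)).
  by move=> mX; apply: measurableT_comp => //; exact: measurable_funM.
have mexps : measurable_fun setT (fun x => expR (sigma x ^+ 2)).
  by apply: measurableT_comp.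
(* The terms in V are constant in s. They are kept under the time integral so that a bound on the
   mean of J at each time is enough. *)
pose J s w := expR (8 * k * V y w) + expR (8 * k * V z w) + 32 * expR (sigma (y s w) ^+ 2) +
  32 * expR (sigma (z s w) ^+ 2) + 1 + rho ^- 2 * (y s w - z s w) ^+ 2.
have J0 s w : 0 <= s <= T -> 0 <= J s w.
  move=> _; have h : 0 <= rho ^- 2 * (y s w - z s w) ^+ 2.
    by apply: mulr_ge0 => //; exact: sqr_ge0.
  by apply: addr_ge0 => //; rewrite !addr_ge0 ?expR_ge0// mulr_ge0 ?expR_ge0.
have mJ : jointly_measurable T J.
  have m2 (X : Omega -> R) : measurable_fun setT X -> measurable_fun setT (fun p : R * Omega => X p.2).
    by move=> mX; exact: (measurableT_comp mX measurable_snd).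
  apply: measurable_funD; last first.
    by apply: measurable_funM => //; apply: measurable_funX; exact: measurable_funB.
  apply: measurable_funD => //; apply: measurable_funD; last first.
    by apply: measurable_funM => //; exact: (jointly_measurable_comp mexps mz).
  apply: measurable_funD; last first.
    by apply: measurable_funM => //; exact: (jointly_measurable_comp mexps my).
  by apply: measurable_funD; [exact: (m2 _ (mexp _ _ mVy))|exact: (m2 _ (mexp _ _ mVz))].
have EJ s : 0 <= s <= T -> (\int[P]_w (J s w)%:E <=
    (K8 + K8 + 32 * K1 + 32 * K1 + 1 + `|D|)%:E)%E.
  move=> sT; have mys := jointly_measurable_section sT my; have mzs := jointly_measurable_section sT mz.
  have m1 := mexp (8 * k) _ mVy; have m2 := mexp (8 * k) _ mVz.
  have m3 : measurable_fun setT (fun w => expR (sigma (y s w) ^+ 2)) := measurableT_comp mexps mys.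
  have m4 : measurable_fun setT (fun w => expR (sigma (z s w) ^+ 2)) := measurableT_comp mexps mzs.
  have m5 : measurable_fun setT (fun w => (y s w - z s w) ^+ 2).
    by apply: measurable_funX; exact: measurable_funB.
  have m3' : measurable_fun setT (fun w => 32 * expR (sigma (y s w) ^+ 2)) by exact: measurable_funM.
  have m4' : measurable_fun setT (fun w => 32 * expR (sigma (z s w) ^+ 2)) by exact: measurable_funM.
  have m5' : measurable_fun setT (fun w => rho ^- 2 * (y s w - z s w) ^+ 2) by exact: measurable_funM.
  have e0 x : 0 <= expR x :> R by exact: expR_ge0.
  have e32 x : 0 <= 32 * expR x :> R by rewrite mulr_ge0.
  have h3 : (\int[P]_w (32 * expR (sigma (y s w) ^+ 2))%:E <= (32 * K1)%:E)%E.
    apply: integralZ_le => //; have := HK1 y s sy sT.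
    by under eq_integral do rewrite mul1r.
  have h4 : (\int[P]_w (32 * expR (sigma (z s w) ^+ 2))%:E <= (32 * K1)%:E)%E.
    apply: integralZ_le => //; have := HK1 z s sz sT.
    by under eq_integral do rewrite mul1r.
  have h5 : (\int[P]_w (rho ^- 2 * (y s w - z s w) ^+ 2)%:E <= `|D|%:E)%E.
    apply: (@le_trans _ _ (rho ^- 2 * (D * rho ^+ 2))%:E).
      by apply: integralZ_le => // [w|]; [exact: sqr_ge0|exact: yz].
    rewrite lee_fin mulrCA mulVf ?mulr1 ?ler_norm//.
    by rewrite expf_neq0// gt_eqF.
  have h1c : (\int[P]_w (1 : R)%:E <= 1%:E)%E.
    by rewrite (integral_cst P measurableT 1%E) mul1e; exact: probability_le1.
  have m12 := measurable_funD m1 m2; have m123 := measurable_funD m12 m3'.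
  have m1234 := measurable_funD m123 m4'.
  have m12341 := measurable_funD m1234 (measurable_cst (1 : R)).
  apply: integralD_le => //.
    by move=> w; apply: mulr_ge0 => //; exact: sqr_ge0.
  apply: integralD_le => //.
  apply: integralD_le => //.
  apply: integralD_le => //.
  by apply: integralD_le => //; [exact: HK8|exact: HK8].
have Crho : 0 <= Csigma * rho `^ r by rewrite mulr_ge0 ?powR_ge0.
have mIJ := measurable_process_integral T0 mJ J0.
apply: (@le_trans _ _ (\int[P]_w ((Csigma * rho `^ r)%:E * \int[mu]_(s in `[0%R, T]) (J s w)%:E))%E).
  apply: ge0_le_integral => //.
  - apply/measurable_EFinP; apply: measurable_funM.
      by apply: mexp; exact: measurable_funD.
    by apply: measurableT_comp => //; exact: measurable_funB.
  - exact: emeasurable_funM.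
  move=> w _; rewrite EFinM; set e := expR _.
  have e0 : 0 <= e by exact: expR_ge0.
  have Iy := integrable_sqr_volatility w sy; have Iz := integrable_sqr_volatility w sz.
  have mD : measurable_fun `[0, T] (fun s => `|sigma (y s w) ^+ 2 - sigma (z s w) ^+ 2|).
    apply: measurableT_comp => //; apply: measurable_funB.
      by apply/measurable_EFinP; exact: (measurable_int _ Iy).
    by apply/measurable_EFinP; exact: (measurable_int _ Iz).
  have h : (`|V y w - V z w|%:E <= \int[mu]_(s in `[0%R, T]) `|sigma (y s w) ^+ 2 - sigma (z s w) ^+ 2|%:E)%E.
    rewrite -abse_EFin EFinB -!int_squareE// -integralB//.
    by apply: le_abse_integral => //; exact: (measurable_int _ (integrableB _ Iy Iz)).
  apply: (@le_trans _ _ (e%:E * \int[mu]_(s in `[0%R, T]) `|sigma (y s w) ^+ 2 - sigma (z s w) ^+ 2|%:E)%E).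
    by rewrite lee_wpmul2l ?lee_fin.
  have mJw : measurable_fun `[0, T] (fun s => (J s w)%:E).
    by apply/measurable_EFinP; exact: jointly_measurable_path.
  rewrite -ge0_integralZl_EFin//; last exact/measurable_EFinP.
  rewrite -ge0_integralZl_EFin//; last by move=> s /=; rewrite in_itv/= lee_fin; exact: J0.
  apply: ge0_le_integral => //.
  - by move=> s _; rewrite mule_ge0 ?lee_fin.
  - by apply: emeasurable_funM => //; exact/measurable_EFinP.
  - exact: emeasurable_funM.
  move=> s _; rewrite -!EFinM lee_fin.
  apply: le_trans (sqr_difference_le _ _ rho0 e0) _.
  rewrite ler_wpM2l// /J lerD2r lerD2r lerD2r lerD2r.
  have -> : e ^+ 4 = expR (4 * k * V y w) * expR (4 * k * V z w).
    by rewrite /e -expRM_natl -expRD; congr expR; ring.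
  have E8 x : expR (8 * k * x) = expR (4 * k * x) ^+ 2.
    by rewrite -expRM_natl; congr expR; ring.
  rewrite !E8; have := sqr_ge0 (expR (4 * k * V y w) - expR (4 * k * V z w)).
  have := expR_ge0 (4 * k * V y w); have := expR_ge0 (4 * k * V z w); nra.
rewrite ge0_integralZl_EFin//; last first.
  by move=> w _; apply: integral_ge0 => s /=; rewrite in_itv/= lee_fin; exact: J0.
have -> : Csigma * (T * (K8 + K8 + 32 * K1 + 32 * K1 + 1 + `|D|)) * rho `^ r =
  Csigma * rho `^ r * (T * (K8 + K8 + 32 * K1 + 32 * K1 + 1 + `|D|)) by ring.
rewrite [leRHS]EFinM lee_wpmul2l ?lee_fin//.
exact: integral_process_le.
Qed.

End integrated_variance.

(** * Sigma-algebras generated by processes, and independence of a join *)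

Section past.
Context {R : realType} {d : measure_display} {Omega : measurableType d}.
Variable P : probability Omega R.

Lemma sub_sigma_process (X : R -> Omega -> R) D E : D `<=` E ->
  sigma_process X D `<=` sigma_process X E.
Proof. by move=> DE; apply: sub_smallest2r; [exact: smallest_sigma_algebra|exact: bigcup_subset]. Qed.

Lemma measurable_sigma_process (X : R -> Omega -> R) D :
  (forall t, measurable_fun setT (X t)) -> sigma_process X D `<=` measurable.
Proof.
move=> mX; apply: smallest_sub; first exact: sigma_algebra_measurable.
by move=> A [t Dt [B mB <-]]; exact: mX.
Qed.

Lemma sigma_process_preimage (X : R -> Omega -> R) D (V : Omega -> R) A :
  measurable_fun setT (V : g_sigma_algebraType (\bigcup_(t in D) sigma_rv (X t)) -> R) ->
  measurable A -> sigma_process X D (V @^-1` A).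
Proof. by move=> mV mA; rewrite -[_ @^-1` _]setTI; exact: mV. Qed.

Lemma measurable_sigma_process_val (X : R -> Omega -> R) D t : D t ->
  measurable_fun setT (X t : g_sigma_algebraType (\bigcup_(t in D) sigma_rv (X t)) -> R).
Proof.
by move=> Dt _ A mA; apply: sub_sigma_algebra; exists t => //; exists A.
Qed.

Lemma sigma_processI (X : R -> Omega -> R) D : setI_closed (sigma_process X D).
Proof.
move=> A B XA XB.
exact: (@measurableI _ (g_sigma_algebraType (\bigcup_(t in D) sigma_rv (X t)))).
Qed.

Lemma sigma_processT (X : R -> Omega -> R) D : sigma_process X D setT.
Proof. exact: (@measurableT _ (g_sigma_algebraType (\bigcup_(t in D) sigma_rv (X t)))). Qed.

(** Intersections of a set of F1 and a set of F2 form a pi-system generating the join. On it the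
    finite measures P(A & D) and P(A) P(D) of A agree, hence they agree on the join. *)
Lemma independent_join (F1 F2 : set (set Omega)) (D : set Omega) :
  F1 `<=` measurable -> F2 `<=` measurable -> F1 setT -> F2 setT ->
  setI_closed F1 -> setI_closed F2 -> measurable D ->
  (forall A1 A2, F1 A1 -> F2 A2 -> P (A1 `&` A2 `&` D) = P (A1 `&` A2) * P D)%E ->
  forall A, <<s F1 `|` F2 >> A -> (P (A `&` D) = P A * P D)%E.
Proof.
move=> mF1 mF2 F1T F2T IF1 IF2 mD PD A F12A.
pose G := [set E | exists A1 A2, [/\ F1 A1, F2 A2 & E = A1 `&` A2]].
have PDfin : P D \is a fin_num by exact: fin_num_measure.
pose c : {nonneg R} := NngNum (fine_ge0 (measure_ge0 P D)).
have PDE : P D = (c%:num)%:E by rewrite fineK.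
have subG : <<s F1 `|` F2 >> `<=` <<s G >>.
  apply: sub_smallest2r; [exact: smallest_sigma_algebra|move=> E [E1|E2]].
    by exists E, setT; rewrite setIT.
  by exists setT, E; rewrite setTI.
rewrite -[LHS]/(mrestr P mD A) [RHS]muleC PDE -[RHS]/(mscale c P A).
have mG : G `<=` measurable.
  by move=> E [A1 [A2 [/mF1 mA1 /mF2 mA2 ->]]]; exact: measurableI.
refine (@g_sigma_algebra_measure_unique _ R _ G mG (fun=> setT) _ _
  (mrestr P mD) (mscale c P) _ _ _ A _) => //.
- by exists setT, setT; rewrite setIT.
- by rewrite bigcup_const.
- move=> _ _ [A1 [A2 [F1A F2A ->]]] [B1 [B2 [F1B F2B ->]]].
  exists (A1 `&` B1), (A2 `&` B2); split; [exact: IF1|exact: IF2|].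
  by rewrite setIACA.
- move=> E [A1 [A2 [F1A F2A ->]]].
  rewrite -[LHS]/(P (A1 `&` A2 `&` D)) -[RHS]/((c%:num)%:E * P (A1 `&` A2))%E.
  by rewrite PD// muleC PDE.
- move=> _; apply: (@le_lt_trans _ _ (P D)); last by rewrite PDE ltry.
  by rewrite -[leLHS]/(P (setT `&` D)) setTI.
- exact: subG.
Qed.

End past.

(** * Increments of W given the past of W and the whole of B *)

Section wiener.
Context {R : realType} {d : measure_display} {Omega : measurableType d}.
Variables (P : probability Omega R) (T : R) (W B : R -> {RV P >-> R}).
Hypothesis wienerW : standard_wiener T W.
Hypothesis WB_indep : independent_systems P (sigma_process W `[0, T])
                                            (sigma_process B `[0, T]).

(* The whole of B is adjoined at every time, since it is independent of W. *)
Definition past (s : R) := sigma_process W `[0, s] `|` sigma_process B `[0, T].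

Definition past_measurable s (X : Omega -> R) :=
  measurable_fun setT (X : g_sigma_algebraType (past s) -> R).

Lemma sub_past s : <<s past s >> `<=` measurable.
Proof.
apply: smallest_sub; first exact: sigma_algebra_measurable.
by move=> A [] /measurable_sigma_process; apply => t; exact: measurable_funPT.
Qed.

Lemma past_mono s t : s <= t -> <<s past s >> `<=` <<s past t >>.
Proof.
move=> st; apply: sub_smallest2r; first exact: smallest_sigma_algebra.
apply: setSU; apply: sub_sigma_process => u /=; rewrite !in_itv/= => /andP[-> us].
exact: le_trans st.
Qed.

Lemma past_measurable_mono s t X : s <= t ->
  past_measurable s X -> past_measurable t X.
Proof. by move=> st mX mD A mA; apply: (past_mono st); exact: mX. Qed.

Lemma past_measurableW s X : past_measurable s X -> measurable_fun setT X.
Proof. exact: (measurable_fun_sub_sigma (@sub_past s)). Qed.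

Lemma past_measurable_sub s (F : set (set Omega)) (X : Omega -> R) :
  F `<=` <<s past s >> -> sigma_rv X `<=` F -> past_measurable s X.
Proof. by move=> FP XF _ A mA; apply: FP; apply: XF; exists A. Qed.

Lemma past_measurable_wiener s u : 0 <= u <= s -> past_measurable s (W u).
Proof.
move=> us _ A mA; apply: sub_sigma_algebra; left.
by apply: sub_sigma_algebra; exists u; [rewrite /= in_itv|exists A].
Qed.

Lemma past_measurable_noise s u : 0 <= u <= T -> past_measurable s (B u).
Proof.
move=> us _ A mA; apply: sub_sigma_algebra; right.
by apply: sub_sigma_algebra; exists u; [rewrite /= in_itv|exists A].
Qed.

(** On an intersection of an event of the past of W and an event of B, independence of W and B first
    splits off the event of B; then the increment is split from the past of W; finally the two past
    events are recombined. *)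
Lemma wiener_independent_past s t A (U : set R) : 0 <= s -> s < t -> t <= T ->
  <<s past s >> A -> measurable U ->
  (P (A `&` (fun w => W t w - W s w)%R @^-1` U) =
   P A * P ((fun w => W t w - W s w)%R @^-1` U))%E.
Proof.
move=> s0 st tT pA mU; have [_ _ W_indep _] := wienerW.
have mW u := @measurable_funPT _ _ _ _ (W u).
have mB u := @measurable_funPT _ _ _ _ (B u).
have t0 : 0 <= t by rewrite (le_trans s0)// ltW.
have sT : s <= T by rewrite (le_trans _ tT)// ltW.
have sub_sT : sigma_process W `[0, s] `<=` sigma_process W `[0, T].
  apply: sub_sigma_process => u /=; rewrite !in_itv/= => /andP[-> us].
  exact: le_trans sT.
have WU : sigma_process W `[0, T] ((fun w => W t w - W s w) @^-1` U).
  apply: sigma_process_preimage => //; apply: measurable_funB.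
    by apply: measurable_sigma_process_val; rewrite /= in_itv/= t0.
  by apply: measurable_sigma_process_val; rewrite /= in_itv/= s0.
apply: (independent_join (F1 := sigma_process W `[0, s])
    (F2 := sigma_process B `[0, T])) pA => //.
- exact: measurable_sigma_process.
- exact: measurable_sigma_process.
- exact: sigma_processT.
- exact: sigma_processT.
- exact: sigma_processI.
- exact: sigma_processI.
- exact: (measurable_sigma_process mW WU).
- move=> A1 A2 WA1 BA2; rewrite setIAC WB_indep//; last first.
    by apply: sigma_processI => //; exact: sub_sT.
  rewrite (W_indep _ _ s0 st tT)//; last by exists U => //; rewrite setTI.
  rewrite WB_indep//; last exact: sub_sT.
  by rewrite muleAC.
Qed.

Lemma wiener_freezing s t (K : g_sigma_algebraType (past s) * R -> \bar R) :
  0 <= s -> s < t -> t <= T -> measurable_fun setT K -> (forall x, 0 <= K x)%E ->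
  (\int[P]_w K (w, W t w - W s w)%R =
   \int[P]_w \int[normal_prob 0 (Num.sqrt (t - s))]_y K (w, y))%E.
Proof.
move=> s0 st tT mK K0; have [_ W_law _ _] := wienerW.
have [_] := W_law _ _ s0 st tT; rewrite gt_eqF ?subr_gt0// => law.
have mD : measurable_fun setT (fun w => W t w - W s w).
  by apply: measurable_funB; exact: measurable_funPT.
have indep A U : <<s past s >> A -> measurable U ->
    (P (A `&` (fun w => W t w - W s w)%R @^-1` U) =
     P A * P ((fun w => W t w - W s w)%R @^-1` U))%E.
  by move=> pA mU; exact: wiener_independent_past.
exact: (@integral_freezing _ _ _ P (past s) (@sub_past s) _ _
  (normal_prob 0 (Num.sqrt (t - s))) _ mD law indep K mK K0).
Qed.

Lemma integral_wiener_increment s t X (phi : R * R -> \bar R) :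
  0 <= s -> s < t -> t <= T -> past_measurable s X ->
  measurable_fun setT phi -> (forall x, 0 <= phi x)%E ->
  (\int[P]_w phi (X w, W t w - W s w)%R =
   \int[P]_w \int[normal_prob 0 (Num.sqrt (t - s))]_y phi (X w, y))%E.
Proof.
move=> s0 st tT mX mphi phi0.
pose K (x : g_sigma_algebraType (past s) * R) := phi (X x.1, x.2).
suff mK : measurable_fun setT K.
  exact: (wiener_freezing s0 st tT mK (fun x => phi0 (X x.1, x.2))).
apply: (measurableT_comp mphi); apply/measurable_fun_pairP; split.
  exact: (measurableT_comp mX).
exact: measurable_snd.
Qed.

Lemma integral_EFinE d' (T' : measurableType d') (mu : {measure set T' -> \bar R})
    (X : T' -> R) :
  (\int[mu]_w (X w)%:E = \int[mu]_w (Num.max (X w) 0)%:E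
                        - \int[mu]_w (Num.max (- X w) 0)%:E)%E.
Proof.
rewrite integralE; congr (_ - _)%E; apply: eq_integral => w _.
  by rewrite funepos.unlock/= EFin_max.
by rewrite funeneg.unlock/= EFin_max.
Qed.

Section increment.
Variables (s t : R).
Hypotheses (s0 : 0 <= s) (st : s < t) (tT : t <= T).

Let sd := Num.sqrt (t - s).

Let sd0 : 0 < sd. Proof. by rewrite sqrtr_gt0 subr_gt0. Qed.

Let integral_normal_sqr : (\int[normal_prob 0 sd]_y (y ^+ 2)%:E = (t - s)%:E)%E.
Proof.
by rewrite normal_prob_sqr// expr0n add0r sqr_sqrtr// subr_ge0 ltW.
Qed.

Lemma ge0_integral_mul_increment_sqr X : past_measurable s X ->
  (forall w, 0 <= X w) ->
  (\int[P]_w (X w * (W t w - W s w) ^+ 2)%:E = (t - s)%:E * \int[P]_w (X w)%:E)%E.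
Proof.
move=> mX X0; pose phi (x : R * R) : \bar R := (`|x.1| * x.2 ^+ 2)%:E.
transitivity (\int[P]_w phi (X w, (W t w - W s w)%R))%E.
  by apply: eq_integral => w _; rewrite /phi/= ger0_norm.
rewrite (integral_wiener_increment s0 st tT mX)//; last 2 first.
- apply/measurable_EFinP; apply: measurable_funM.
    by apply: measurableT_comp => //; exact: measurable_fst.
  by apply: measurable_funX; exact: measurable_snd.
- by move=> x; rewrite lee_fin mulr_ge0 ?sqr_ge0.
rewrite -ge0_integralZl//; first last.
- by rewrite lee_fin subr_ge0 ltW.
- by move=> w _; rewrite lee_fin.
- by apply/measurable_EFinP; exact: past_measurableW mX.
apply: eq_integral => w _; rewrite /phi/=.
under eq_integral do rewrite EFinM.
rewrite ge0_integralZl//; last 2 first.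
- by apply/measurable_EFinP; exact: measurable_funX.
- by move=> y _; rewrite lee_fin sqr_ge0.
by rewrite integral_normal_sqr ger0_norm// muleC.
Qed.

Lemma integral_mul_increment_sqr X : past_measurable s X ->
  P.-integrable setT (EFin \o X) ->
  (\int[P]_w (X w * (W t w - W s w) ^+ 2)%:E = (t - s)%:E * \int[P]_w (X w)%:E)%E.
Proof.
move=> mX IX.
have maxM (a b : R) : 0 <= b -> Num.max (a * b) 0 = Num.max a 0 * b.
  by move=> b0; rewrite maxr_pMl// mul0r.
have E : (t - s)%:E \is a fin_num by [].
rewrite integral_EFinE [in RHS]integral_EFinE muleBr//; last first.
  have := integrable_add_def measurableT IX; congr (_ +? - _)%E.
    by apply: eq_integral => w _; rewrite funepos.unlock/= EFin_max.
  by apply: eq_integral => w _; rewrite funeneg.unlock/= EFin_max.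
congr (_ - _)%E.
  rewrite -ge0_integral_mul_increment_sqr//; last 2 first.
  - by apply: measurable_maxr.
  - by move=> w; rewrite le_max lexx orbT.
  by apply: eq_integral => w _; rewrite maxM// sqr_ge0.
rewrite -ge0_integral_mul_increment_sqr//; last 2 first.
- by apply: measurable_maxr => //; exact: measurable_funN.
- by move=> w; rewrite le_max lexx orbT.
by apply: eq_integral => w _; rewrite -mulNr maxM// sqr_ge0.
Qed.

(** Freezing is available for nonnegative integrands, so the positive and the negative part of the
    product are treated apart. Once the increment is integrated out they coincide, because a
    centered Gaussian gives x y equal positive and negative means for each x. *)
Lemma integral_mul_increment X : past_measurable s X ->
  P.-integrable setT (EFin \o (fun w => X w * (W t w - W s w))) ->
  (\int[P]_w (X w * (W t w - W s w))%:E = 0)%E.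
Proof.
move=> mX IXD; pose phi e (x : R * R) : \bar R := (Num.max (e * (x.1 * x.2)) 0)%:E.
have mphi e : measurable_fun setT (phi e).
  apply/measurable_EFinP; apply: measurable_maxr => //.
  apply: measurable_funM => //.
  by apply: measurable_funM; [exact: measurable_fst|exact: measurable_snd].
have phi0 e x : (0 <= phi e x)%E by rewrite lee_fin le_max lexx orbT.
have xE (x : R) : (\int[normal_prob 0 sd]_y phi 1%R (x, y) =
             \int[normal_prob 0 sd]_y phi (-1)%R (x, y))%E.
  have I : (normal_prob 0 sd).-integrable setT (EFin \o (fun y => x * y)).
    have := integrable_normal_center 0 sd0.
    move=> /(integrableZl measurableT x); apply: eq_integrable => // y _.
    by rewrite /= subr0 EFinM.
  have [Ip In] := (integrable_pos_fin_num measurableT I,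
                   integrable_neg_fin_num measurableT I).
  have : (\int[normal_prob 0 sd]_y (x * y)%:E = 0)%E.
    transitivity (x%:E * \int[normal_prob 0 sd]_y (y - 0)%:E)%E.
      rewrite -integralZl//; last exact: integrable_normal_center.
      by apply: eq_integral => y _; rewrite subr0.
    by rewrite normal_prob_mean// mule0.
  rewrite integralE => /eqP; rewrite sube_eq ?add0e//.
  move=> /eqP E; transitivity (\int[normal_prob 0 sd]_y
      (EFin \o (fun y => (x * y)%R))^\+%E y)%E.
    by apply: eq_integral => y _; rewrite funepos.unlock/= /phi/= mul1r EFin_max.
  rewrite E; apply: eq_integral => y _.
  by rewrite funeneg.unlock/= /phi/= mulN1r EFin_max.
have [Ip In] := (integrable_pos_fin_num measurableT IXD,
                 integrable_neg_fin_num measurableT IXD).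
rewrite integral_EFinE.
transitivity (\int[P]_w phi 1%R (X w, (W t w - W s w)%R) - \int[P]_w phi (-1)%R (X w, (W t w - W s w)%R))%E.
  by congr (_ - _)%E; apply: eq_integral => w _; rewrite /phi/= ?mul1r ?mulN1r.
rewrite !(integral_wiener_increment s0 st tT mX)//.
under eq_integral do rewrite xE.
rewrite -(integral_wiener_increment s0 st tT mX)// subee//.
rewrite (eq_integral (EFin \o (fun w => X w * (W t w - W s w))%R)^\-%E)// => w _.
by rewrite funeneg.unlock/= /phi/= mulN1r EFin_max.
Qed.

End increment.

End wiener.

(** * Orthogonality of increments and the isometry for pairs of steps *)

Section wiener_isometry.
Context {R : realType} {d : measure_display} {Omega : measurableType d}.
Variables (P : probability Omega R) (T : R) (W B : R -> {RV P >-> R}).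
Hypothesis wienerW : standard_wiener T W.
Hypothesis WB_indep : independent_systems P (sigma_process W `[0, T])
                                            (sigma_process B `[0, T]).

Let mW u : measurable_fun setT (W u) := @measurable_funPT _ _ _ _ (W u).
Let mD s t : measurable_fun setT (fun w => W t w - W s w).
Proof. exact: measurable_funB. Qed.

Definition past_sqr s (X : Omega -> R) :=
  past_measurable T W B s X /\ (\int[P]_w (X w ^+ 2)%:E < +oo)%E.

Lemma past_sqr_mono s t X : s <= t -> past_sqr s X -> past_sqr t X.
Proof. by move=> st [mX X2]; split => //; exact: past_measurable_mono mX. Qed.

Lemma past_sqr_integrable s t X Y : past_sqr s X -> past_sqr t Y ->
  P.-integrable setT (EFin \o (fun w => X w * Y w)).
Proof.
by move=> [/past_measurableW mX X2] [/past_measurableW mY Y2]; exact: integrable_mul_sqr.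
Qed.

Lemma past_sqr_increment s t X : 0 <= s -> s <= t -> t <= T -> past_sqr s X ->
  past_sqr t (fun w => X w * (W t w - W s w)).
Proof.
move=> s0 st tT [mX X2]; split.
  apply: measurable_funM; first exact: past_measurable_mono mX.
  by apply: measurable_funB; apply: past_measurable_wiener; rewrite ?s0 ?lexx ?(le_trans s0).
have [{}st|ts|->] := ltgtP s t.
- under eq_integral do rewrite exprMn.
  rewrite (ge0_integral_mul_increment_sqr wienerW WB_indep s0 st tT)//.
  + by rewrite lte_mul_pinfty// ?lee_fin ?subr_ge0 ?(ltW st).
  + exact: measurable_funX.
  + by move=> w; exact: sqr_ge0.
- by rewrite ltNge st in ts.
- under eq_integral do rewrite subrr mulr0 expr0n/=.
  by rewrite integral0 ltry.
Qed.

Lemma past_sqr_orthogonal s t Z X : 0 <= s -> s <= t -> t <= T ->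
  past_sqr s Z -> past_sqr s X ->
  (\int[P]_w (Z w * (X w * (W t w - W s w)))%:E = 0)%E.
Proof.
move=> s0 st tT Z2 X2; have [{}st|ts|->] := ltgtP s t.
- have I := past_sqr_integrable Z2 (past_sqr_increment s0 (ltW st) tT X2).
  under eq_integral do rewrite mulrA.
  rewrite (integral_mul_increment wienerW WB_indep s0 st tT)//.
    by apply: measurable_funM; [exact: Z2.1|exact: X2.1].
  by apply: eq_integrable I => // w _; rewrite /= mulrA.
- by rewrite ltNge st in ts.
- by under eq_integral do rewrite subrr !mulr0; rewrite integral0.
Qed.

Lemma past_sqr_isometry s t X Y : 0 <= s -> s <= t -> t <= T ->
  past_sqr s X -> past_sqr s Y ->
  (\int[P]_w (X w * (W t w - W s w) * (Y w * (W t w - W s w)))%:E =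
   (t - s)%:E * \int[P]_w (X w * Y w)%:E)%E.
Proof.
move=> s0 st tT X2 Y2; have [{}st|ts|->] := ltgtP s t.
- rewrite -(integral_mul_increment_sqr wienerW WB_indep s0 st tT).
  + by apply: eq_integral => w _; congr EFin; ring.
  + by apply: measurable_funM; [exact: X2.1|exact: Y2.1].
  + exact: past_sqr_integrable X2 Y2.
- by rewrite ltNge st in ts.
- under eq_integral do rewrite subrr !mulr0.
  by rewrite integral0 subrr mul0e.
Qed.

(** For s <= u the two intervals are cut at u and at the smaller right end. The piece before u and
    the piece after the common part give orthogonal contributions, and only the overlap remains. *)
Let pair_le s t u v X Y : 0 <= s -> s <= t -> t <= T -> s <= u -> u <= v -> v <= T ->
  past_sqr s X -> past_sqr u Y ->
  (\int[P]_w (X w * (W t w - W s w) * (Y w * (W v w - W u w)))%:E =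
   (Num.max 0 (Num.min t v - u))%:E * \int[P]_w (X w * Y w)%:E)%E.
Proof.
move=> s0 st tT su uv vT X2 Y2; have u0 := le_trans s0 su.
have [tu|ut] := leP t u.
  rewrite max_l; last by rewrite subr_le0 ge_min tu.
  rewrite mul0e past_sqr_orthogonal//.
  by apply: past_sqr_mono tu _; exact: past_sqr_increment.
have v0 := le_trans u0 uv; have uT := le_trans uv vT.
have t0 := le_trans s0 st.
have X2u := past_sqr_mono su X2.
have A2 := past_sqr_increment s0 su uT X2.
have B2 := past_sqr_increment u0 uv vT Y2.
have AB0 := past_sqr_orthogonal u0 uv vT A2 Y2.
have IAB := past_sqr_integrable A2 B2.
have [tv|vt] := leP t v.
- have D2 := past_sqr_increment u0 (ltW ut) tT X2u.
  have E2 := past_sqr_increment u0 (ltW ut) tT Y2.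
  have Y2t := past_sqr_mono (ltW ut) Y2.
  have F2 := past_sqr_increment t0 tv vT Y2t.
  have DF0 := past_sqr_orthogonal t0 tv vT D2 Y2t.
  rewrite max_r ?subr_ge0 ?(ltW ut)// -past_sqr_isometry// ?(ltW ut)//.
  transitivity (\int[P]_w ((X w * (W u w - W s w) * (Y w * (W v w - W u w)))%:E
     + ((X w * (W t w - W u w) * (Y w * (W t w - W u w)))%:E
     + (X w * (W t w - W u w) * (Y w * (W v w - W t w)))%:E)))%E.
    by apply: eq_integral => w _; rewrite -!EFinD; congr EFin; ring.
  rewrite integralD//; last first.
    by apply: integrableD => //; [exact: past_sqr_integrable D2 E2|
      exact: past_sqr_integrable D2 F2].
  rewrite integralD//; [|exact: past_sqr_integrable D2 E2|exact: past_sqr_integrable D2 F2].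
  by rewrite AB0 DF0 adde0 add0e.
- have D2 := past_sqr_increment u0 uv vT X2u.
  have X2v := past_sqr_mono uv X2u.
  have F2 := past_sqr_increment v0 (ltW vt) tT X2v.
  have FB0 := past_sqr_orthogonal v0 (ltW vt) tT B2 X2v.
  rewrite max_r ?subr_ge0// -past_sqr_isometry//.
  transitivity (\int[P]_w ((X w * (W u w - W s w) * (Y w * (W v w - W u w)))%:E
     + ((X w * (W v w - W u w) * (Y w * (W v w - W u w)))%:E
     + (Y w * (W v w - W u w) * (X w * (W t w - W v w)))%:E)))%E.
    by apply: eq_integral => w _; rewrite -!EFinD; congr EFin; ring.
  rewrite integralD//; last first.
    by apply: integrableD => //; [exact: past_sqr_integrable D2 B2|
      exact: past_sqr_integrable B2 F2].
  rewrite integralD//; [|exact: past_sqr_integrable D2 B2|exact: past_sqr_integrable B2 F2].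
  by rewrite AB0 FB0 adde0 add0e.
Qed.

Lemma past_sqr_pair s t u v X Y :
  0 <= s -> s <= t -> t <= T -> 0 <= u -> u <= v -> v <= T ->
  past_sqr s X -> past_sqr u Y ->
  (\int[P]_w (X w * (W t w - W s w) * (Y w * (W v w - W u w)))%:E =
   (Num.max 0 (Num.min t v - Num.max s u))%:E * \int[P]_w (X w * Y w)%:E)%E.
Proof.
move=> s0 st tT u0 uv vT X2 Y2; have [su|us] := leP s u.
  by rewrite (pair_le s0 st tT su uv vT X2 Y2).
under eq_integral do rewrite mulrC.
rewrite (pair_le u0 uv vT (ltW us) st tT Y2 X2) minC.
by congr (_ * _)%E; apply: eq_integral => w _; rewrite mulrC.
Qed.

End wiener_isometry.

(** * The isometry for step processes *)

Section step_isometry.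
Context {R : realType} {d : measure_display} {Omega : measurableType d}.
Variables (P : probability Omega R) (T : R) (W B : R -> {RV P >-> R}).
Hypothesis T0 : 0 < T.
Hypothesis wienerW : standard_wiener T W.
Hypothesis WB_indep : independent_systems P (sigma_process W `[0, T])
                                            (sigma_process B `[0, T]).

Lemma sqr_sumE (n : nat) (x : 'I_n -> R) :
  ((\sum_i x i) ^+ 2)%:E = (\sum_i \sum_j (x i * x j)%:E)%E.
Proof.
rewrite expr2 big_distrlr/= -sumEFin; apply: eq_bigr => i _.
by rewrite -sumEFin.
Qed.

Lemma integral_sqr_sum d' (T' : measurableType d') (mu : {measure set T' -> \bar R})
    (D : set T') n (x : 'I_n -> T' -> R) : measurable D ->
  (forall i j, mu.-integrable D (EFin \o (fun w => x i w * x j w))) ->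
  (\int[mu]_(w in D) ((\sum_i x i w) ^+ 2)%:E =
   \sum_i \sum_j \int[mu]_(w in D) (x i w * x j w)%:E)%E.
Proof.
move=> mD I; under eq_integral do rewrite sqr_sumE.
rewrite integral_sum//; last by move=> i; apply: integrable_sum => // j _; exact: I.
by apply: eq_bigr => i _; rewrite integral_sum// => j; exact: I.
Qed.

Let overlap (s t u v : R) := Num.max 0 (Num.min t v - Num.max s u).

Lemma integral_indic_overlap s t u v : 0 <= s -> t <= T -> 0 <= u -> v <= T ->
  (\int[lebesgue_measure]_(x in `[0%R, T]) (\1_(`]s, t]) x * \1_(`]u, v]) x)%:E =
   (overlap s t u v)%:E)%E.
Proof.
move=> s0 tT u0 vT.
have E : `]s, t]%classic `&` `]u, v]%classic =
    `]Num.max s u, Num.min t v]%classic :> set R.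
  by apply/seteqP; split=> x /=; rewrite !in_itv/= gt_max le_min;
    [move=> [/andP[-> ->] /andP[-> ->]]|move=> /andP[/andP[-> ->] /andP[-> ->]]].
transitivity (\int[lebesgue_measure]_(x in `[0%R, T])
    (\1_(`]Num.max s u, Num.min t v]) x)%:E)%E.
  by apply: eq_integral => x _; rewrite -E indicI.
rewrite integral_indic// setIidl; last first.
  move=> x /=; rewrite !in_itv/= gt_max le_min => /andP[/andP[sx _] /andP[xt _]].
  by rewrite (le_trans s0 (ltW sx)) (le_trans xt tT).
rewrite -[LHS]/(lebesgue_measure [set` `]Num.max s u, Num.min t v]%R]).
rewrite lebesgue_measure_itv/= lte_fin /overlap.
have [h|h] := ltP (Num.max s u) (Num.min t v); last first.
  by rewrite [RHS](congr1 EFin (max_l _))// subr_le0.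
by rewrite [RHS](congr1 EFin (max_r _))// subr_ge0 ltW.
Qed.

Lemma integrable_indic_overlap c s t u v :
  lebesgue_measure.-integrable `[0%R, T]
    (EFin \o (fun x => c * (\1_(`]s, t]) x * \1_(`]u, v]) x))).
Proof.
apply: (@integrable_itv_bounded _ T T0 _ `|c|) => [|x _].
  by apply: measurable_funM => //; apply: measurable_funM; exact: measurable_indic.
rewrite !indicE !normrM -[leRHS]mulr1; apply: ler_wpM2l => //.
by rewrite mulr_ile1 // ?ger0_norm ?ler0n//; case: (_ \in _).
Qed.

(** The intervals may overlap arbitrarily: both sides expand into double sums that agree term by
    term, the factor being the length of the overlap. A difference of step processes on unrelated
    grids is thus covered with no common refinement. *)
Lemma step_isometry n (s t : nat -> R) (a : nat -> Omega -> R) :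
  (forall i, (i < n)%N -> [/\ 0 <= s i, s i <= t i, t i <= T & past_sqr T W B (s i) (a i)]) ->
  (\int[P]_w ((\sum_(i < n) a i w * (W (t i) w - W (s i) w)) ^+ 2)%:E =
   \int[P]_w \int[lebesgue_measure]_(x in `[0%R, T])
     ((\sum_(i < n) a i w * \1_(`]s i, t i]) x) ^+ 2)%:E)%E.
Proof.
move=> h.
have I (i j : 'I_n) : P.-integrable setT (EFin \o (fun w => a i w * a j w)).
  have [_ _ _ ai] := h i (ltn_ord i); have [_ _ _ aj] := h j (ltn_ord j).
  exact: (past_sqr_integrable (P := P) ai aj).
transitivity (\sum_(i < n) \sum_(j < n)
    (overlap (s i) (t i) (s j) (t j))%:E * \int[P]_w (a i w * a j w)%:E)%E.
  rewrite integral_sqr_sum//; last first.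
    move=> i j; have [s0 st tT ai] := h i (ltn_ord i).
    have [u0 uv vT aj] := h j (ltn_ord j).
    have ai' := past_sqr_increment wienerW WB_indep s0 st tT ai.
    have aj' := past_sqr_increment wienerW WB_indep u0 uv vT aj.
    exact: (past_sqr_integrable (P := P) ai' aj').
  apply: eq_bigr => i _; apply: eq_bigr => j _.
  have [s0 st tT ai] := h i (ltn_ord i); have [u0 uv vT aj] := h j (ltn_ord j).
  exact: (past_sqr_pair wienerW WB_indep s0 st tT u0 uv vT ai aj).
transitivity (\int[P]_w \sum_(i < n) \sum_(j < n)
    ((overlap (s i) (t i) (s j) (t j))%:E * (a i w * a j w)%:E))%E; last first.
  apply: eq_integral => w _; rewrite integral_sqr_sum//; last first.
    move=> i j; apply: eq_integrable (integrable_indic_overlap (a i w * a j w)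
      (s i) (t i) (s j) (t j)) => // x _.
    by rewrite /=; congr EFin; ring.
  apply: eq_bigr => i _; apply: eq_bigr => j _.
  have [s0 st tT ai] := h i (ltn_ord i); have [u0 uv vT aj] := h j (ltn_ord j).
  rewrite -integral_indic_overlap// muleC -integralZl//.
    by apply: eq_integral => x _; rewrite -EFinM; congr EFin; ring.
  apply: eq_integrable (integrable_indic_overlap 1
      (s i) (t i) (s j) (t j)) => // x _.
  by rewrite /= mul1r.
rewrite integral_sum//; last first.
  by move=> i; apply: integrable_sum => // j _; exact/integrableZl/I.
apply: eq_bigr => i _; rewrite integral_sum//; last by move=> j; exact/integrableZl/I.
by apply: eq_bigr => j _; rewrite integralZl//; exact: I.
Qed.

End step_isometry.

(** * Mixtures of normal densities *)

Section normal_mixture.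
Context {R : realType}.

Lemma normal_prob_affine (m c s : R) (h : R -> R) : 0 < c -> 0 < s ->
  continuous h -> (forall x, 0 <= h x) ->
  (\int[normal_prob 0 s]_z (h (m + c * z))%:E =
   \int[lebesgue_measure]_x (h x * normal_pdf m (c * s) x)%:E)%E.
Proof.
move=> c0 s0 ch h0; pose F (z : R) := m + c * z.
have dF z : is_derive z (1 : R) F c.
  have := is_deriveD (is_derive_cst m z 1) (is_deriveZ c (is_derive_id z 1)).
  by rewrite add0r /GRing.scale/= mulr1.
have F'E : F^`()%classic = cst c by apply/funext => z; rewrite derive1E; have [] := dF z.
have cF : continuous F by move=> z; apply/differentiable_continuous/derivable1_diffP; have [] := dF z.
rewrite ge0_integral_normal_prob; last 2 first.
- apply/measurable_EFinP; apply: (measurableT_comp (continuous_measurable_fun ch)).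
  exact: continuous_measurable_fun.
- by move=> x; rewrite lee_fin.
rewrite (@increasing_ge0_integration_by_substitutionT _ F
  (fun x => h x * normal_pdf m (c * s) x)).
- apply: eq_integral => z _; rewrite -EFinM F'E /= /F -mulrA; congr (_ * _)%:E.
  rewrite -[RHS]/(normal_pdf m (c * s) (m + c * z) * c).
  rewrite !normal_pdf_expE ?mulr_gt0//.
  have -> : ((m + c * z - m) ^+ 2 / (2 * (c * s) ^+ 2)) = (z - 0) ^+ 2 / (2 * s ^+ 2).
    by field; rewrite ?(gt_eqF c0) ?(gt_eqF s0).
  rewrite [RHS]mulrC invfM !mulrA; congr (_ / _ * _).
  by rewrite invfM mulrA mulfV ?gt_eqF// mul1r.
- by move=> x y xy; rewrite /F ltrD2l ltr_pM2l.
- by rewrite F'E => x; exact: cvg_cst.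
- by rewrite F'E; apply/cvg_ex; exists c; exact: cvg_cst.
- by rewrite F'E; apply/cvg_ex; exists c; exact: cvg_cst.
- by move=> x; have [] := dF x.
- apply/cvgrNyPle => A.
  apply: filterS (nbhs_ninfty_le (num_real (c^-1 * (A - m)))) => z.
  by rewrite ler_pdivlMl// lerBrDl.
- apply/cvgryPge => A.
  apply: filterS (nbhs_pinfty_ge (num_real (c^-1 * (A - m)))) => z.
  by rewrite ler_pdivrMl// lerBlDl.
- move=> x; apply: cvgM; first exact: ch.
  by apply: continuous_normal_pdf; rewrite gt_eqF ?mulr_gt0.
- by move=> x; rewrite mulr_ge0// normal_pdf_ge0.
Qed.

(** A random mean is reduced to the case already treated by translating the argument: the density is
    [lognormal_pdf 0] at X - M - V / 2. *)
Lemma measurable_normal_pdf_sqrt d' (T' : measurableType d') (M V X : T' -> R) :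
  measurable_fun setT M -> measurable_fun setT V -> measurable_fun setT X ->
  (forall w, 0 < V w) -> measurable_fun setT (fun w => normal_pdf (M w) (Num.sqrt (V w)) (X w)).
Proof.
move=> mM mV mX V0.
have -> : (fun w => normal_pdf (M w) (Num.sqrt (V w)) (X w)) =
    (fun w => lognormal_pdf 0 (V w) (X w - M w - V w / 2)).
  apply/funext => w; rewrite /lognormal_pdf !normal_pdf_expE ?sqrtr_gt0//.
  by have -> : X w - M w - V w / 2 - (0 - V w / 2) = X w - M w by ring.
apply: measurable_lognormal_pdf => //; apply: measurable_funB.
  exact: measurable_funB.
exact: measurable_funM.
Qed.

Lemma fubini_normal_pdf d (Omega : measurableType d) (P : probability Omega R)
    (h : R -> R) (M V : Omega -> R) :
  measurable_fun setT h -> (forall x, 0 <= h x) ->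
  measurable_fun setT M -> measurable_fun setT V -> (forall w, 0 < V w) ->
  (\int[P]_w \int[lebesgue_measure]_x (h x * normal_pdf (M w) (Num.sqrt (V w)) x)%:E =
   \int[lebesgue_measure]_x
     ((h x)%:E * \int[P]_w (normal_pdf (M w) (Num.sqrt (V w)) x)%:E))%E.
Proof.
move=> mh h0 mM mV V0.
rewrite (@fubini_tonelli _ _ _ _ _ P lebesgue_measure
  (fun p : Omega * R => (h p.2 * normal_pdf (M p.1) (Num.sqrt (V p.1)) p.2)%:E))//; last 2 first.
- apply/measurable_EFinP; apply: measurable_funM.
    by apply: (measurableT_comp mh); exact: measurable_snd.
  apply: measurable_normal_pdf_sqrt => //;
    [exact: (measurableT_comp mM)|exact: (measurableT_comp mV)].
- by move=> p; rewrite lee_fin mulr_ge0 ?normal_pdf_ge0.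
apply: eq_integral => x _; rewrite -ge0_integralZl//.
- by apply/measurable_EFinP; exact: measurable_normal_pdf_sqrt.
- by move=> w _; rewrite lee_fin normal_pdf_ge0.
- by rewrite lee_fin.
Qed.

End normal_mixture.

(** * The exact conditional law of sums with coefficients depending on B *)

Section conditional_sum.
Context {R : realType} {d : measure_display} {Omega : measurableType d}.
Variables (P : probability Omega R) (T : R) (W B : R -> {RV P >-> R}).
Hypothesis wienerW : standard_wiener T W.
Hypothesis WB_indep : independent_systems P (sigma_process W `[0, T])
                                            (sigma_process B `[0, T]).
Variables (n : nat) (u : nat -> R) (c : nat -> Omega -> R).
Hypothesis u0 : 0 <= u 0.
Hypothesis uT : u n <= T.
Hypothesis u_incr : forall i, u i < u i.+1.
Hypothesis mc : forall i, past_measurable T W B 0 (c i).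
Hypothesis c_gt0 : forall i w, 0 < c i w.

Let npdf m v x : R := normal_pdf m (Num.sqrt v) x.

Let S k w := \sum_(i < k) c i w * (W (u i.+1) w - W (u i) w).

Let Q k w := \sum_(i < k) c i w ^+ 2 * (u i.+1 - u i).

Let u_homo : {homo u : i j / (i <= j)%N >-> i <= j}.
Proof. by apply: homo_leq => // [|i]; [exact: le_trans|exact: ltW]. Qed.

Let u_ge0 i : 0 <= u i.
Proof. exact: le_trans (u_homo (leq0n i)). Qed.

Let u_leT i : (i <= n)%N -> u i <= T.
Proof. by move=> /u_homo /le_trans; apply. Qed.

Let mS k : (k <= n)%N -> past_measurable T W B (u k) (S k).
Proof.
move=> kn; apply: measurable_sum => i; have ik := ltn_ord i.
apply: measurable_funM; first exact: past_measurable_mono (mc i).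
by apply: measurable_funB; apply: past_measurable_wiener;
  rewrite u_ge0 u_homo// ltnW.
Qed.

Let mQ k : past_measurable T W B 0 (Q k).
Proof.
apply: measurable_sum => i; apply: measurable_funM => //; apply: measurable_funX; exact: mc.
Qed.

Let Q_ge0 k w : 0 <= Q k w.
Proof.
apply: sumr_ge0 => i _; apply: mulr_ge0; first exact: sqr_ge0.
by rewrite subr_ge0 ltW.
Qed.

(** Induction on the number of increments: integrating out the last one by convolution adds its
    conditional variance to v0, which is why v0 is generalized. The functions M, c and v0 are
    measurable for the past at time 0, which contains B, so they stay frozen throughout. *)
Let smoothed k M v0 x : (k <= n)%N ->
  past_measurable T W B 0 M -> past_measurable T W B 0 v0 -> (forall w, 0 < v0 w) ->
  (\int[P]_w (npdf (M w + S k w) (v0 w) x)%:E =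
   \int[P]_w (npdf (M w) (v0 w + Q k w) x)%:E)%E.
Proof.
elim: k v0 => [|k IH] v0 kn mM mv0 v0_gt0.
  by apply: eq_integral => w _; rewrite /S /Q !big_ord0 !addr0.
pose K (p : g_sigma_algebraType (past T W B (u k)) * R) : \bar R :=
  (npdf (M p.1 + S k p.1 + c k p.1 * p.2) (v0 p.1) x)%:E.
have mfst X : past_measurable T W B (u k) X ->
  measurable_fun setT (fun p : g_sigma_algebraType (past T W B (u k)) * R => X p.1).
  by move=> mX; exact: (measurableT_comp mX).
have m0k X : past_measurable T W B 0 X -> past_measurable T W B (u k) X.
  by apply: past_measurable_mono.
have mK : measurable_fun setT K.
  apply/measurable_EFinP; apply: measurable_normal_pdf_sqrt => //; last exact: (mfst _ (m0k _ mv0)).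
  apply: measurable_funD; last first.
    by apply: measurable_funM; [exact: (mfst _ (m0k _ (mc k)))|exact: measurable_snd].
  apply: measurable_funD; first exact: (mfst _ (m0k _ mM)).
  exact: (mfst _ (mS (ltnW kn))).
have K0 p : (0 <= K p)%E by rewrite lee_fin normal_pdf_ge0.
transitivity (\int[P]_w K (w, W (u k.+1) w - W (u k) w)%R)%E.
  by apply: eq_integral => w _; rewrite /K/= /S big_ord_recr/= addrA.
rewrite (wiener_freezing wienerW WB_indep (u_ge0 k) (u_incr k) (u_leT kn) mK K0).
transitivity (\int[P]_w (npdf (M w + S k w)
    (v0 w + c k w ^+ 2 * (u k.+1 - u k)) x)%:E)%E.
  apply: eq_integral => w _; rewrite /K/= normal_pdf_convolution ?sqrtr_gt0 ?subr_gt0//.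
  by rewrite /npdf !sqr_sqrtr// ?subr_ge0 ltW.
pose v1 w := v0 w + c k w ^+ 2 * (u k.+1 - u k).
have mv1 : past_measurable T W B 0 v1.
  by apply: measurable_funD => //; apply: measurable_funM => //; apply: measurable_funX; exact: mc.
have v1_gt0 w : 0 < v1 w.
  by rewrite ltr_pwDl//; apply: mulr_ge0; [exact: sqr_ge0|rewrite subr_ge0 ltW].
rewrite (IH v1 (ltnW kn) mM mv1 v1_gt0).
by apply: eq_integral => w _; rewrite /Q big_ord_recr/= /v1 -addrA [in RHS](addrC (\sum_(_ < _) _)).
Qed.

(** The last increment turns h into an integral against a nondegenerate normal density. For each
    fixed x the density is then averaged by [smoothed], which accounts for all the earlier
    increments. *)
Lemma integral_normal_sum M (h : R -> R) : (0 < n)%N ->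
  past_measurable T W B 0 M -> continuous h -> (forall x, 0 <= h x) ->
  (\int[P]_w (h (M w + S n w))%:E =
   \int[P]_w \int[lebesgue_measure]_x (h x * npdf (M w) (Q n w) x)%:E)%E.
Proof.
move=> n0 mM ch h0; have nE := prednK n0; set k := n.-1 in nE.
have kn : (k < n)%N by rewrite nE.
have mh := continuous_measurable_fun ch.
pose K (p : g_sigma_algebraType (past T W B (u k)) * R) : \bar R :=
  (h (M p.1 + S k p.1 + c k p.1 * p.2))%:E.
have mfst X : past_measurable T W B (u k) X ->
  measurable_fun setT (fun p : g_sigma_algebraType (past T W B (u k)) * R => X p.1).
  by move=> mX; exact: (measurableT_comp mX).
have m0k X : past_measurable T W B 0 X -> past_measurable T W B (u k) X.
  by apply: past_measurable_mono.
have mK : measurable_fun setT K.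
  apply/measurable_EFinP; apply: (measurableT_comp mh).
  apply: measurable_funD; last first.
    by apply: measurable_funM; [exact: (mfst _ (m0k _ (mc k)))|exact: measurable_snd].
  apply: measurable_funD; first exact: (mfst _ (m0k _ mM)).
  exact: (mfst _ (mS (ltnW kn))).
have K0 p : (0 <= K p)%E by rewrite lee_fin.
have mP s X : past_measurable T W B s X -> measurable_fun setT X.
  exact: past_measurableW.
pose v w := c k w ^+ 2 * (u k.+1 - u k).
have mv : past_measurable T W B 0 v.
  by apply: measurable_funM => //; apply: measurable_funX; exact: mc.
have v0 w : 0 < v w by rewrite mulr_gt0 ?exprn_gt0// subr_gt0.
transitivity (\int[P]_w K (w, W (u k.+1) w - W (u k) w)%R)%E.
  by apply: eq_integral => w _; rewrite /K/= -nE /S big_ord_recr/= addrA.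
rewrite (wiener_freezing wienerW WB_indep (u_ge0 k) (u_incr k) (u_leT kn) mK K0).
transitivity (\int[P]_w \int[lebesgue_measure]_x (h x * npdf (M w + S k w) (v w) x)%:E)%E.
  have s0 : 0 < Num.sqrt (u k.+1 - u k) by rewrite sqrtr_gt0 subr_gt0.
  apply: eq_integral => w _; rewrite /K/= (normal_prob_affine _ (c_gt0 k w) s0 ch h0).
  have -> : c k w * Num.sqrt (u k.+1 - u k) = Num.sqrt (v w); last by [].
  by rewrite /v sqrtrM ?sqr_ge0// sqrtr_sqr (ger0_norm (ltW (c_gt0 k w))).
have mMS : measurable_fun setT (fun w => M w + S k w).
  by apply: measurable_funD; [exact: (mP _ _ mM)|exact: (mP _ _ (mS (ltnW kn)))].
have Q_gt0 w : 0 < Q n w.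
  rewrite -nE /Q big_ord_recr/=; apply: ltr_wpDl (v0 w); exact: Q_ge0.
apply: etrans (fubini_normal_pdf P mh h0 mMS (mP _ _ mv) v0) _.
apply: etrans _ (esym (fubini_normal_pdf P mh h0 (mP _ _ mM) (mP _ _ (mQ n)) Q_gt0)).
apply: eq_integral => x _; apply: (congr1 (fun y => (h x)%:E * y)%E).
apply: etrans (smoothed x (ltnW kn) mM mv v0) _.
by apply: eq_integral => w _; rewrite -nE /Q big_ord_recr/= addrC.
Qed.

End conditional_sum.

(** * Y and its discretizations satisfy the same sub-Gaussian bounds *)

Section ou_processes.
Context {R : realType} {d : measure_display} {Omega : measurableType d}.
Variables (P : probability Omega R) (T H alpha Y0 : R) (B : R -> {RV P >-> R}).
Variable Y : R -> Omega -> R.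
Hypotheses (T0 : 0 < T) (H01 : 2^-1 < H < 1) (alpha0 : 0 < alpha).
Hypothesis fbm : fractional_brownian T H B.
Hypothesis YOU : fractional_OU T alpha Y0 B Y.

Let eps := ou_exponent T H alpha.
Let Keps : R := 4 * expR (2 * eps * Y0 ^+ 2).

Lemma jointly_measurable_noise (u : R -> R) : measurable_fun setT u ->
  (forall s, 0 <= u s <= T) ->
  measurable_fun setT (fun p : R * Omega => B (u p.1) p.2).
Proof.
move=> mu uT; have [_ _ _ cB] := fbm.
have mB := @measurable_continuous_process R _ Omega T B (ltW T0)
  (fun t => @measurable_funPT _ _ _ _ (B t)) cB.
rewrite (_ : (fun p => _) = (fun p : R * Omega => B (clamp T (u p.1)) p.2)); last first.
  by apply/funext => p; rewrite clamp_id.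
have mh : measurable_fun setT (fun p : R * Omega => (u p.1, p.2)).
  by apply/measurable_fun_pairP; split; [exact: (measurableT_comp mu)|exact: measurable_snd].
exact: (measurableT_comp mB mh).
Qed.

(** Y is a pointwise limit of left sums over grids of [0, s] that scale with s. Each sum is jointly
    measurable because B has continuous paths. *)
Lemma jointly_measurable_ou : jointly_measurable T Y.
Proof.
have mc : measurable_fun setT (fun p : R * Omega => clamp T p.1).
  by apply: measurableT_comp; [exact: measurable_clamp|exact: measurable_fst].
have mexp a : measurable_fun setT (fun p : R * Omega => expR (a * clamp T p.1)).
  by apply: measurableT_comp => //; exact: measurable_funM.
have cT s : 0 <= clamp T s <= T by exact/clamp_itv/ltW.
pose g N k s := linear_grid 0 (clamp T s) N k.
have gE N k s : g N k s = clamp T s * (k%:R / N%:R).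
  by rewrite /g /linear_grid subr0 add0r.
have mg N k : measurable_fun setT (g N k).
  rewrite (_ : g N k = fun s => clamp T s * (k%:R / N%:R)).
    by apply: measurable_funM => //; exact: measurable_clamp.
  by apply/funext => s; exact: gE.
have gT N k s : (k <= N)%N -> 0 <= g N k s <= T.
  move=> kN; have /andP[c0 cT'] := cT s.
  by have /andP[-> /le_trans ->] := linear_grid_itv c0 kN.
rewrite /jointly_measurable (_ : (fun p => _) = fun p : R * Omega =>
    Y0 * expR (- alpha * clamp T p.1) +
    expR (- alpha * clamp T p.1) * ou_noise alpha Y0 Y (clamp T p.1) p.2); last first.
  by apply/funext => p; exact: ou_noiseE.
apply: measurable_funD; apply: measurable_funM => //.
apply: (@measurable_fun_cvg _ _ _ setT (fun N (p : R * Omega) =>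
  \sum_(k < N.+1) expR (alpha * g N.+1 k p.1) * (B (g N.+1 k.+1 p.1) p.2 - B (g N.+1 k p.1) p.2))).
  move=> N; apply: measurable_sum => k; apply: measurable_funM.
    apply: measurableT_comp => //; apply: measurable_funM => //.
    by apply: measurableT_comp => //; exact: measurable_fst.
  apply: measurable_funB; apply: jointly_measurable_noise => // s; apply: gT => //.
  exact: ltnW.
move=> p _; have /andP[c0 cT'] := cT p.1.
have := left_sum_cvg T0 YOU (w := p.2) (lexx (0 : R)) c0 cT'.
by rewrite (ou_noise0 T0 YOU) subr0.
Qed.

Lemma jointly_measurable_Yn n : jointly_measurable T (Yn T alpha Y0 B n).
Proof.
apply: (@measurable_fun_nat_index _ _ _ _ (fun n' (p : R * Omega) => Yn_grid T alpha Y0 B n n' p.2)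
   (fun p => Num.truncn (clamp T p.1 * n%:R / T))) => [j|j].
  by apply: measurableT_comp; [exact: measurable_Yn_grid|exact: measurable_snd].
rewrite (_ : [set _ | _] = (fun p : R * Omega => clamp T p.1 * n%:R / T) @^-1`
    [set x | Num.truncn x = j])//.
rewrite -[_ @^-1` _]setTI; apply: (_ : measurable_fun _ _) => //; last first.
  exact: measurable_truncn_eq.
do 2 apply: measurable_funM => //.
by apply: measurableT_comp; [exact: measurable_clamp|exact: measurable_fst].
Qed.

Lemma subgaussian_ou : subgaussian_process P T eps Keps Y.
Proof.
split; first exact: jointly_measurable_ou.
- move=> w; have [K K0 HK] := ou_noise_bounded T0 alpha0 fbm YOU w.
  exists (`|Y0| + K) => s sT; have /andP[s0 _] := sT.
  have e1 : expR (- alpha * s) <= 1.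
    by rewrite -expR0 ler_expR mulNr oppr_le0 mulr_ge0// ltW.
  rewrite (ou_noiseE alpha Y0); apply: le_trans (ler_normD _ _) _; apply: lerD.
    by rewrite normrM (ger0_norm (expR_ge0 _)) ler_piMr.
  rewrite normrM (ger0_norm (expR_ge0 _)) -[leRHS]mul1r.
  by apply: ler_pM => //; exact: HK.
- move=> s sT; exact: (ou_exp_sqr T0 H01 alpha0 fbm YOU sT).
Qed.

Lemma subgaussian_Yn n : (0 < n)%N ->
  subgaussian_process P T eps Keps (Yn T alpha Y0 B n).
Proof.
move=> n0; split; first exact: jointly_measurable_Yn.
- move=> w; exists (\sum_(i < n.+1) `|Yn_grid T alpha Y0 B n i w|) => s sT.
  have [jn _ _] := Yn_index T0 n0 sT.
  rewrite /Yn; set j := Num.truncn _ in jn *.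
  by rewrite (bigD1 (Ordinal (jn : (j < n.+1)%N)))//= lerDl sumr_ge0.
- move=> s sT; have [jn _ _] := Yn_index T0 n0 sT; exact: (Yn_grid_exp_sqr Y0 T0 H01 alpha0 fbm n0 jn).
Qed.

End ou_processes.

(** * Second moments of sums of processes *)

Section square_sums.
Context {R : realType}.

Lemma ge0_integral_sqrD_le d (T : measurableType d) (m : {measure set T -> \bar R})
    (D : set T) (f g : T -> R) : measurable D ->
  measurable_fun D f -> measurable_fun D g ->
  (\int[m]_(x in D) ((f x + g x) ^+ 2)%:E <=
   2%:E * \int[m]_(x in D) (f x ^+ 2)%:E + 2%:E * \int[m]_(x in D) (g x ^+ 2)%:E)%E.
Proof.
move=> mD mf mg.
have mf2 : measurable_fun D (fun x => (f x ^+ 2)%:E).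
  by apply/measurable_EFinP; exact: measurable_funX.
have mg2 : measurable_fun D (fun x => (g x ^+ 2)%:E).
  by apply/measurable_EFinP; exact: measurable_funX.
rewrite -!ge0_integralZl//; try by move=> x _; rewrite lee_fin sqr_ge0.
rewrite -ge0_integralD//; last 4 first.
- by move=> x _; rewrite -EFinM lee_fin mulr_ge0 ?sqr_ge0.
- by apply: emeasurable_funM.
- by move=> x _; rewrite -EFinM lee_fin mulr_ge0 ?sqr_ge0.
- by apply: emeasurable_funM.
apply: ge0_le_integral => //.
- by move=> x _; rewrite lee_fin sqr_ge0.
- by apply/measurable_EFinP; apply: measurable_funX; exact: measurable_funD.
- by apply: emeasurable_funD; apply: emeasurable_funM.
- by move=> x _; rewrite -!EFinM -EFinD lee_fin; have := sqr_ge0 (f x - g x); nra.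
Qed.

Variables (d : measure_display) (Omega : measurableType d) (P : probability Omega R).
Variable T : R.
Hypothesis T0 : 0 < T.
Local Notation mu := (@lebesgue_measure R).

Lemma jointly_measurableD (F G : R -> Omega -> R) :
  jointly_measurable T F -> jointly_measurable T G ->
  jointly_measurable T (fun s w => F s w + G s w).
Proof. by move=> mF mG; exact: measurable_funD. Qed.

Lemma jointly_measurableB (F G : R -> Omega -> R) :
  jointly_measurable T F -> jointly_measurable T G ->
  jointly_measurable T (fun s w => F s w - G s w).
Proof. by move=> mF mG; exact: measurable_funB. Qed.

Lemma jointly_measurableX (F : R -> Omega -> R) k :
  jointly_measurable T F -> jointly_measurable T (fun s w => F s w ^+ k).
Proof. by move=> mF; exact: measurable_funX. Qed.

Lemma jointly_measurable_step n (s t : nat -> R) (a : nat -> Omega -> R) :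
  (forall i, (i < n)%N -> measurable_fun setT (a i)) ->
  jointly_measurable T (fun x w => \sum_(i < n) a i w * \1_(`]s i, t i]) x).
Proof.
move=> ma; apply: measurable_sum => i; apply: measurable_funM.
  by apply: measurableT_comp; [exact: ma|exact: measurable_snd].
have mi : measurable_fun setT (\1_(`]s i, t i]) : R -> R) by exact: measurable_indic.
apply: (measurableT_comp mi).
by apply: measurableT_comp; [exact: measurable_clamp|exact: measurable_fst].
Qed.

Lemma integral_process_sqrD_le (F G : R -> Omega -> R) :
  jointly_measurable T F -> jointly_measurable T G ->
  (\int[P]_w \int[mu]_(s in `[0%R, T]) ((F s w + G s w) ^+ 2)%:E <=
   2%:E * \int[P]_w \int[mu]_(s in `[0%R, T]) (F s w ^+ 2)%:E +
   2%:E * \int[P]_w \int[mu]_(s in `[0%R, T]) (G s w ^+ 2)%:E)%E.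
Proof.
move=> mF mG.
have msqr (K : R -> Omega -> R) : jointly_measurable T K ->
    measurable_fun setT (fun w => \int[mu]_(s in `[0%R, T]) (K s w ^+ 2)%:E)%E.
  move=> mK; apply: (measurable_process_integral T0 (jointly_measurableX 2 mK)).
  by move=> s w _; exact: sqr_ge0.
have sqr0 (K : R -> Omega -> R) w : (0 <= \int[mu]_(s in `[0%R, T]) (K s w ^+ 2)%:E)%E.
  by apply: integral_ge0 => s _; rewrite lee_fin sqr_ge0.
rewrite -!ge0_integralZl//; try exact: msqr.
rewrite -ge0_integralD//; last 4 first.
- by move=> w _; rewrite mule_ge0.
- by apply: emeasurable_funM => //; exact: msqr.
- by move=> w _; rewrite mule_ge0.
- by apply: emeasurable_funM => //; exact: msqr.
apply: ge0_le_integral => //.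
- by move=> w _; exact: (sqr0 (fun s w => F s w + G s w)).
- exact: (msqr _ (jointly_measurableD mF mG)).
- by apply: emeasurable_funD; apply: emeasurable_funM => //; exact: msqr.
- by move=> w _; apply: ge0_integral_sqrD_le => //; exact: jointly_measurable_path.
Qed.

End square_sums.


(** * The distance between an Ito integral and a step sum *)

Section ito.
Context {R : realType} {d : measure_display} {Omega : measurableType d}.
Variables (P : probability Omega R) (T : R) (W B : R -> {RV P >-> R}).
Hypothesis T0 : 0 < T.
Hypothesis wienerW : standard_wiener T W.
Hypothesis WB_indep : independent_systems P (sigma_process W `[0, T])
                                            (sigma_process B `[0, T]).
Local Notation mu := (@lebesgue_measure R).

(** The Ito integral is defined with the natural filtration; its simple processes remain admissible
    for the larger past that contains all of B. *)
Lemma natural_filtration_past t : t <= T ->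
  natural_filtration W B t `<=` <<s past T W B t >>.
Proof.
move=> tT; apply: sub_smallest2r; first exact: smallest_sigma_algebra.
apply: setUS; apply: sub_sigma_process => u /=; rewrite !in_itv/= => /andP[-> ut].
exact: le_trans tT.
Qed.

Lemma past_sqr_bounded s X M : past_measurable T W B s X ->
  (forall w, `|X w| <= M) -> past_sqr T W B s X.
Proof.
move=> mX XM; split => //.
apply: (@le_lt_trans _ _ (\int[P]_w (M ^+ 2)%:E)%E); last first.
  by rewrite integral_cst//= probability_setT mule1 ltry.
apply: ge0_le_integral => //.
- by move=> w _; rewrite lee_fin sqr_ge0.
- by apply/measurable_EFinP; apply: measurable_funX; exact: past_measurableW mX.
- by move=> w _; rewrite lee_fin -ler_sqrt ?sqr_ge0// sqrtr_sqr sqrtr_sqr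
    (le_trans (XM w)) ?ler_norm.
Qed.

Lemma measurable_wiener_sum n (s t : nat -> R) (a : nat -> Omega -> R) :
  (forall i, (i < n)%N -> measurable_fun setT (a i)) ->
  measurable_fun setT (fun w => \sum_(i < n) a i w * (W (t i) w - W (s i) w)).
Proof.
move=> ma; apply: measurable_sum => i; apply: measurable_funM; first exact: ma.
by apply: measurable_funB; exact: measurable_funPT.
Qed.

(** The simple integrals that define Z are inserted between Z and the step sum. The isometry turns
    the second difference into a distance of step processes, between which u is inserted. Each
    insertion costs a factor 2, whence 4, and the terms in k vanish in the limit. *)
Lemma ito_step_error (u : R -> Omega -> R) (Z : Omega -> R) n (s t : nat -> R)
    (a : nat -> Omega -> R) :
  is_ito_integral P (natural_filtration W B) W u T Z ->
  jointly_measurable T u -> measurable_fun setT Z ->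
  (forall i, (i < n)%N -> [/\ 0 <= s i, s i <= t i, t i <= T & past_sqr T W B (s i) (a i)]) ->
  (\int[P]_w ((Z w - \sum_(i < n) a i w * (W (t i) w - W (s i) w)) ^+ 2)%:E <=
   4%:E * \int[P]_w \int[mu]_(x in `[0%R, T])
     ((u x w - \sum_(i < n) a i w * \1_(`]s i, t i]) x) ^+ 2)%:E)%E.
Proof.
move=> [phi [phi_u phi_Z]] mu_ mZ h.
have double (x y : \bar R) : (0 <= x -> 0 <= y ->
    2%:E * (2%:E * x + 2%:E * y) = 4%:E * x + 4%:E * y)%E.
  move=> x0 y0; rewrite ge0_muleDr ?mule_ge0// !muleA -EFinM.
  by have -> : (2 * 2 = 4 :> R) by ring.
set L := (X in (X <= _)%E); set J := (X in (_ <= 4%:E * X)%E).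
have J0 : (0 <= J)%E.
  by apply: integral_ge0 => w _; apply: integral_ge0 => x _; rewrite lee_fin sqr_ge0.
pose e k := (\int[P]_w \int[mu]_(x in `[0%R, T]) ((sp_eval (phi k) x w - u x w) ^+ 2)%:E)%E.
pose f k := (\int[P]_w ((sp_integral (phi k) W w - Z w) ^+ 2)%:E)%E.
have eE : e @ \oo --> 0%E by [].
have fE : f @ \oo --> 0%E.
  move: phi_Z; rewrite (_ : (fun k => _) = f)//.
  by apply/funext => k; rewrite expectation.unlock.
have ma i : (i < n)%N -> measurable_fun setT (a i).
  by move=> /h[_ _ _ [/past_measurableW]].
have mono k i j : (i <= j <= sp_size (phi k))%N -> sp_time (phi k) i <= sp_time (phi k) j.
  move=> /andP[]; elim: j => [|j IH]; first by rewrite leqn0 => /eqP ->.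
  rewrite leq_eqVlt => /orP[/eqP -> //|ij jk].
  by apply: le_trans (IH ij (ltnW jk)) _; exact: sp_time_mono.
have sp k i : (i < sp_size (phi k))%N -> [/\ 0 <= sp_time (phi k) i,
    sp_time (phi k) i <= sp_time (phi k) i.+1, sp_time (phi k) i.+1 <= T &
    past_sqr T W B (sp_time (phi k) i) (sp_val (phi k) i)].
  move=> ik.
  have tT : sp_time (phi k) i.+1 <= T.
    by apply: le_trans (sp_time_le (phi k)); apply: mono; rewrite ik leqnn.
  have st := sp_time_mono ik.
  split=> //; first by apply: le_trans (sp_time_ge0 (phi k)) _; apply: mono; exact: ltnW.
  have [M HM] := sp_bounded ik; apply: past_sqr_bounded HM.
  apply: past_measurable_sub (sp_adapted ik).
  by apply: natural_filtration_past; exact: le_trans tT.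
have msp k i : (i < sp_size (phi k))%N -> measurable_fun setT (sp_val (phi k) i).
  by move=> /sp[_ _ _ [/past_measurableW]].
have key k : (L <= 2%:E * f k + (4%:E * e k + 4%:E * J))%E.
  set A := fun w => \sum_(i < n) a i w * (W (t i) w - W (s i) w).
  set G := fun x w => \sum_(i < n) a i w * \1_(`]s i, t i]) x.
  have mA : measurable_fun setT A by exact: measurable_wiener_sum.
  have mS : measurable_fun setT (sp_integral (phi k) W).
    exact: (@measurable_wiener_sum _ (sp_time (phi k)) (fun i => sp_time (phi k) i.+1) _ (@msp k)).
  have mG : jointly_measurable T G by exact: jointly_measurable_step.
  have mE : jointly_measurable T (sp_eval (phi k)).
    exact: (@jointly_measurable_step _ _ _ T _ (sp_time (phi k)) (fun i => sp_time (phi k) i.+1) _ (@msp k)).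
  have isom : (\int[P]_w ((sp_integral (phi k) W w - A w) ^+ 2)%:E =
      \int[P]_w \int[mu]_(x in `[0%R, T]) ((sp_eval (phi k) x w - G x w) ^+ 2)%:E)%E.
    (* The difference of the two step processes is itself a step process: the intervals of the
       second list follow those of the first, with opposite coefficients. *)
    pose N := sp_size (phi k).
    pose s' i := if (i < N)%N then sp_time (phi k) i else s (i - N)%N.
    pose t' i := if (i < N)%N then sp_time (phi k) i.+1 else t (i - N)%N.
    pose a' i w := if (i < N)%N then sp_val (phi k) i w else - a (i - N)%N w.
    have split_sum (F : nat -> R) (F1 F2 : nat -> R) :
        (forall i, F i = if (i < N)%N then F1 i else - F2 (i - N)%N) ->
        \sum_(i < N + n) F i = \sum_(i < N) F1 i - \sum_(i < n) F2 i.
      move=> FE; rewrite big_split_ord/= -sumrN; congr (_ + _).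
        by apply: eq_bigr => i _; rewrite FE ltn_ord.
      by apply: eq_bigr => i _; rewrite FE ltnNge leq_addr/= addKn.
    have := @step_isometry R _ _ P T W B T0 wienerW WB_indep (N + n) s' t' a'.
    have -> : (fun w => ((\sum_(i < N + n) a' i w * (W (t' i) w - W (s' i) w)) ^+ 2)%:E) =
        (fun w => ((sp_integral (phi k) W w - A w) ^+ 2)%:E).
      apply/funext => w; congr ((_ ^+ 2)%:E).
      apply: (split_sum (fun i => a' i w * (W (t' i) w - W (s' i) w))
        (fun i => sp_val (phi k) i w *
           (W (sp_time (phi k) i.+1) w - W (sp_time (phi k) i) w))
        (fun i => a i w * (W (t i) w - W (s i) w))) => i.
      by rewrite /a' /t' /s'; case: ifP => _ //; rewrite mulNr.
    have -> : (fun w => \int[mu]_(x in `[0%R, T])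
          ((\sum_(i < N + n) a' i w * \1_(`]s' i, t' i]) x) ^+ 2)%:E)%E =
        (fun w => \int[mu]_(x in `[0%R, T]) ((sp_eval (phi k) x w - G x w) ^+ 2)%:E)%E.
      apply/funext => w; apply: eq_integral => x _; congr ((_ ^+ 2)%:E).
      apply: (split_sum (fun i => a' i w * \1_(`]s' i, t' i]) x)
        (fun i => sp_val (phi k) i w * \1_(`]sp_time (phi k) i, sp_time (phi k) i.+1]) x)
        (fun i => a i w * \1_(`]s i, t i]) x)) => i.
      by rewrite /a' /t' /s'; case: ifP => _ //; rewrite mulNr.
    apply=> i iNn; rewrite /s' /t' /a'; case: ltnP => iN; first exact: sp.
    have /h[s0 st tT [mai ai2]] : (i - N < n)%N by rewrite ltn_subLR.
    split=> //; split; first exact: measurable_funN.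
    by under eq_integral do rewrite sqrrN.
  have L1 : (L <= 2%:E * f k + 2%:E * \int[P]_w ((sp_integral (phi k) W w - A w) ^+ 2)%:E)%E.
    have := @ge0_integral_sqrD_le R _ _ P setT (fun w => Z w - sp_integral (phi k) W w)
      (fun w => sp_integral (phi k) W w - A w) measurableT (measurable_funB mZ mS)
      (measurable_funB mS mA).
    under eq_integral do rewrite addrA subrK.
    under [X in (_ <= 2%:E * X + _)%E -> _]eq_integral do rewrite -sqrrN opprB.
    by [].
  have L2 : (\int[P]_w \int[mu]_(x in `[0%R, T]) ((sp_eval (phi k) x w - G x w) ^+ 2)%:E <=
      2%:E * e k + 2%:E * J)%E.
    have := integral_process_sqrD_le P T0 (jointly_measurableB mE mu_)
      (jointly_measurableB mu_ mG).
    under eq_integral do under eq_integral do rewrite addrA subrK.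
    by [].
  apply: le_trans L1 _; rewrite isom leeD2l//.
  apply: le_trans (lee_wpmul2l _ L2) _ => //.
  have e0 : (0 <= e k)%E.
    by apply: integral_ge0 => w _; apply: integral_ge0 => x _; rewrite lee_fin sqr_ge0.
  have dJ : (2%:E * (2%:E * e k + 2%:E * J) = 4%:E * e k + 4%:E * J)%E := double _ _ e0 J0.
  by rewrite dJ.
have f2 : (2%:E * f k)%E @[k --> \oo] --> 0%E.
  by have := cvgeZl (isT : 2%:E \is a fin_num) fE; rewrite mule0.
have e4 : (4%:E * e k)%E @[k --> \oo] --> 0%E.
  by have := cvgeZl (isT : 4%:E \is a fin_num) eE; rewrite mule0.
have cJ : (fun=> 4%:E * J)%E @ \oo --> (4%:E * J)%E by exact: cvg_cst.
have e4J : (4%:E * e k + 4%:E * J)%E @[k --> \oo] --> (4%:E * J)%E.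
  by rewrite -[X in _ --> X]add0e; apply: cvgeD.
have cv : (2%:E * f k + (4%:E * e k + 4%:E * J))%E @[k --> \oo] --> (4%:E * J)%E.
  by rewrite -[X in _ --> X]add0e; apply: cvgeD.
exact: (cvge_to_ge cv (nearW _ key)).
Qed.

End ito.

(** * Identification of a law by Lipschitz test functions *)

Section law_of_ramps.
Context {R : realType}.
Local Notation mu := (@lebesgue_measure R).

(* The Lipschitz functions increasing to the indicator of ]c, +oo[. *)
Definition ramp (c : R) (k : nat) (x : R) : R := Num.min 1 (k.+1%:R * Num.max 0 (x - c)).

Lemma ramp_ge0 c k x : 0 <= ramp c k x.
Proof. by rewrite le_min ler01 mulr_ge0// le_max lexx. Qed.

Lemma ramp_le1 c k x : ramp c k x <= 1.
Proof. by rewrite ge_min lexx. Qed.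

Lemma ramp_lip c k x y : `|ramp c k x - ramp c k y| <= k.+1%:R * `|x - y|.
Proof.
suff main a b : ramp c k a <= ramp c k b + k.+1%:R * `|a - b|.
  rewrite ler_norml lerBlDl main andbT.
  by have := main y x; rewrite (distrC y); lra.
have n0 : 0 <= k.+1%:R :> R by [].
have m : Num.max 0 (a - c) <= Num.max 0 (b - c) + `|a - b|.
  rewrite ge_max addr_ge0 ?le_max ?lexx//=.
  apply: (@le_trans _ _ (b - c + `|a - b|)); last by rewrite lerD2r le_max lexx orbT.
  by rewrite addrAC lerD2r -lerBlDl ler_norm.
rewrite /ramp addr_minl le_min; apply/andP; split.
  by rewrite ge_min lerDl mulr_ge0.
by rewrite ge_min -mulrDr ler_wpM2l ?orbT.
Qed.

Lemma continuous_ramp c k : continuous (ramp c k).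
Proof.
move=> x; apply/cvgrPdist_lt => e e0; near=> y.
apply: le_lt_trans (ramp_lip c k x y) _.
rewrite mulrC -ltr_pdivlMr//; near: y.
apply: (@cvgr_dist_lt _ _ _ _ _ id x); first exact: cvg_id.
by rewrite divr_gt0.
Unshelve. all: by end_near. Qed.

Lemma ramp_homo c x : {homo (fun k => ramp c k x) : n m / (n <= m)%N >-> n <= m}.
Proof.
move=> n m nm; rewrite /ramp le_min ge_min lexx/= ge_min; apply/orP; right.
by rewrite ler_wpM2r ?ler_nat// le_max lexx.
Qed.

Lemma ramp_cvg c x : ramp c k x @[k --> \oo] --> (\1_(`]c, +oo[) x : R).
Proof.
apply: cvg_near_cst; rewrite indicE mem_setE in_itv/= andbT.
have [xc|cx] := leP x c.
  by apply: nearW => k; rewrite /ramp max_l ?subr_le0// mulr0 min_r.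
have d0 : 0 < x - c by rewrite subr_gt0.
apply: filterS (near_infty_natSinv_lt (PosNum d0)) => k /= kd.
rewrite /ramp max_r ?(ltW d0)// min_l//.
by rewrite mulrC -ler_pdivrMr// div1r ltW.
Qed.

Context d (Omega : measurableType d) (P : probability Omega R).
Variables (X : Omega -> R) (q : R -> R).
Hypotheses (mX : measurable_fun setT X) (mq : measurable_fun setT q).
Hypothesis q0 : forall x, 0 <= q x.
Hypothesis q1 : (\int[mu]_x (q x)%:E = 1)%E.
Hypothesis rampE : forall c k,
  (\int[P]_w (ramp c k (X w))%:E = \int[mu]_x (ramp c k x * q x)%:E)%E.

Let mramp c k : measurable_fun setT (ramp c k).
Proof. by apply: continuous_measurable_fun; exact: continuous_ramp. Qed.

Let law_ray c : (P (X @^-1` `]c, +oo[) = \int[mu]_(x in `]c, +oo[) (q x)%:E)%E.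
Proof.
have mray : measurable (`]c, +oo[%classic : set R) by [].
have limE x : (limn (fun k => (ramp c k x)%:E) = (\1_(`]c, +oo[) x)%:E)%E.
  by apply/cvg_lim => //; apply/fine_cvgP; split; [exact: nearW|exact: ramp_cvg].
have cP : ((\int[P]_w (ramp c k (X w))%:E)%E @[k --> \oo] --> P (X @^-1` `]c, +oo[))%E.
  have -> : P (X @^-1` `]c, +oo[) = (\int[P]_w limn (fun k => (ramp c k (X w))%:E))%E.
    under eq_integral do rewrite limE.
    rewrite (eq_integral (fun w => (\1_(X @^-1` `]c, +oo[) w)%:E))//.
    rewrite integral_indic ?setIT// -[X @^-1` _]setTI; exact: mX.
  apply: cvg_monotone_convergence => //.
  - by move=> k; apply/measurable_EFinP; exact: measurableT_comp.
  - by move=> k w _; rewrite lee_fin ramp_ge0.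
  - by move=> w _ n m nm; rewrite lee_fin ramp_homo.
have cq : ((\int[P]_w (ramp c k (X w))%:E)%E @[k --> \oo] -->
    \int[mu]_(x in `]c, +oo[) (q x)%:E)%E.
  have -> : (\int[mu]_(x in `]c, +oo[) (q x)%:E =
      \int[mu]_x limn (fun k => (ramp c k x * q x)%:E))%E.
    rewrite integral_mkcond; apply: eq_integral => x _; rewrite patchE.
    have cxq : (ramp c k x * q x)%:E @[k --> \oo] --> ((\1_(`]c, +oo[) x) * q x)%:E.
      apply/fine_cvgP; split; first exact: nearW.
      by apply: cvgM; [exact: ramp_cvg|exact: cvg_cst].
    rewrite (cvg_lim _ cxq)// indicE; case: ifP => _; first by rewrite mul1r.
    by rewrite mul0r.
  rewrite (_ : (fun k => _) = (fun k => \int[mu]_x (ramp c k x * q x)%:E)%E); last first.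
    by apply/funext => k; exact: rampE.
  apply: cvg_monotone_convergence => //.
  - by move=> k; apply/measurable_EFinP; exact: (measurable_funM (mramp c k) mq).
  - by move=> k x _; rewrite lee_fin mulr_ge0// ramp_ge0.
  - by move=> x _ n m nm; rewrite lee_fin ler_wpM2r// ramp_homo.
exact: cvg_unique cP cq.
Qed.

(** Open half-lines are stable under intersection and generate the Borel sets; they are reached by
    monotone limits of ramps, and Dynkin's lemma does the rest. *)
Lemma law_of_ramps (A : set R) : measurable A ->
  (P (X @^-1` A) = \int[mu]_(x in A) (q x)%:E)%E.
Proof.
have mqE (D : set R) : measurable_fun D (EFin \o q).
  by apply: measurable_funTS; exact/measurable_EFinP.
have q0E x : (0 <= (q x)%:E)%E by rewrite lee_fin.
have mXA (D : set R) : measurable D -> measurable (X @^-1` D).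
  by move=> mD; rewrite -[_ @^-1` _]setTI; exact: mX.
pose rays := @RGenOInfty.G R.
have mrays := RGenOInfty.measurableE R.
move=> mA; have {}mA : <<s rays >> A by rewrite -[X in X A]mrays.
apply: (@dynkin_induction _ (g_sigma_algebraType (@ocitv R)) rays
  [set A | P (X @^-1` A) = \int[mu]_(x in A) (q x)%:E]%E) mA => //.
- move=> _ _ [x ->] [y ->]; exists (Num.max x y).
  by apply/seteqP; split=> z /=; rewrite !in_itv/= !andbT gt_max; [case=> -> ->|case/andP].
- by rewrite /= preimage_setT probability_setT q1.
- by move=> _ [c ->]; exact: law_ray.
- move=> S mS /= PS; rewrite -[X @^-1` (~` S)]/(~` (X @^-1` S)).
  rewrite probability_setC; last exact: mXA.
  rewrite PS -q1.
  have -> : (\int[mu]_x (q x)%:E = \int[mu]_(x in S) (q x)%:E + \int[mu]_(x in ~` S) (q x)%:E)%E.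
    rewrite -ge0_integral_setU//; first by rewrite setUv.
    - exact: measurableC.
    - exact: mqE.
    - by rewrite disj_set2E setICr.
  have Sfin : (\int[mu]_(x in S) (q x)%:E)%E \is a fin_num.
    by rewrite -PS fin_num_measure//; exact: mXA.
  by rewrite addeAC subee// add0e.
- move=> F mF tF PF /=; rewrite preimage_bigcup measure_bigcup//; last 2 first.
  + by move=> k _; exact: (mXA _ (mF k)).
  + apply/trivIsetP => i j _ _ ij; move/trivIsetP : tF => /(_ i j Logic.I Logic.I ij) Fij.
    by rewrite -preimage_setI Fij preimage_set0.
  rewrite ge0_integral_bigcup//; last exact: mqE.
  transitivity (\sum_(0 <= i <oo) P (X @^-1` F i))%E.
    by apply: eq_eseriesl => i; rewrite in_setT.
  by apply: eq_eseriesr => i _; exact: PF.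
Qed.

Lemma ge0_integral_of_ramps (f : R -> \bar R) : measurable_fun setT f ->
  (forall x, 0 <= f x)%E ->
  (\int[P]_w f (X w) = \int[mu]_x (f x * (q x)%:E))%E.
Proof.
(* The Lebesgue measure lives on the reals with the sigma-algebra generated by half-open intervals,
   so X is repackaged with that codomain. *)
move=> mf f0; pose S := g_sigma_algebraType (@ocitv R).
pose hX := isMeasurableFun.Build _ _ _ S X mX.
pose X' : {mfun Omega >-> S} := HB.pack (X : Omega -> S) hX.
pose m' : {measure set S -> \bar R} := distribution P X'.
have law (A : set S) : measurable A -> m' A = (\int[mu]_(x in A) (q x)%:E)%E.
  exact: law_of_ramps.
rewrite -(@ge0_integral_density _ S R mu m' q mq q0 law f mf f0).
exact: (@ge0_integral_law _ _ _ S R P m' X f).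
Qed.

End law_of_ramps.

(** * Step functions on the grid *)

Section step_grid.
Context {R : realType}.
Variable T : R.
Hypothesis T0 : 0 < T.
Local Notation mu := (@lebesgue_measure R).
Local Notation tg := (grid T).

Let on_grid n (s : R) := exists2 i, (i <= n)%N & s = tg n i.

(** Simple processes are constant on intervals ]t_i, t_(i+1)] whereas Y_n is constant on [t_i,
    t_(i+1)[. The two conventions differ at grid points only, a null set. *)
Lemma integral_off_grid n (F G : R -> \bar R) :
  measurable_fun `[0, T] F -> measurable_fun `[0, T] G ->
  (forall s, 0 <= s <= T -> ~ on_grid n s -> F s = G s) ->
  (\int[mu]_(s in `[0%R, T]) F s = \int[mu]_(s in `[0%R, T]) G s)%E.
Proof.
move=> mF mG FG; apply: ae_eq_integral => //.
have cg : countable [set s | on_grid n s].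
  apply: finite_set_countable; apply: sub_finite_set (finite_image (tg n) (finite_II n.+1)).
  by move=> s [i ni ->]; exists i.
exists [set s | on_grid n s]; split.
- by apply: countable_measurable => // t; exact: measurable_set1.
- exact: countable_lebesgue_measure0.
- move=> s /= /not_implyP[]; rewrite in_itv/= => sT FGs.
  by apply: contrapT => sg; apply: FGs; exact: FG.
Qed.

Lemma grid_n n : (0 < n)%N -> tg n n = T.
Proof. by move=> n0; rewrite /grid mulrAC mulfV ?mul1r// pnatr_eq0 -lt0n. Qed.

Lemma step_grid_value n (phi : nat -> R) s : (0 < n)%N -> 0 <= s <= T -> ~ on_grid n s ->
  \sum_(i < n) phi i * \1_(`]tg n i, tg n i.+1]) s = phi (Num.truncn (s * n%:R / T)).
Proof.
move=> n0 sT sg; have [] := Yn_index T0 n0 sT.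
set j := Num.truncn _ => jn gj sj; have /andP[_ sT'] := sT.
have jltn : (j < n)%N.
  rewrite ltn_neqAle jn andbT; apply/eqP => jE; apply: sg; exists n => //.
  by apply/eqP; rewrite eq_le grid_n// sT' -(grid_n n0)/=; move: gj; rewrite jE.
have gjs : tg n j < s.
  by rewrite lt_neqAle gj andbT; apply/eqP => E; apply: sg; exists j.
rewrite (bigD1 (Ordinal jltn))//= big1 ?addr0.
  by rewrite indicE mem_set ?mulr1//= in_itv/= gjs gridS ltW.
move=> i ij; rewrite indicE memNset ?mulr0//= in_itv/= => /andP[gi si].
have [ij'|ji|E] := ltngtP i j.
- by have := le_lt_trans (le_trans si (grid_le T0 n ij')) gjs; rewrite ltxx.
- have := lt_le_trans sj (_ : tg n j + T / n%:R <= tg n i).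
  by rewrite -gridS (grid_le T0) // ltNge ltW// => /(_ isT).
- by move: ij; rewrite -val_eqE/= E eqxx.
Qed.

End step_grid.

(** * Euler sums of the stochastic integral *)

Section euler_sums.
Context {R : realType} {d : measure_display} {Omega : measurableType d}.
Variables (P : probability Omega R) (T H alpha Y0 : R) (sigma : R -> R).
Variables (smin Csigma q : R) (W B : R -> {RV P >-> R}).
Hypotheses (T0 : 0 < T) (H01 : 2^-1 < H < 1) (alpha0 : 0 < alpha).
Hypotheses (smin0 : 0 < smin) (C0 : 0 < Csigma) (q01 : 0 < q < 1).
Hypothesis sigma_min : forall x, smin <= sigma x.
Hypothesis sigma_growth : forall x, sigma x <= Csigma * (1 + `|x| `^ q).
Hypothesis sigma_cont : continuous sigma.
Hypothesis wienerW : standard_wiener T W.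
Hypothesis fbm : fractional_brownian T H B.
Hypothesis WB_indep : independent_systems P (sigma_process W `[0, T])
                                            (sigma_process B `[0, T]).
Local Notation mu := (@lebesgue_measure R).
Local Notation tg := (grid T).
Local Notation Yg := (Yn_grid T alpha Y0 B).
Local Notation YN := (Yn T alpha Y0 B).
Local Notation V := (int_square T sigma).

(* The index is truncated at n only to make every coefficient past-measurable. *)
Definition euler_coef n i (w : Omega) : R := sigma (Yg n (minn i n) w).

Definition euler_sum n (w : Omega) : R :=
  \sum_(i < n) euler_coef n i w * (W (tg n i.+1) w - W (tg n i) w).

Let sigma_gt0 x : 0 < sigma x. Proof. exact: lt_le_trans (sigma_min x). Qed.

Let measurable_sigma : measurable_fun setT sigma.
Proof. exact: continuous_measurable_fun. Qed.

Lemma past_Yn_grid n i : (0 < n)%N -> (i <= n)%N -> past_measurable T W B 0 (Yg n i).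
Proof.
move=> n0 jn; apply: measurable_funD => //; apply: measurable_funM => //.
apply: measurable_sum => k; apply: measurable_funM => //.
have kn : (k < n)%N by exact: leq_trans (ltn_ord k) jn.
by apply: measurable_funB; apply: past_measurable_noise; apply: grid_itv => //; exact: ltnW.
Qed.

Lemma past_euler_coef n i : (0 < n)%N -> past_measurable T W B 0 (euler_coef n i).
Proof.
move=> n0; apply: (measurableT_comp measurable_sigma).
by apply: past_Yn_grid => //; exact: geq_minr.
Qed.

Lemma past_sqr_euler_coef n i : (0 < n)%N -> past_sqr T W B (tg n i) (euler_coef n i).
Proof.
move=> n0; have mc := past_euler_coef i n0.
have g0 : 0 <= tg n i by rewrite /grid divr_ge0// mulr_ge0// ltW.
split; first exact: past_measurable_mono mc.
pose e := ou_exponent T H alpha; have e0 : 0 < e by exact: ou_exponent_gt0.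
have [c c0 Hc] := sqr_volatility_le C0 q01 (fun x => ltW (sigma_gt0 x)) sigma_growth ler01 e0.
have jn : (minn i n <= n)%N by exact: geq_minr.
have mY := past_measurableW (past_Yn_grid n0 jn).
have mexp : measurable_fun setT (fun w => (expR (e * Yg n (minn i n) w ^+ 2))%:E).
  apply/measurable_EFinP; apply: measurableT_comp => //.
  by apply: measurable_funM => //; exact: measurable_funX.
apply: (@le_lt_trans _ _ (\int[P]_w (c%:E + (expR (e * Yg n (minn i n) w ^+ 2))%:E))%E).
  apply: ge0_le_integral => //.
  - by move=> w _; rewrite lee_fin sqr_ge0.
  - by apply/measurable_EFinP; apply: measurable_funX; exact: past_measurableW mc.
  - exact: emeasurable_funD.
  - move=> w _; rewrite -EFinD lee_fin /euler_coef.
    have := Hc (Yg n (minn i n) w); rewrite mul1r => /le_trans; apply.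
    by rewrite lerD2l; apply: le_trans (expR_ge1Dx _); rewrite lerDr.
rewrite ge0_integralD//.
rewrite integral_cst//= probability_setT mule1 lte_add_pinfty ?ltry//.
exact: le_lt_trans (Yn_grid_exp_sqr Y0 T0 H01 alpha0 fbm n0 jn) (ltry _).
Qed.

Lemma euler_coef_step n s w : (0 < n)%N -> 0 <= s <= T ->
  ~ (exists2 i, (i <= n)%N & s = tg n i) ->
  \sum_(i < n) euler_coef n i w * \1_(`]tg n i, tg n i.+1]) s = sigma (YN n s w).
Proof.
move=> n0 sT sg; rewrite (step_grid_value T0 (euler_coef n ^~ w) n0 sT sg).
by have [jn _ _] := Yn_index T0 n0 sT; rewrite /euler_coef (minn_idPl jn).
Qed.

Let subY n : (0 < n)%N ->
  subgaussian_process P T (ou_exponent T H alpha)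
    (4 * expR (2 * ou_exponent T H alpha * Y0 ^+ 2)) (YN n).
Proof. exact: (subgaussian_Yn Y0 T0 H01 alpha0 fbm). Qed.

Lemma int_square_Yn n w : (0 < n)%N ->
  V (YN n) w = \sum_(i < n) euler_coef n i w ^+ 2 * (tg n i.+1 - tg n i).
Proof.
move=> n0; have sY := subY n0; apply/EFin_inj.
rewrite -(int_squareE T0 smin0 C0 q01 sigma_min sigma_growth sigma_cont w sY).
pose F i s : R := euler_coef n i w ^+ 2 * \1_(`]tg n i, tg n i.+1]) s.
have mF i : measurable_fun setT (F i).
  by apply: measurable_funM => //; exact: measurable_indic.
transitivity (\int[mu]_(s in `[0%R, T]) (\sum_(i < n) F i s)%:E)%E.
  apply: (@integral_off_grid _ T n).
  - exact: (measurable_int _ (integrable_sqr_volatility T0 smin0 C0 q01 sigma_min sigma_growth sigma_cont w sY)).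
  - by apply/measurable_EFinP; apply: measurable_funTS; apply: measurable_sum.
  - move=> s sT sg; rewrite (step_grid_value T0 (fun i => euler_coef n i w ^+ 2) n0 sT sg).
    by have [jn _ _] := Yn_index T0 n0 sT; rewrite /euler_coef (minn_idPl jn).
under eq_integral do rewrite -sumEFin.
rewrite ge0_integral_sum//; last 2 first.
- by move=> i; apply/measurable_EFinP; apply: measurable_funTS; exact: mF.
- by move=> i s _; rewrite lee_fin mulr_ge0 ?sqr_ge0.
rewrite -sumEFin; apply: eq_bigr => i _.
have gT k : (k <= n)%N -> 0 <= tg n k <= T by move=> kn; exact: grid_itv.
have /andP[g0 _] := gT i (ltnW (ltn_ord i)); have /andP[_ gT'] := gT i.+1 (ltn_ord i).
have lt_g : tg n i < tg n i.+1 by rewrite gridS ltrDl divr_gt0 ?ltr0n.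
under eq_integral do rewrite EFinM.
rewrite ge0_integralZl_EFin ?sqr_ge0//; last first.
  by apply/measurable_EFinP; apply: measurable_funTS; exact: measurable_indic.
rewrite integral_indic// setIidl; last first.
  move=> x /=; rewrite !in_itv/= => /andP[gx xg].
  by rewrite (le_trans g0 (ltW gx)) (le_trans xg gT').
rewrite [RHS]EFinM; congr (_ * _)%E.
rewrite -[LHS]/(mu [set` `]tg n i, tg n i.+1]%R]) lebesgue_measure_itv/= lte_fin lt_g.
by rewrite EFinB.
Qed.

End euler_sums.

(** * Rates for the variance and the Euler sums, and the law of the terminal value *)

Section strong_error.
Context {R : realType} {d : measure_display} {Omega : measurableType d}.
Variables (P : probability Omega R) (T H alpha Y0 r : R) (sigma : R -> R).
Variables (smin Csigma q : R) (W B : R -> {RV P >-> R}) (Y : R -> Omega -> R).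
Hypotheses (T0 : 0 < T) (H01 : 2^-1 < H < 1) (alpha0 : 0 < alpha).
Hypotheses (smin0 : 0 < smin) (C0 : 0 < Csigma) (q01 : 0 < q < 1) (r01 : 0 < r <= 1).
Hypothesis sigma_min : forall x, smin <= sigma x.
Hypothesis sigma_growth : forall x, sigma x <= Csigma * (1 + `|x| `^ q).
Hypothesis sigma_holder : forall x y, `|sigma x - sigma y| <= Csigma * `|x - y| `^ r.
Hypothesis sigma_cont : continuous sigma.
Hypothesis wienerW : standard_wiener T W.
Hypothesis fbm : fractional_brownian T H B.
Hypothesis WB_indep : independent_systems P (sigma_process W `[0, T])
                                            (sigma_process B `[0, T]).
Hypothesis YOU : fractional_OU T alpha Y0 B Y.
Local Notation mu := (@lebesgue_measure R).
Local Notation tg := (grid T).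
Local Notation YN := (Yn T alpha Y0 B).
Local Notation V := (int_square T sigma).
Local Notation I_ := (euler_sum T alpha Y0 sigma W B).
Local Notation rate n := (n%:R `^ (- (r * H))).

(** The L^2 scale of Y - Y_n. Its power r is the rate of the theorem. *)
Let rho n : R := n%:R `^ (- H).

Let rho_gt0 n : (0 < n)%N -> 0 < rho n.
Proof. by move=> n0; apply: powR_gt0; rewrite ltr0n. Qed.

Let rho_sqr n : rho n ^+ 2 = n%:R `^ (- (2 * H)).
Proof. by rewrite -powR_mulrn ?powR_ge0// -powRrM mulNr mulrC. Qed.

Let rho_rate n : rho n `^ r = rate n.
Proof. by rewrite -powRrM mulNr mulrC. Qed.

Let rate_gt0 n : (0 < n)%N -> 0 < rate n :> R.
Proof. by move=> n0; apply: powR_gt0; rewrite ltr0n. Qed.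

(** The squared Hoelder bound is made affine in the square of the normalized distance, so that it
    can be integrated with second moments only. *)
Lemma sigma_holder_sqr rh x y : 0 < rh ->
  (sigma x - sigma y) ^+ 2 <= (Csigma * rh `^ r) ^+ 2 * (1 + ((x - y) / rh) ^+ 2).
Proof.
move=> rh0; have /andP[r0 r1] := r01; set a := (x - y) / rh.
have aE : `|x - y| = rh * `|a|.
  by rewrite /a normrM normfV (gtr0_norm rh0) mulrCA mulfV ?mulr1// gt_eqF.
have Ha : (`|a| `^ r) ^+ 2 <= 1 + a ^+ 2.
  have [a1|a1] := leP `|a| 1.
    have h : `|a| `^ r <= 1.
      by have := @ge0_ler_powR R r (ltW r0) `|a| 1; rewrite powR1 !nnegrE; apply.
    by have := powR_ge0 `|a| r; have := sqr_ge0 a; nra.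
  have h : `|a| `^ r <= `|a| by apply: ler1_powR r1; exact: ltW.
  have := powR_ge0 `|a| r; rewrite -(real_normK (num_real a)); nra.
have := sigma_holder x y; rewrite aE powRM ?normr_ge0 ?(ltW rh0)//.
rewrite -(real_normK (num_real (sigma x - sigma y))) mulrA => h.
apply: (@le_trans _ _ ((Csigma * rh `^ r * `|a| `^ r) ^+ 2)).
  by rewrite lerXn2r ?nnegrE// !mulr_ge0 ?powR_ge0// ltW.
by rewrite exprMn ler_wpM2l ?sqr_ge0.
Qed.

Let eps := ou_exponent T H alpha.
Let Keps : R := 4 * expR (2 * eps * Y0 ^+ 2).

Let eps0 : 0 < eps. Proof. exact: ou_exponent_gt0. Qed.

Let subY : subgaussian_process P T eps Keps Y.
Proof. exact: (subgaussian_ou T0 H01 alpha0 fbm YOU). Qed.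

Let subYN n : (0 < n)%N -> subgaussian_process P T eps Keps (YN n).
Proof. exact: (subgaussian_Yn Y0 T0 H01 alpha0 fbm). Qed.

Let mV y : subgaussian_process P T eps Keps y -> measurable_fun setT (V y).
Proof. exact: (measurable_int_square T0 smin0 C0 q01 sigma_min sigma_growth sigma_cont). Qed.

Let V_ge y w : subgaussian_process P T eps Keps y -> smin ^+ 2 * T <= V y w.
Proof. exact: (int_square_ge T0 smin0 C0 q01 sigma_min sigma_growth sigma_cont). Qed.

Lemma ou_error_rho : exists2 D, 0 <= D & forall n s, (0 < n)%N -> 0 <= s <= T ->
  (\int[P]_w ((Y s w - YN n s w) ^+ 2)%:E <= (D * rho n ^+ 2)%:E)%E.
Proof.
have [D D0 HD] := ou_discretization_error T0 H01 alpha0 fbm YOU.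
by exists D => // n s n0 sT; rewrite rho_sqr; exact: HD.
Qed.

Lemma variance_error k : 0 <= k -> exists2 K, 0 <= K & forall n, (0 < n)%N ->
  (\int[P]_w (expR (k * (V Y w + V (YN n) w)) * `|V Y w - V (YN n) w|)%:E <=
   (K * rate n)%:E)%E.
Proof.
move=> k0; have [D D0 HD] := ou_error_rho.
have [K K0 HK] := weighted_variance_difference P T0 smin0 C0 q01 r01 sigma_min
  sigma_growth sigma_holder sigma_cont Keps eps0 D k0.
exists K => // n n0; rewrite -rho_rate.
exact: (HK Y (YN n) (rho n) subY (subYN n0) (rho_gt0 n0) (fun s sT => HD n s n0 sT)).
Qed.

Lemma euler_error (Z : Omega -> R) : measurable_fun setT Z ->
  is_ito_integral P (natural_filtration W B) W (fun s w => sigma (Y s w)) T Z ->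
  exists2 K, 0 <= K & forall n, (0 < n)%N ->
  (\int[P]_w ((Z w - I_ n w) ^+ 2)%:E <= (K * rate n ^+ 2)%:E)%E.
Proof.
move=> mZ itoZ; have [D D0 HD] := ou_error_rho.
have msig : measurable_fun setT sigma by exact: continuous_measurable_fun.
exists (4 * (T * (Csigma ^+ 2 * (1 + D)))) => [|n n0].
  by rewrite !mulr_ge0 ?sqr_ge0 ?addr_ge0// ltW.
have [mY _ _] := subY; have [mYN _ _] := subYN n0.
have msY := jointly_measurable_comp msig mY; have msYN := jointly_measurable_comp msig mYN.
have gT k : (k <= n)%N -> 0 <= tg n k <= T by move=> kn; exact: grid_itv.
have step i : (i < n)%N -> [/\ 0 <= tg n i, tg n i <= tg n i.+1, tg n i.+1 <= T &
    past_sqr T W B (tg n i) (euler_coef T alpha Y0 sigma B n i)].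
  move=> ilt; have /andP[g0 _] := gT i (ltnW ilt); have /andP[_ gT'] := gT i.+1 ilt.
  split=> //; first exact: grid_le.
  exact: (past_sqr_euler_coef Y0 W T0 H01 alpha0 smin0 C0 q01 sigma_min sigma_growth sigma_cont fbm).
apply: le_trans (ito_step_error T0 wienerW WB_indep itoZ msY mZ step) _.
have mcoef i : (i < n)%N -> measurable_fun setT (euler_coef T alpha Y0 sigma B n i).
  by move=> /step[_ _ _ [/past_measurableW]].
have mstep := jointly_measurable_step T (tg n) (fun i => tg n i.+1) mcoef.
have -> : (fun w => \int[mu]_(x in `[0%R, T]) ((sigma (Y x w) -
    \sum_(i < n) euler_coef T alpha Y0 sigma B n i w * \1_(`]tg n i, tg n i.+1]) x) ^+ 2)%:E)%E =
  (fun w => \int[mu]_(x in `[0%R, T]) ((sigma (Y x w) - sigma (YN n x w)) ^+ 2)%:E)%E.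
  apply/funext => w; apply: (@integral_off_grid _ T n).
  - apply/measurable_EFinP.
    exact: (jointly_measurable_path w (jointly_measurableX 2 (jointly_measurableB msY mstep))).
  - apply/measurable_EFinP.
    exact: (jointly_measurable_path w (jointly_measurableX 2 (jointly_measurableB msY msYN))).
  - by move=> s sT sg; rewrite euler_coef_step.
rewrite -mulrA EFinM lee_wpmul2l// -mulrA.
apply: integral_process_le => //.
- exact: (jointly_measurableX 2 (jointly_measurableB msY msYN)).
- by move=> s w _; exact: sqr_ge0.
move=> s sT.
have mYs := jointly_measurable_section sT mY; have mYNs := jointly_measurable_section sT mYN.
pose A := (Csigma * rho n `^ r) ^+ 2.
have A0 : 0 <= A by exact: sqr_ge0.
have msq : measurable_fun setT (fun w => (((Y s w - YN n s w) / rho n) ^+ 2)%:E).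
  by apply/measurable_EFinP; apply: measurable_funX; apply: measurable_funM => //; exact: measurable_funB.
apply: (@le_trans _ _ (\int[P]_w (A%:E * (1 + (((Y s w - YN n s w) / rho n) ^+ 2)%:E)))%E).
  apply: ge0_le_integral => //.
  - by move=> w _; rewrite lee_fin sqr_ge0.
  - apply/measurable_EFinP; apply: measurable_funX; apply: measurable_funB;
      exact: (measurableT_comp msig).
  - by apply: emeasurable_funM => //; exact: emeasurable_funD.
  - by move=> w _; rewrite -EFinD -EFinM lee_fin; apply: sigma_holder_sqr; exact: rho_gt0.
rewrite ge0_integralZl//; last 2 first.
- exact: emeasurable_funD.
- by move=> w _; rewrite adde_ge0// lee_fin sqr_ge0.
rewrite ge0_integralD//; last by move=> w _; rewrite lee_fin sqr_ge0.
rewrite integral_cst//= probability_setT mule1.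
have -> : Csigma ^+ 2 * (1 + D) * rate n ^+ 2 = A * (1 + D).
  by rewrite /A rho_rate; ring.
rewrite [leRHS]EFinM lee_wpmul2l ?lee_fin// EFinD leeD2l//.
have -> : D = (rho n)^-1 ^+ 2 * (D * rho n ^+ 2).
  by rewrite mulrCA -exprMn mulVf ?expr1n ?mulr1// gt_eqF// rho_gt0.
under eq_integral do rewrite mulrC.
by apply: integral_sqrZ_le; [exact: measurable_funB|exact: HD].
Qed.


Lemma ge0_integral_le_add (f g : Omega -> \bar R) (e : Omega -> R) (K : R) :
  measurable_fun setT f -> measurable_fun setT g -> measurable_fun setT e ->
  (forall w, 0 <= f w)%E -> (forall w, 0 <= g w)%E -> (forall w, 0 <= e w) ->
  (forall w, f w <= g w + (e w)%:E)%E -> (\int[P]_w (e w)%:E <= K%:E)%E ->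
  (\int[P]_w f w <= \int[P]_w g w + K%:E)%E.
Proof.
move=> mf mg me f0 g0 e0 fge eK.
have me' : measurable_fun setT (fun w => (e w)%:E) by exact/measurable_EFinP.
apply: (@le_trans _ _ (\int[P]_w (g w + (e w)%:E))%E).
  apply: ge0_le_integral => //.
  exact: emeasurable_funD.
by rewrite ge0_integralD//; [rewrite leeD2l|move=> w _; rewrite lee_fin].
Qed.

Lemma measurable_lognormal_mean (h : R -> R) m (U : Omega -> R) :
  measurable_fun setT h -> (forall x, 0 <= h x) -> measurable_fun setT U ->
  (forall w, 0 < U w) -> measurable_fun setT (fun w => lognormal_mean h m (U w)).
Proof.
move=> mh h0 mU U0.
apply: (@measurable_fun_fubini_tonelli_F _ _ _ _ _ mu
  (fun p : Omega * R => (h p.2 * lognormal_pdf m (U p.1) p.2)%:E)).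
  apply/measurable_EFinP; apply: measurable_funM.
    by apply: (measurableT_comp mh); exact: measurable_snd.
  by apply: measurable_lognormal_pdf => //; exact: (measurableT_comp mU).
by move=> p; rewrite lee_fin mulr_ge0// lognormal_pdf_ge0.
Qed.

Let vmin : R := smin ^+ 2 * T.

Let vmin0 : 0 < vmin. Proof. by rewrite mulr_gt0// exprn_gt0. Qed.

(** The estimate is split into finiteness and two one-sided inequalities so as to avoid subtraction
    in the extended reals. It serves twice: with h = g for the theorem, and with h a ramp to
    identify the law of the terminal value. *)
Lemma lognormal_mean_error (h : R -> R) m C a :
  measurable_fun setT h -> (forall x, 0 <= h x) -> 0 <= a -> 0 <= C ->
  (forall x, h x <= C * (expR (a * (x - m)) + expR (- a * (x - m)))) ->
  exists2 K, 0 <= K & forall n, (0 < n)%N ->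
  [/\ (\int[P]_w lognormal_mean h m (V Y w))%E \is a fin_num,
      (\int[P]_w lognormal_mean h m (V (YN n) w))%E \is a fin_num,
      (\int[P]_w lognormal_mean h m (V Y w) <=
       \int[P]_w lognormal_mean h m (V (YN n) w) + (K * rate n)%:E)%E &
      (\int[P]_w lognormal_mean h m (V (YN n) w) <=
       \int[P]_w lognormal_mean h m (V Y w) + (K * rate n)%:E)%E].
Proof.
move=> mh h0 a0 C0' hC.
have mean0 v : (0 <= lognormal_mean h m v)%E.
  by apply: integral_ge0 => x _; rewrite lee_fin mulr_ge0// lognormal_pdf_ge0.
have [K1 [k1 [K10 k10 H1]]] := lognormal_mean_growth mh h0 vmin0 a0 C0' hC.
have [K2 [k2 [K20 k20 H2]]] := lognormal_mean_lip mh h0 vmin0 a0 C0' hC.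
have [K3 K30 H3] := variance_error k20.
have [K4 K40 H4] := exp_int_square P T0 smin0 C0 q01 sigma_min sigma_growth sigma_cont Keps eps0 k10.
have mmean y : subgaussian_process P T eps Keps y ->
    measurable_fun setT (fun w => lognormal_mean h m (V y w)).
  move=> sy; apply: measurable_lognormal_mean => //; first exact: mV.
  by move=> w; exact: lt_le_trans (V_ge w sy).
have meanfin y w : subgaussian_process P T eps Keps y ->
    lognormal_mean h m (V y w) \is a fin_num.
  move=> sy; rewrite ge0_fin_numE//; apply: le_lt_trans (H1 _ (V_ge w sy)) _.
  exact: ltry.
have ifin y : subgaussian_process P T eps Keps y ->
    (\int[P]_w lognormal_mean h m (V y w))%E \is a fin_num.
  move=> sy; have mexp : measurable_fun setT (fun w => (expR (k1 * V y w))%:E).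
    apply/measurable_EFinP; apply: measurableT_comp => //.
    by apply: measurable_funM => //; exact: mV.
  rewrite ge0_fin_numE; last exact: integral_ge0.
  apply: (@le_lt_trans _ _ (\int[P]_w (K1%:E * (expR (k1 * V y w))%:E))%E).
    apply: ge0_le_integral => //.
    - exact: mmean.
    - exact: emeasurable_funM.
    - by move=> w _; rewrite -EFinM; apply: H1; exact: V_ge.
  rewrite ge0_integralZl_EFin//.
  by rewrite lte_mul_pinfty// ?lee_fin//; apply: le_lt_trans (H4 y sy) _; exact: ltry.
exists (K2 * K3); first by rewrite mulr_ge0.
move=> n n0; have sYN := subYN n0.
pose e w := `|V Y w - V (YN n) w| * (K2 * expR (k2 * (V Y w + V (YN n) w))).
have e0 w : 0 <= e w by rewrite !mulr_ge0 ?expR_ge0.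
have mVY := mV subY; have mVYN := mV sYN.
have mwd : measurable_fun setT (fun w => (expR (k2 * (V Y w + V (YN n) w)) * `|V Y w - V (YN n) w|)%:E).
  apply/measurable_EFinP; apply: measurable_funM.
    by apply: measurableT_comp => //; apply: measurable_funM => //; exact: measurable_funD.
  by apply: measurableT_comp => //; exact: measurable_funB.
have eE w : (e w)%:E = (K2%:E * (expR (k2 * (V Y w + V (YN n) w)) * `|V Y w - V (YN n) w|)%:E)%E.
  by rewrite -EFinM /e; congr EFin; ring.
have me : measurable_fun setT e.
  apply/measurable_EFinP; rewrite (_ : EFin \o e = fun w => (K2%:E *
    (expR (k2 * (V Y w + V (YN n) w)) * `|V Y w - V (YN n) w|)%:E)%E).
    exact: emeasurable_funM.
  by apply/funext => w; exact: eE.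
have eK : (\int[P]_w (e w)%:E <= (K2 * K3 * rate n)%:E)%E.
  under eq_integral do rewrite eE.
  rewrite ge0_integralZl_EFin//.
  by rewrite -mulrA EFinM lee_wpmul2l// H3.
have lip w : (`|lognormal_mean h m (V Y w) - lognormal_mean h m (V (YN n) w)| <= (e w)%:E)%E.
  by apply: H2; exact: V_ge.
have dist_le (x y : \bar R) (z : R) : x \is a fin_num -> y \is a fin_num ->
    (`|x - y| <= z%:E -> x <= y + z%:E /\ y <= x + z%:E)%E.
  case: x y => [x||] [y||]// _ _; rewrite -EFinB abse_EFin -!EFinD !lee_fin ler_norml.
  by move=> /andP[zx xz]; split; lra.
have [f1 f2] := (ifin _ subY, ifin _ sYN).
pose x w := lognormal_mean h m (V Y w).
pose y w := lognormal_mean h m (V (YN n) w).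
have near w : (x w <= y w + (e w)%:E /\ y w <= x w + (e w)%:E)%E.
  exact: (dist_le (x w) (y w) (e w) (meanfin _ w subY) (meanfin _ w sYN) (lip w)).
have le1 w : (x w <= y w + (e w)%:E)%E := proj1 (near w).
have le2 w : (y w <= x w + (e w)%:E)%E := proj2 (near w).
have [mx my] := (mmean _ subY, mmean _ sYN).
have x0 w : (0 <= x w)%E := mean0 _.
have y0 w : (0 <= y w)%E := mean0 _.
split=> //.
- exact: (ge0_integral_le_add mx my me x0 y0 e0 le1 eK).
- exact: (ge0_integral_le_add my mx me y0 x0 e0 le2 eK).
Qed.

Let rate_small K e : 0 <= K -> 0 < e -> exists2 n, (0 < n)%N & K * rate n <= e.
Proof.
move=> K0 e0; have a0 : 0 < r * H.
  by case/andP: r01 => r0 _; case/andP: H01 => H0 _; rewrite mulr_gt0// (lt_trans _ H0).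
set a := r * H in a0 *; pose M := K / e.
have M0 : 0 <= M by rewrite divr_ge0// ltW.
(* With n above (K / e)^(1 / a), the power n^a exceeds K / e. *)
pose n := (Num.truncn (M `^ a^-1)).+1; exists n => //.
have nM : M <= n%:R `^ a.
  have -> : M = (M `^ a^-1) `^ a by rewrite -powRrM mulVf ?gt_eqF// powRr1.
  rewrite ge0_ler_powR ?nnegrE ?powR_ge0 ?(ltW a0)//.
  by have /andP[_ /ltW] := truncn_itv (powR_ge0 M a^-1).
rewrite powRN -ler_pdivlMr ?invr_gt0 ?powR_gt0 ?ltr0n// invrK mulrC.
by move: nM; rewrite /M ler_pdivrMr.
Qed.

Let measurable_euler_sum n : (0 < n)%N -> measurable_fun setT (I_ n).
Proof.
move=> n0; apply: (@measurable_wiener_sum _ _ _ _ _ n (tg n) (fun i => tg n i.+1)) => i _.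
exact: past_measurableW (past_euler_coef alpha Y0 (W := W) (B := B) T0 sigma_cont i n0).
Qed.

Lemma integral_log_euler n m (h : R -> R) : (0 < n)%N -> continuous h -> (forall x, 0 <= h x) ->
  (\int[P]_w (h (m - V (YN n) w / 2 + I_ n w))%:E =
   \int[P]_w lognormal_mean h m (V (YN n) w))%E.
Proof.
move=> n0 ch h0.
have VE w := int_square_Yn Y0 T0 H01 alpha0 smin0 C0 q01 sigma_min sigma_growth sigma_cont fbm w n0.
have mc i : past_measurable T W B 0 (euler_coef T alpha Y0 sigma B n i).
  exact: past_euler_coef.
have mM : past_measurable T W B 0 (fun w => m - V (YN n) w / 2).
  rewrite (_ : (fun w => _) = (fun w => m - (\sum_(i < n)
    euler_coef T alpha Y0 sigma B n i w ^+ 2 * (tg n i.+1 - tg n i)) / 2)); last first.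
    by apply/funext => w; rewrite VE.
  apply: measurable_funB => //; apply: measurable_funM => //.
  apply: measurable_sum => i; apply: measurable_funM => //.
  apply: measurable_funX; exact: mc.
have u_incr i : tg n i < tg n i.+1 by rewrite gridS ltrDl divr_gt0 ?ltr0n.
have g0 : 0 <= tg n 0 by rewrite /grid !mul0r.
have gT : tg n n <= T by rewrite grid_n.
have c_gt0 i w : 0 < euler_coef T alpha Y0 sigma B n i w.
  exact: lt_le_trans (sigma_min _).
rewrite (integral_normal_sum wienerW WB_indep g0 gT u_incr mc c_gt0 n0 mM ch h0).
by apply: eq_integral => w _; rewrite /lognormal_mean /lognormal_pdf VE.
Qed.

Section terminal.
Variables (Z : Omega -> R) (m : R).
Hypothesis mZ : measurable_fun setT Z.
Hypothesis itoZ :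
  is_ito_integral P (natural_filtration W B) W (fun s w => sigma (Y s w)) T Z.

Let X w := m - V Y w / 2 + Z w.

Let mX : measurable_fun setT X.
Proof.
apply: measurable_funD => //; apply: measurable_funB => //.
by apply: measurable_funM => //; exact: mV.
Qed.

(** The first moment of z = Z - I_n follows from its second moment, of order eta^2, through |z| <=
    z^2 / eta + eta, with eta the rate itself. The variance term is [variance_error] with weight 1,
    that is k = 0. *)
Lemma integral_euler_dist : exists2 K, 0 <= K & forall n, (0 < n)%N ->
  (\int[P]_w (`|Z w - I_ n w| + `|V Y w - V (YN n) w|)%:E <= (K * rate n)%:E)%E.
Proof.
have [K1 K10 H1] := euler_error mZ itoZ; have [K2 K20 H2] := variance_error (lexx 0).
exists (K1 + 1 + K2) => [|n n0]; first by rewrite !addr_ge0.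
have eta0 := rate_gt0 n0; set eta : R := rate n in eta0 *.
have mVd : measurable_fun setT (fun w => V Y w - V (YN n) w).
  by apply: measurable_funB; apply: mV; [exact: subY|exact: subYN].
have mI := measurable_euler_sum n0.
have mZI : measurable_fun setT (fun w => Z w - I_ n w) by exact: measurable_funB.
pose e w : \bar R := (eta^-1%:E * ((Z w - I_ n w) ^+ 2)%:E + eta%:E +
   (expR (0 * (V Y w + V (YN n) w)) * `|V Y w - V (YN n) w|)%:E)%E.
have msq : measurable_fun setT (fun w => ((Z w - I_ n w) ^+ 2)%:E).
  by apply/measurable_EFinP; exact: measurable_funX.
have mabs : measurable_fun setT
    (fun w => (expR (0 * (V Y w + V (YN n) w)) * `|V Y w - V (YN n) w|)%:E).
  rewrite (_ : (fun w => _) = fun w => (`|V Y w - V (YN n) w|)%:E).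
    by apply/measurable_EFinP; apply: measurableT_comp.
  by apply/funext => w; rewrite mul0r expR0 mul1r.
have eta0' : (0 <= eta%:E)%E by rewrite lee_fin ltW.
have sq0 w : (0 <= eta^-1%:E * ((Z w - I_ n w) ^+ 2)%:E)%E.
  by rewrite mule_ge0// lee_fin ?sqr_ge0// invr_ge0 ltW.
apply: (@le_trans _ _ (\int[P]_w e w)%E).
  apply: ge0_le_integral => //.
  - by apply/measurable_EFinP; apply: measurable_funD; apply: measurableT_comp.
  - by do 2 apply: emeasurable_funD => //; exact: emeasurable_funM.
  - move=> w _; rewrite /e mul0r expR0 mul1r -EFinM -!EFinD lee_fin lerD2r.
    set z := Z w - I_ n w.
    have h : eta * `|z| <= z ^+ 2 + eta ^+ 2.
      by rewrite -(real_normK (num_real z)); have := sqr_ge0 (`|z| - eta); have := normr_ge0 z; nra.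
    have -> : eta^-1 * z ^+ 2 + eta = (z ^+ 2 + eta ^+ 2) / eta.
      by field; rewrite gt_eqF.
    by rewrite ler_pdivlMr// mulrC.
rewrite ge0_integralD//; last 2 first.
- by move=> w _; exact: adde_ge0.
- by apply: emeasurable_funD => //; exact: emeasurable_funM.
rewrite !mulrDl EFinD; apply: leeD; last exact: H2.
rewrite ge0_integralD//; last exact: emeasurable_funM.
rewrite integral_cst//= probability_setT mule1 mul1r EFinD leeD2r//.
rewrite ge0_integralZl_EFin ?invr_ge0 ?(ltW eta0)//; last first.
  by move=> w _; rewrite lee_fin sqr_ge0.
have -> : K1 * eta = eta^-1 * (K1 * eta ^+ 2) by field; rewrite gt_eqF.
by rewrite [leRHS]EFinM lee_wpmul2l ?lee_fin ?invr_ge0 ?(ltW eta0)// H1.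
Qed.

(** A ramp is Lipschitz, so replacing X by its Euler version costs a multiple of the rate. For the
    Euler version the identity is exact, and returning from V (Y_n) to V Y costs the rate again.
    Both errors are made smaller than any e > 0 by the choice of n. *)
Let integral_ramp c k :
  (\int[P]_w (ramp c k (X w))%:E = \int[P]_w lognormal_mean (ramp c k) m (V Y w))%E.
Proof.
have [K1 K10 H1] := integral_euler_dist.
have mr : measurable_fun setT (ramp c k).
  by apply: continuous_measurable_fun; exact: continuous_ramp.
have bnd x : ramp c k x <= 1 * (expR (0 * (x - m)) + expR (- 0 * (x - m))).
  rewrite oppr0 mul0r expR0 mul1r; apply: le_trans (ramp_le1 _ _ _) _.
  by rewrite lerDl.
have [K2 K20 H2] := lognormal_mean_error mr (ramp_ge0 c k) (lexx 0) ler01 bnd.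
pose L : R := k.+1%:R.
have dist n : (0 < n)%N ->
    (\int[P]_w (ramp c k (X w))%:E <=
      \int[P]_w (ramp c k (m - V (YN n) w / 2 + I_ n w)%R)%:E + (L * K1 * rate n)%:E)%E /\
    (\int[P]_w (ramp c k (m - V (YN n) w / 2 + I_ n w)%R)%:E <=
      \int[P]_w (ramp c k (X w))%:E + (L * K1 * rate n)%:E)%E.
  move=> n0; pose Xn w := m - V (YN n) w / 2 + I_ n w.
  pose e w := L * (`|Z w - I_ n w| + `|V Y w - V (YN n) w|).
  have mI := measurable_euler_sum n0.
  have mVY := mV subY; have mVN := mV (subYN n0).
  have mXn : measurable_fun setT Xn.
    apply: measurable_funD => //; apply: measurable_funB => //.
    exact: measurable_funM.
  have mD : measurable_fun setT (fun w => `|Z w - I_ n w| + `|V Y w - V (YN n) w|).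
    by apply: measurable_funD; apply: measurableT_comp => //; exact: measurable_funB.
  have me : measurable_fun setT e by exact: measurable_funM.
  have e0 w : 0 <= e w by rewrite mulr_ge0 ?addr_ge0.
  have eK : (\int[P]_w (e w)%:E <= (L * K1 * rate n)%:E)%E.
    under eq_integral do rewrite EFinM.
    rewrite ge0_integralZl_EFin//; last exact/measurable_EFinP.
    by rewrite -mulrA EFinM lee_wpmul2l ?lee_fin// H1.
  have XXn w : `|X w - Xn w| <= `|Z w - I_ n w| + `|V Y w - V (YN n) w|.
    have -> : X w - Xn w = (Z w - I_ n w) - 2^-1 * (V Y w - V (YN n) w).
      by rewrite /X /Xn; ring.
    apply: le_trans (ler_normB _ _) _; rewrite lerD2l normrM ger0_norm ?invr_ge0//.
    by rewrite ler_piMl// invf_le1// ler1n.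
  have lip w : `|ramp c k (X w) - ramp c k (Xn w)| <= e w.
    by apply: le_trans (ramp_lip _ _ _ _) _; rewrite ler_wpM2l.
  have mrX : measurable_fun setT (fun w => (ramp c k (X w))%:E).
    by apply/measurable_EFinP; exact: (measurableT_comp mr).
  have mrXn : measurable_fun setT (fun w => (ramp c k (Xn w))%:E).
    by apply/measurable_EFinP; exact: (measurableT_comp mr).
  have r0 (U : Omega -> R) w : (0 <= (ramp c k (U w))%:E)%E by rewrite lee_fin ramp_ge0.
  have le1 w : ((ramp c k (X w))%:E <= (ramp c k (Xn w))%:E + (e w)%:E)%E.
    by rewrite -EFinD lee_fin; move: (lip w); rewrite ler_norml; lra.
  have le2 w : ((ramp c k (Xn w))%:E <= (ramp c k (X w))%:E + (e w)%:E)%E.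
    by rewrite -EFinD lee_fin; move: (lip w); rewrite ler_norml; lra.
  split; first exact: (ge0_integral_le_add mrX mrXn me (r0 X) (r0 Xn) e0 le1 eK).
  exact: (ge0_integral_le_add mrXn mrX me (r0 Xn) (r0 X) e0 le2 eK).
have K0 : 0 <= L * K1 + K2 by rewrite addr_ge0// mulr_ge0.
apply/eqP; rewrite eq_le; apply/andP; split; apply/lee_addgt0Pr => e e0.
- have [n n0 nK] := rate_small K0 e0; have [d1 _] := dist n n0.
  have [_ _ _ d2] := H2 n n0.
  apply: le_trans d1 _; rewrite integral_log_euler//; last first.
  + by move=> x; exact: ramp_ge0.
  + exact: continuous_ramp.
  apply: le_trans (leeD2r _ d2) _; rewrite -addeA leeD2l// -EFinD lee_fin.
  by rewrite -mulrDl addrC.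
- have [n n0 nK] := rate_small K0 e0; have [_ d1] := dist n n0.
  have [_ _ d2 _] := H2 n n0.
  apply: le_trans d2 _.
  rewrite -(integral_log_euler m n0 (@continuous_ramp _ c k) (ramp_ge0 c k)).
  apply: le_trans (leeD2r _ d1) _; rewrite -addeA leeD2l// -EFinD lee_fin.
  by rewrite -mulrDl.
Qed.


(** The candidate density of X is the mean over B of the conditional normal densities. By Tonelli's
    theorem the identity on ramps says that X and this density integrate ramps alike, hence every
    nonnegative measurable g. *)
Lemma terminal_law (g : R -> R) : measurable_fun setT g -> (forall x, 0 <= g x) ->
  (\int[P]_w (g (X w))%:E = \int[P]_w lognormal_mean g m (V Y w))%E.
Proof.
move=> mg g0; have mVY := mV subY.
have V0 w : 0 < V Y w by exact: lt_le_trans (V_ge w subY).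
pose M w := m - V Y w / 2.
have mM : measurable_fun setT M by apply: measurable_funB => //; exact: measurable_funM.
have mpdf x : measurable_fun setT (fun w => (normal_pdf (M w) (Num.sqrt (V Y w)) x)%:E).
  by apply/measurable_EFinP; exact: measurable_normal_pdf_sqrt.
have pdf0 w x : 0 <= normal_pdf (M w) (Num.sqrt (V Y w)) x by exact: normal_pdf_ge0.
pose Q x := (\int[P]_w (normal_pdf (M w) (Num.sqrt (V Y w)) x)%:E)%E.
have Q0 x : (0 <= Q x)%E by apply: integral_ge0 => w _; rewrite lee_fin.
(* The lower bound on the variance bounds all conditional densities uniformly, so that their mean is
   a finite real at every x. *)
pose ub : R := (Num.sqrt vmin)^-1 / Num.sqrt (2 * pi).
have pdf_le w x : normal_pdf (M w) (Num.sqrt (V Y w)) x <= ub.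
  rewrite normal_pdf_expE ?sqrtr_gt0// -[leRHS]mulr1; apply: ler_pM => //.
  - rewrite /ub ler_wpM2r ?invr_ge0 ?sqrtr_ge0// lef_pV2 ?posrE ?sqrtr_gt0//.
    by rewrite ler_wsqrtr// V_ge.
  - rewrite -expR0 ler_expR oppr_le0; apply: divr_ge0; first exact: sqr_ge0.
    by apply: mulr_ge0 => //; exact: sqr_ge0.
have Qfin x : Q x \is a fin_num.
  rewrite ge0_fin_numE//; apply: (@le_lt_trans _ _ (\int[P]_w ub%:E)%E).
    by apply: ge0_le_integral => // w _; rewrite lee_fin.
  by rewrite integral_cst//= probability_setT mule1 ltry.
pose q' x := fine (Q x).
have q'E x : (q' x)%:E = Q x by rewrite fineK.
have q'0 x : 0 <= q' x by rewrite fine_ge0.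
have mQ : measurable_fun setT Q.
  apply: (@measurable_fun_fubini_tonelli_G _ _ _ _ _ P
    (fun p : Omega * R => (normal_pdf (M p.1) (Num.sqrt (V Y p.1)) p.2)%:E)).
    apply/measurable_EFinP; apply: measurable_normal_pdf_sqrt => //.
    - exact: (measurableT_comp mM).
    - exact: (measurableT_comp mVY).
  by move=> p; rewrite lee_fin.
have mq' : measurable_fun setT q'.
  by apply/measurable_EFinP; rewrite (_ : EFin \o q' = Q)//; apply/funext => x; exact: q'E.
have fub (h : R -> R) : measurable_fun setT h -> (forall x, 0 <= h x) ->
    (\int[P]_w lognormal_mean h m (V Y w) = \int[mu]_x ((h x)%:E * (q' x)%:E))%E.
  move=> mh h0; rewrite /lognormal_mean /lognormal_pdf (fubini_normal_pdf P mh h0 mM mVY V0).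
  by apply: eq_integral => x _; rewrite q'E.
have q'1 : (\int[mu]_x (q' x)%:E = 1)%E.
  have := fub (cst 1) (measurable_cst _) (fun=> ler01).
  rewrite (eq_integral (fun=> 1%E)) => [|w _]; last first.
    rewrite /lognormal_mean; under eq_integral do rewrite mul1r.
    by rewrite integral_normal_pdf// gt_eqF// sqrtr_gt0.
  rewrite integral_cst//= probability_setT mule1 => ->.
  by apply: eq_integral => x _; rewrite mul1e.
have rampE c k : (\int[P]_w (ramp c k (X w))%:E = \int[mu]_x (ramp c k x * q' x)%:E)%E.
  rewrite integral_ramp fub//; last exact: ramp_ge0.
  by apply: continuous_measurable_fun; exact: continuous_ramp.
have mgE : measurable_fun setT (fun x => (g x)%:E) by exact/measurable_EFinP.
by rewrite (ge0_integral_of_ramps mX mq' q'0 q'1 rampE mgE) ?fub.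
Qed.

End terminal.

End strong_error.

(** * The approximating integral as an expected Gaussian mean *)

Section expected_gauss_kernel.
Context {R : realType} {d : measure_display} {Omega : measurableType d}.
Variables (P : probability Omega R) (g : R -> R) (m0 C a v0 : R) (U : Omega -> R).
Hypotheses (mg : measurable_fun setT g) (g0 : forall x, 0 <= g x).
Hypotheses (a0 : 0 <= a) (C0 : 0 <= C) (v00 : 0 < v0).
Hypothesis gC : forall x, g x <= C * (expR (a * (x - m0)) + expR (- a * (x - m0))).
Hypotheses (mU : measurable_fun setT U) (U_ge : forall w, v0 <= U w).
Hypothesis expU : forall k, 0 <= k -> (\int[P]_w (expR (k * U w))%:E < +oo)%E.
Local Notation mu := (@lebesgue_measure R).
Local Notation G := (primitive0 g).

Let kern w x : R := gauss_kernel (m0 - U w / 2) (Num.sqrt (U w)) x.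

Let U_gt0 w : 0 < U w. Proof. exact: lt_le_trans (U_ge w). Qed.

Let sqrt2pi_gt0 : 0 < Num.sqrt (2 * pi) :> R.
Proof. by rewrite sqrtr_gt0 mulr_gt0// pi_gt0. Qed.

Lemma gauss_primitive_lognormal v x : 0 < v ->
  gauss_primitive (m0 - v / 2) (Num.sqrt v) x = Num.sqrt (2 * pi) * lognormal_pdf m0 v x.
Proof.
move=> v_gt0; rewrite /lognormal_pdf normal_pdf_expE ?sqrtr_gt0// /gauss_primitive.
by rewrite [RHS]mulrA; congr (_ * _); rewrite mulrC divfK// gt_eqF.
Qed.

(** Expressing the kernel through [lognormal_pdf] reduces its joint measurability to the one already
    proved. *)
Let kernE w x : kern w x =
  (x - m0 + U w / 2) * (expR (- ln (U w)) * (Num.sqrt (2 * pi) * lognormal_pdf m0 (U w) x)).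
Proof.
rewrite expRN lnK ?posrE// -gauss_primitive_lognormal// /kern /gauss_kernel /gauss_primitive.
have s0 : Num.sqrt (U w) != 0 by rewrite gt_eqF// sqrtr_gt0.
rewrite -[in (U w)^-1](sqr_sqrtr (ltW (U_gt0 w))).
set s := Num.sqrt (U w) in s0 *; set e := expR _.
by rewrite opprB addrA; field.
Qed.

Let mkern d' (T' : measurableType d') (W : T' -> Omega) (X : T' -> R) :
  measurable_fun setT W -> measurable_fun setT X ->
  measurable_fun setT (fun p => kern (W p) (X p)).
Proof.
move=> mW mX.
have mUW : measurable_fun setT (fun p => U (W p)) by exact: (measurableT_comp mU).
rewrite (_ : (fun p => _) = fun p => (X p - m0 + U (W p) / 2) *
  (expR (- ln (U (W p))) * (Num.sqrt (2 * pi) * lognormal_pdf m0 (U (W p)) (X p)))); last first.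
  by apply/funext => p; exact: kernE.
apply: measurable_funM.
  apply: measurable_funD; first exact: measurable_funB.
  exact: measurable_funM.
apply: measurable_funM.
  apply: measurableT_comp => //; apply: measurable_funN.
  by apply: measurableT_comp => //; exact: measurable_ln.
by apply: measurable_funM => //; apply: measurable_lognormal_pdf.
Qed.

(** With t = (x - m) / s the kernel is t exp (- t^2 / 2) / U, and |t| <= 1 + t^2 / 2 <= exp (t^2 /
    2). The mean of the kernel is thus finite at every x, which permits moving G x inside the
    expectation. *)
Let kern_bounded w x : `|kern w x| <= v0^-1.
Proof.
rewrite /kern /gauss_kernel; set m := m0 - _; set s := Num.sqrt (U w).
have s0 : 0 < s by rewrite sqrtr_gt0.
have s2 : s ^+ 2 = U w by rewrite sqr_sqrtr// ltW.
pose t := (x - m) / s.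
have -> : (x - m) / s ^+ 3 * expR (- ((x - m) ^+ 2 / (2 * s ^+ 2))) =
    (U w)^-1 * (t * expR (- (t ^+ 2 / 2))).
  rewrite -s2 /t; have -> : ((x - m) / s) ^+ 2 / 2 = (x - m) ^+ 2 / (2 * s ^+ 2).
    by field; rewrite gt_eqF.
  by field; rewrite gt_eqF.
rewrite normrM gtr0_norm ?invr_gt0// -[leRHS]mulr1; apply: ler_pM => //.
- by rewrite invr_ge0 ltW.
- by rewrite lef_pV2 ?posrE.
rewrite normrM (ger0_norm (expR_ge0 _)) expRN ler_pdivrMr ?expR_gt0// mul1r.
apply: le_trans (expR_ge1Dx _).
by rewrite -(real_normK (num_real t)); have := sqr_ge0 (`|t| - 1); nra.
Qed.

(** Fubini's theorem puts the expectation outside, and for each outcome integration by parts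
    replaces G and the kernel by g and the normal density. Integrability on the product combines
    [primitive0_gauss_growth] with the exponential moments of U. *)
Lemma integral_primitive_gauss_kernel :
  (\int[mu]_x ((G x)%:E * \int[P]_w (kern w x)%:E) =
   (Num.sqrt (2 * pi))%:E * \int[P]_w lognormal_mean g m0 (U w))%E.
Proof.
have mG := measurable_primitive0 mg g0 a0 C0 gC.
have [K [k [K0 k0 HK]]] := primitive0_gauss_growth mg g0 a0 C0 gC v00.
pose F (p : Omega * R) : \bar R := (G p.2 * kern p.1 p.2)%:E.
have mF : measurable_fun setT F.
  apply/measurable_EFinP; apply: measurable_funM; last exact: (mkern measurable_fst measurable_snd).
  exact: (measurableT_comp mG).
have Gk w : (\int[mu]_x (`|G x * kern w x|)%:E <= (K * expR (k * U w))%:E)%E.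
  exact: HK.
have mGk w : measurable_fun setT (fun x => G x * kern w x).
  by apply: measurable_funM => //; apply: (mkern (W := cst w)).
have IF : (P \x mu)%E.-integrable setT F.
  apply/integrableP; split => //.
  rewrite (_ : (\int[_]_x _)%E = (\int[P]_w \int[mu]_x `|F (w, x)|)%E); last first.
    rewrite fubini_tonelli1//; exact: measurableT_comp.
  apply: (@le_lt_trans _ _ (\int[P]_w (K%:E * (expR (k * U w))%:E))%E).
    apply: ge0_le_integral => //.
    - by move=> w _; exact: integral_ge0.
    - apply: (@measurable_fun_fubini_tonelli_F _ _ _ _ _ mu (fun p => `|F p|)%E) => //.
      exact: measurableT_comp.
    - apply: emeasurable_funM => //; apply/measurable_EFinP; apply: measurableT_comp => //.
      exact: measurable_funM.
    - by move=> w _; rewrite -EFinM; exact: Gk.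
  rewrite ge0_integralZl_EFin//.
    by rewrite lte_mul_pinfty// ?lee_fin//; exact: expU.
  by apply/measurable_EFinP; apply: measurableT_comp => //; exact: measurable_funM.
transitivity (\int[mu]_x fubini_G P F x)%E.
  apply: eq_integral => x _; rewrite /fubini_G /F/= -integralZl//.
  suff : P.-integrable setT (EFin \o (fun w => kern w x)) by [].
  apply: measurable_bounded_integrable => //.
  - by rewrite /= probability_setT ltry.
  - exact: (mkern (X := cst x)).
  - exists v0^-1; split; first exact: num_real.
    by move=> M vM w _; exact: le_trans (kern_bounded w x) (ltW vM).
rewrite fubini2// -fubini1//.
rewrite -ge0_integralZl//; last 2 first.
- exact: measurable_lognormal_mean.
- by move=> w _; apply: integral_ge0 => x _; rewrite lee_fin mulr_ge0// lognormal_pdf_ge0.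
apply: eq_integral => w _; rewrite /fubini_F /F/=.
have s0 : 0 < Num.sqrt (U w) by rewrite sqrtr_gt0.
rewrite (integration_by_parts_gauss mg g0 a0 C0 gC s0); last first.
  apply/integrableP; split.
    by apply/measurable_EFinP; exact: (mGk w).
  by apply: le_lt_trans (Gk w) _; rewrite ltry.
rewrite /lognormal_mean -ge0_integralZl//; last 2 first.
- apply/measurable_EFinP; apply: measurable_funM => //; exact: measurable_lognormal_pdf.
- by move=> x _; rewrite lee_fin mulr_ge0// lognormal_pdf_ge0.
by apply: eq_integral => x _; rewrite gauss_primitive_lognormal// -EFinM mulrCA.
Qed.

End expected_gauss_kernel.

(** * Weak error of the discretization *)

Lemma abse_sub_le (R : realType) (x y : \bar R) (e : R) :
  x \is a fin_num -> y \is a fin_num ->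
  (x <= y + e%:E -> y <= x + e%:E -> `|x - y| <= e%:E)%E.
Proof.
case: x y => [x||] [y||]// _ _; rewrite -EFinB abse_EFin -!EFinD !lee_fin => xy yx.
by rewrite ler_norml; apply/andP; split; lra.
Qed.

Theorem theorem5p3 (R : realType) (d : measure_display)
    (Omega : measurableType d) (P : probability Omega R)
    (T H b alpha S0 Y0 r : R) (f sigma : R -> R)
    (W B : R -> {RV P >-> R}) (Y : R -> Omega -> R) (Z : R -> {RV P >-> R})
    (T_gt0 : 0 < T) (H_itv : 2^-1 < H < 1) (alpha_gt0 : 0 < alpha)
    (S0_gt0 : 0 < S0)
    (W_wiener : standard_wiener T W)
    (B_fbm : fractional_brownian T H B)
    (WB_indep : independent_systems P (sigma_process W `[0, T])
                                      (sigma_process B `[0, T]))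
    (Y_fOU : fractional_OU T alpha Y0 B Y)
    (Z_ito : forall t, 0 <= t <= T ->
       is_ito_integral P (natural_filtration W B) W
         (fun s w => sigma (Y s w)) t (Z t))
    (condA : conditionA f) (condB : conditionB sigma r)
    (condC : conditionC P T sigma Y) :
  let X := log_price S0 b sigma Y Z in
  let g := fun y : R => f (expR y) in
  let G := primitive0 g in
  let sig2 := fun n => int_square T sigma (Yn T alpha Y0 B n) in
  let sig := fun n w => Num.sqrt (sig2 n w) in
  let m := fun n w => ln S0 + b * T - 2^-1 * sig2 n w in
  exists C : R, forall n : nat, (1 <= n)%N ->
    (`| 'E_P[fun w => g (X T w)]
        - ((2 * pi) `^ (- 2^-1))%:E *
          \int[lebesgue_measure]_x
             ((G x)%:E *
              'E_P[fun w => ((x - m n w) / (sig n w) ^+ 3 *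
                   expR (- ((x - m n w) ^+ 2 / (2 * (sig n w) ^+ 2))))%R]) |
     <= (C * n%:R `^ (- (r * H)))%:E)%E.
Proof.
move=> X g G sig2 sig m.
have [r01 [Csigma [C0 [[smin smin0 sigma_min] [q q01 sigma_growth] sigma_holder
  [sigma_cont _ _]]]]] := condB.
have [f0 mf [Cf [p [Cf0 p0 fC]]] _] := condA.
pose mu0 := ln S0 + b * T.
(* The function f is measurable on [0, +oo[ only, which is enough because the exponential takes its
   values there. *)
have mg : measurable_fun setT g.
  have mI : measurable (`[0, +oo[%classic : set R) by [].
  have mexp : measurable_fun setT (@expR R) by exact: measurable_expR.
  apply: (@measurable_comp _ _ _ _ _ _ _ f _ (@expR R) mI _ mf mexp).
  by move=> _ [x _ <-]; rewrite /= in_itv/= andbT expR_ge0.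
have g0 x : 0 <= g x by apply: f0; exact: expR_ge0.
(* Polynomial growth of f is exponential growth of g. The factor exp (p mu0) recenters the bound at
   mu0, and the constant 1 is absorbed because exp u + exp (- u) >= 1. *)
pose C := Cf * (1 + expR (p * mu0)).
have C_ge0 : 0 <= C by rewrite mulr_ge0 ?addr_ge0 ?expR_ge0// ltW.
have gC x : g x <= C * (expR (p * (x - mu0)) + expR (- p * (x - mu0))).
  apply: le_trans (fC _ (expR_ge0 x)) _; rewrite /C -mulrA ler_wpM2l ?(ltW Cf0)//.
  have -> : expR x `^ p = expR (p * mu0) * expR (p * (x - mu0)).
    by rewrite -expRD -expRM; congr expR; ring.
  set u := p * (x - mu0); rewrite mulNr -/u.
  have h : 1 <= expR u + expR (- u).
    have [u0|u0] := leP 0 u.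
      by apply: le_trans (_ : expR u <= _); rewrite ?lerDl ?expR_ge0// -expR0 ler_expR.
    apply: le_trans (_ : expR (- u) <= _); rewrite ?lerDr ?expR_ge0//.
    by rewrite -expR0 ler_expR oppr_ge0 ltW.
  have := expR_ge0 (p * mu0); have := expR_ge0 (- u); nra.
have [K K0 HK] := lognormal_mean_error T_gt0 H_itv alpha_gt0 smin0 C0 q01 r01 sigma_min
  sigma_growth sigma_holder sigma_cont B_fbm Y_fOU mg g0 (ltW p0) C_ge0 gC.
exists K => n n1; have [finY finYn leY leYn] := HK n n1.
have subYn := subgaussian_Yn Y0 T_gt0 H_itv alpha_gt0 B_fbm n1.
have eps0 : 0 < ou_exponent T H alpha by exact: ou_exponent_gt0.
have -> : ('E_P[fun w => g (X T w)] =
    \int[P]_w lognormal_mean g mu0 (int_square T sigma Y w))%E.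
  have T_itv : 0 <= T <= T by rewrite lexx ltW.
  rewrite expectation.unlock -(terminal_law T_gt0 H_itv alpha_gt0 smin0 C0 q01 r01 sigma_min
    sigma_growth sigma_holder sigma_cont W_wiener B_fbm WB_indep Y_fOU (Z := Z T) mu0
    (@measurable_funPT _ _ _ _ (Z T)) (Z_ito T T_itv) mg g0).
  apply: eq_integral => w _; congr (g _)%:E.
  rewrite /X /log_price /price lnM ?posrE ?expR_gt0// expRK /mu0; ring.
have vmin0 : 0 < smin ^+ 2 * T by rewrite mulr_gt0// exprn_gt0.
have mU : measurable_fun setT (sig2 n).
  exact: (measurable_int_square T_gt0 smin0 C0 q01 sigma_min sigma_growth sigma_cont subYn).
have U_ge w : smin ^+ 2 * T <= sig2 n w.
  exact: (int_square_ge T_gt0 smin0 C0 q01 sigma_min sigma_growth sigma_cont w subYn).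
have expU k : 0 <= k -> (\int[P]_w (expR (k * sig2 n w))%:E < +oo)%E.
  move=> k0; have [M M0 HM] := exp_int_square P T_gt0 smin0 C0 q01 sigma_min sigma_growth
    sigma_cont (4 * expR (2 * ou_exponent T H alpha * Y0 ^+ 2)) eps0 k0.
  exact: le_lt_trans (HM _ subYn) (ltry _).
have -> : (\int[lebesgue_measure]_x ((G x)%:E *
      'E_P[fun w => ((x - m n w) / (sig n w) ^+ 3 *
        expR (- ((x - m n w) ^+ 2 / (2 * (sig n w) ^+ 2))))%R]) =
    (Num.sqrt (2 * pi))%:E * \int[P]_w lognormal_mean g mu0 (sig2 n w))%E.
  rewrite -(integral_primitive_gauss_kernel mg g0 (ltW p0) C_ge0 vmin0 gC mU U_ge expU).
  apply: eq_integral => x _; rewrite expectation.unlock; congr (_ * _)%E.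
  by apply: eq_integral => w _; rewrite /gauss_kernel /m [_ / 2]mulrC.
have pi2 : 0 < 2 * pi :> R by rewrite mulr_gt0// pi_gt0.
have -> : (((2 * pi) `^ (- 2^-1))%:E * ((Num.sqrt (2 * pi))%:E *
    \int[P]_w lognormal_mean g mu0 (sig2 n w)) =
    \int[P]_w lognormal_mean g mu0 (sig2 n w))%E.
  rewrite muleA -EFinM powRN powR12_sqrt ?(ltW pi2)//.
  by rewrite mulVf ?mul1e// gt_eqF// sqrtr_gt0.
exact: abse_sub_le finY finYn leY leYn.
Qed.
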